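(* Let $r\ge1$ and let $N\subset A$ be a non-zero proper ideal satisfying the level assumption. The subschemes $\Omega_W$ of $Q_{A,V^r_N}$, for all non-zero free $A/N$-submodules $W\subset V^r_N$, are pairwise disjoint and their union is $Q_{A,V^r_N}$.
   Context: $\mathbb{F}_q$ is a finite field with $q$ elements. $A$ is an admissible coefficient ring containing $\mathbb{F}_q$, i.e. the ring of elements of a global function field $F\supset\mathbb{F}_q$ that are regular outside one fixed place $\infty$; so $F=\mathrm{Quot}(A)$. For $a\in A\setminus\{0\}$ put $\deg_A(a)=\dim_{\mathbb{F}_q}(A/(a))$, and $\deg_A(0)=-\infty$. For a non-zero ideal $N\subset A$ put $\mathrm{Div}(N)=\{a\in A\mid N\subset (a)\}$. Level assumption on a non-zero proper ideal $N\subset A$: there exists a subset $D\subset\mathrm{Div}(N)$ such that (i) for any $a\in A\setminus\{0\}$ there is $b\in A\setminus\{0\}$ which is a product of elements of $D$ with $\deg_A(a-b)<\deg_A(a)$; (ii) for any distinct $a,b\in D$ we have $ab\in\mathrm{Div}(N)$; (iii) any element of $\mathrm{Div}(N)$ is a product of elements of $D$; (iv) $N$ is principal. $V^r_N=(N^{-1}/A)^{\oplus r}$ and $V^r_a=(a^{-1}A/A)^{\oplus r}$ for $a\in A\setminus\{0\}$; for $a\in\mathrm{Div}(N)$ we have $V^r_a\subset V^r_N$. For a finite dimensional $\mathbb{F}_q$-vector space $V$ let $K_V$ be the field of quotients of the symmetric algebra of $V$ over $\mathbb{F}_q$, and $R_V\subset K_V$ the $\mathbb{F}_q$-subalgebra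 generated by all $\frac1v$, $v\in V\setminus\{0\}$, graded so that each $\frac1v$ has degree $1$. For $s\ge1$, $R_{A,V^s_N}$ is the graded factor ring of $R_{V^s_N}\otimes_{\mathbb{F}_q}F$ by the ideal generated by $\frac{1}{av}\otimes a-\sum_{v'\in V^s_a}\frac{1}{v-v'}\otimes 1$ for all $a\in\mathrm{Div}(N)$ and $v\in V^s_N\setminus V^s_a$; $[f]$ denotes the image of $f$. $RS_{A,V^s_N}$ is its localization obtained by inverting $[\frac1v\otimes1]$ for all $v\in V^s_N\setminus\{0\}$. $Q_{A,V^s_N}=\mathrm{Proj}(R_{A,V^s_N})$ and $\Omega_{A,V^s_N}=\mathrm{Proj}(RS_{A,V^s_N})$, an affine open subscheme of $Q_{A,V^s_N}$. For an injective $A$-linear map $i\colon V^s_N\hookrightarrow V^r_N$ with $1\le s\le r$ there is a surjective graded $F$-algebra homomorphism $\pi_i\colon R_{A,V^r_N}\to R_{A,V^s_N}$ sending $[\frac{1}{i(v')}\otimes1]$ to $[\frac1{v'}\otimes1]$ for $v'\in V^s_N\setminus\{0\}$ and $[\frac1v\otimes1]$ to $0$ for $v\in V^r_N\setminus i(V^s_N)$. It induces a closed embedding $\epsilon_i\colon Q_{A,V^s_N}\hookrightarrow Q_{A,V^r_N}$. For $W=i(V^s_N)$ put $\Omega_W=\epsilon_i(\Omega_{A,V^s_N})$; this depends only on $W$ and is the locally closed subscheme of $Q_{A,V^r_N}$ defined by the equations $[\frac1v\otimes1]=0$ for $v\in V^r_N\setminus W$ and the conditions $[\frac1v\otimes1]\ne0$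 for $v\in W\setminus\{0\}$. Every non-zero free $A/N$-submodule $W\subset V^r_N$ is of this form. *)

(* Defs.v *)
From HB Require Import structures.
From mathcomp Require Import all_boot all_algebra all_field.
From mathcomp Require Import ring_quotient.
From mathcomp Require Import finmap.
From mathcomp Require Import boolp classical_sets cardinality fsbigop.
From mathcomp Require Import monalg.
From mathcomp Require Import mpoly.

Set Implicit Arguments.
Unset Strict Implicit.
Unset Printing Implicit Defensive.

Import GRing.Theory.
Local Open Scope ring_scope.
Local Open Scope quotient_scope.

(** * Quotient modules *)

Section QuotientModule.
Variables (R : comNzRingType) (M : lmodType R) (S : {pred M}).
Variable (S_closed : submod_closed S).

Definition quotmod_pred of submod_closed S : {pred M} := S.
Local Notation U := (quotmod_pred S_closed).
HB.instance Definition _ := GRing.isZmodClosed.Build M U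
  (GRing.submod_closedB S_closed).

Definition quotmod : Type := Quotient.quot U.
HB.instance Definition _ := GRing.Zmodule.on quotmod.

Definition quotmod_pi (x : M) : quotmod := \pi_(Quotient.quot U) x.
Definition quotmod_scale (a : R) (m : quotmod) : quotmod :=
  quotmod_pi (a *: (repr (m : (Quotient.quot U)))).

Lemma quotmod_piP (x y : M) : quotmod_pi x = quotmod_pi y <-> x - y \in S.
Proof.
rewrite /quotmod_pi; split=> [/eqP|xy]; first by rewrite -Quotient.idealrBE.
by apply/eqP; rewrite -Quotient.idealrBE.
Qed.

Lemma quotmod_piK (m : quotmod) : quotmod_pi (repr (m : (Quotient.quot U))) = m.
Proof. exact: (@reprK _ (Quotient.quot U) m). Qed.

Lemma quotmod_piD x y : quotmod_pi (x + y) = quotmod_pi x + quotmod_pi y.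
Proof. by rewrite /quotmod_pi (raddfD (\pi_(Quotient.quot U))). Qed.

Lemma quotmod_piZ a x : quotmod_scale a (quotmod_pi x) = quotmod_pi (a *: x).
Proof.
apply/quotmod_piP; rewrite -scalerBr.
rewrite -[_ *: _]addr0; apply: S_closed.2; last exact: S_closed.1.
by apply/quotmod_piP; rewrite quotmod_piK.
Qed.

Fact quotmod_scaleA a b m :
  quotmod_scale a (quotmod_scale b m) = quotmod_scale (a * b) m.
Proof. by rewrite -(quotmod_piK m) !quotmod_piZ scalerA. Qed.
Fact quotmod_scale1 : left_id 1 quotmod_scale.
Proof. by move=> m; rewrite -(quotmod_piK m) quotmod_piZ scale1r. Qed.
Fact quotmod_scaleDr : right_distributive quotmod_scale +%R.
Proof.
move=> a m n; rewrite -(quotmod_piK m) -(quotmod_piK n).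
by rewrite -quotmod_piD !quotmod_piZ scalerDr quotmod_piD.
Qed.
Fact quotmod_scaleDl m : {morph quotmod_scale^~ m : a b / a + b}.
Proof.
by move=> a b; rewrite -(quotmod_piK m) !quotmod_piZ scalerDl quotmod_piD.
Qed.
HB.instance Definition _ := GRing.Zmodule_isLmodule.Build R quotmod
  quotmod_scaleA quotmod_scale1 quotmod_scaleDr quotmod_scaleDl.

End QuotientModule.

(** * Restriction of scalars *)

Definition restr (k R : comNzRingType) (f : {rmorphism k -> R}) (M : lmodType R) :
  Type := M.

Section Restrict.
Variables (k R : comNzRingType) (f : {rmorphism k -> R}) (M : lmodType R).

HB.instance Definition _ := GRing.Zmodule.on (restr f M).
Definition restr_scale (c : k) (m : restr f M) : restr f M := f c *: (m : M).
Fact restr_scaleA a b m : restr_scale a (restr_scale b m) = restr_scale (a * b) m.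
Proof. by rewrite /restr_scale scalerA rmorphM. Qed.
Fact restr_scale1 : left_id 1 restr_scale.
Proof. by move=> m; rewrite /restr_scale rmorph1 scale1r. Qed.
Fact restr_scaleDr : right_distributive restr_scale +%R.
Proof. by move=> a m n; apply: scalerDr. Qed.
Fact restr_scaleDl m : {morph restr_scale^~ m : a b / a + b}.
Proof. by move=> a b; rewrite /restr_scale rmorphD scalerDl. Qed.
HB.instance Definition _ := GRing.Zmodule_isLmodule.Build k (restr f M)
  restr_scaleA restr_scale1 restr_scaleDr restr_scaleDl.

End Restrict.

(** * Coordinates on a finite dimensional vector space *)

Section Coordinates.
Variables (k : fieldType) (V : lmodType k).

(* A chosen linear isomorphism of V with some k^n.  The default value is only
   taken when V is not finite dimensional. *)
Definition fdcoord : {n : nat & {linear V -> 'rV[k]_n}} :=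
  match pselect (exists c : {n : nat & {linear V -> 'rV[k]_n}},
                   bijective (projT2 c)) with
  | left h => projT1 (cid h)
  | right _ => existT _ 0%N (\0 : {linear V -> 'rV[k]_0})
  end.

Definition fdim : nat := projT1 fdcoord.
Definition fcoord : {linear V -> 'rV[k]_fdim} := projT2 fdcoord.

End Coordinates.

(** * Quotient of a commutative ring by the ideal generated by a set.
   The quotient may a priori be the zero ring, whence the [Pz] structures. *)

Section RingQuotient.
Variables (P : comPzRingType) (G : set P).

Inductive ideal_span : P -> Prop :=
| IdealSpan0 : ideal_span 0
| IdealSpanD a g x : G g -> ideal_span x -> ideal_span (a * g + x).

Definition ideal_spanb : {pred P} := fun x => `[< ideal_span x >].

Lemma ideal_spanD x y : ideal_span x -> ideal_span y -> ideal_span (x + y).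
Proof.
move=> xI yI; elim: xI => [|a g z Gg _ IH]; first by rewrite add0r.
by rewrite -addrA; apply: IdealSpanD.
Qed.

Lemma ideal_spanM a x : ideal_span x -> ideal_span (a * x).
Proof.
elim=> [|b g z Gg _ IH]; first by rewrite mulr0; apply: IdealSpan0.
by rewrite mulrDr mulrA; apply: IdealSpanD.
Qed.

Fact ideal_spanb_zmod : zmod_closed ideal_spanb.
Proof.
split=> [|x y /asboolP xI /asboolP yI]; apply/asboolP; first exact: IdealSpan0.
by rewrite -mulN1r; apply: ideal_spanD xI (ideal_spanM _ yI).
Qed.
HB.instance Definition _ := GRing.isZmodClosed.Build P ideal_spanb ideal_spanb_zmod.

Definition ringquot : Type := (Quotient.quot ideal_spanb).
HB.instance Definition _ := GRing.Zmodule.on ringquot.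

Definition ringquot_pi (x : P) : ringquot := \pi_(Quotient.quot ideal_spanb) x.
Definition ringquot_repr (m : ringquot) : P := repr (m : (Quotient.quot ideal_spanb)).
Definition ringquot_mul (m n : ringquot) : ringquot :=
  ringquot_pi (ringquot_repr m * ringquot_repr n).

Lemma ringquot_piP x y : ringquot_pi x = ringquot_pi y <-> ideal_span (x - y).
Proof.
rewrite /ringquot_pi; split=> [/eqP|xy].
  by rewrite -Quotient.idealrBE => /asboolP.
by apply/eqP; rewrite -Quotient.idealrBE; apply/asboolP.
Qed.

Lemma ringquot_piK m : ringquot_pi (ringquot_repr m) = m.
Proof. exact: (@reprK _ (Quotient.quot ideal_spanb) m). Qed.

Lemma ringquot_piD x y : ringquot_pi (x + y) = ringquot_pi x + ringquot_pi y.
Proof. by rewrite /ringquot_pi (raddfD (\pi_(Quotient.quot ideal_spanb))). Qed.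

Lemma ringquot_piM x y :
  ringquot_mul (ringquot_pi x) (ringquot_pi y) = ringquot_pi (x * y).
Proof.
have e z : ideal_span (ringquot_repr (ringquot_pi z) - z).
  by apply/ringquot_piP; rewrite ringquot_piK.
apply/ringquot_piP; set x' := ringquot_repr _; set y' := ringquot_repr _.
have -> : x' * y' - x * y = y' * (x' - x) + x * (y' - y).
  by rewrite !mulrBr [y' * x']mulrC [y' * x]mulrC addrA subrK.
by apply: ideal_spanD; apply: ideal_spanM; apply: e.
Qed.

Fact ringquot_mulA : associative ringquot_mul.
Proof.
move=> x y z; rewrite -(ringquot_piK x) -(ringquot_piK y) -(ringquot_piK z).
by rewrite !ringquot_piM mulrA.
Qed.
Fact ringquot_mulC : commutative ringquot_mul.
Proof. by move=> x y; rewrite /ringquot_mul mulrC. Qed.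
Fact ringquot_mul1 : left_id (ringquot_pi 1) ringquot_mul.
Proof. by move=> x; rewrite -(ringquot_piK x) ringquot_piM mul1r. Qed.
Fact ringquot_mulDl : left_distributive ringquot_mul +%R.
Proof.
move=> x y z; rewrite -(ringquot_piK x) -(ringquot_piK y) -(ringquot_piK z).
by rewrite -ringquot_piD !ringquot_piM mulrDl ringquot_piD.
Qed.
HB.instance Definition _ := GRing.Zmodule_isComPzRing.Build ringquot
  ringquot_mulA ringquot_mulC ringquot_mul1 ringquot_mulDl.

End RingQuotient.

(** * Localization of a commutative ring at the submonoid generated by a set *)

Section Localization.
Variables (R : comPzRingType) (G : set R).

Inductive submonoid : R -> Prop :=
| Submonoid1 : submonoid 1
| SubmonoidM g s : G g -> submonoid s -> submonoid (g * s).

Lemma submonoidM s t : submonoid s -> submonoid t -> submonoid (s * t).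
Proof.
move=> sS tS; elim: sS => [|g z Gg _ IH]; first by rewrite mul1r.
by rewrite -mulrA; apply: SubmonoidM.
Qed.

Definition denom : Type := {s : R | `[< submonoid s >]}.
HB.instance Definition _ := Choice.on denom.
Lemma denomP (s : denom) : submonoid (val s).
Proof. exact/asboolP/(valP s). Qed.
Definition mkdenom s (sS : submonoid s) : denom :=
  exist _ s (introT (asboolP _) sS).

Definition loc_equiv (x y : R * denom) : bool :=
  `[< exists2 u, submonoid u & u * (x.1 * val y.2) = u * (y.1 * val x.2) >].

Fact loc_equiv_class : equiv_class_of loc_equiv.
Proof.
split=> [x|x y|y x z]; first by apply/asboolP; exists 1; first exact: Submonoid1.
  by apply/asboolP/asboolP=> -[u uS e]; exists u.
move=> /asboolP[u uS e] /asboolP[w wS e']; apply/asboolP.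
exists (u * w * val y.2); first by do 2?apply: submonoidM => //; apply: denomP.
have -> : u * w * val y.2 * (x.1 * val z.2) =
          w * val z.2 * (u * (x.1 * val y.2)).
  by rewrite [LHS](AC (3*2) ((2*5)*(1*(4*3))))/=.
rewrite e.
have -> : w * val z.2 * (u * (y.1 * val x.2)) =
          u * val x.2 * (w * (y.1 * val z.2)).
  by rewrite [LHS](AC (2*(1*2)) ((3*5)*(1*(4*2))))/=.
by rewrite e' [LHS](AC (2*(1*2)) ((1*3*5)*(4*2)))/=.
Qed.
Canonical loc_equiv_equiv := EquivRelPack loc_equiv_class.
Canonical loc_equiv_encModRel := defaultEncModRel loc_equiv.

Definition loc : Type := {eq_quot loc_equiv}.
HB.instance Definition _ := Choice.on loc.

Definition loc_pi (x : R * denom) : loc := \pi_{eq_quot loc_equiv} x.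
Definition loc_repr (m : loc) : R * denom := repr (m : {eq_quot loc_equiv}).
Definition loc_frac (x : R) (s : denom) : loc := loc_pi (x, s).

Lemma loc_piK m : loc_pi (loc_repr m) = m.
Proof. exact: (@reprK _ {eq_quot loc_equiv} m). Qed.

Lemma loc_piP x y : loc_pi x = loc_pi y <->
  exists2 u, submonoid u & u * (x.1 * val y.2) = u * (y.1 * val x.2).
Proof. by split=> [/eqmodP/asboolP|e] //; apply/eqmodP/asboolP. Qed.

Definition loc_one : denom := mkdenom Submonoid1.
Definition loc_den (s t : denom) : denom := mkdenom (submonoidM (denomP s) (denomP t)).

Definition loc_add0 (x y : R * denom) : R * denom :=
  (x.1 * val y.2 + y.1 * val x.2, loc_den x.2 y.2).
Definition loc_opp0 (x : R * denom) : R * denom := (- x.1, x.2).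
Definition loc_mul0 (x y : R * denom) : R * denom :=
  (x.1 * y.1, loc_den x.2 y.2).

Definition loc_add m n := loc_pi (loc_add0 (loc_repr m) (loc_repr n)).
Definition loc_opp m := loc_pi (loc_opp0 (loc_repr m)).
Definition loc_mul m n := loc_pi (loc_mul0 (loc_repr m) (loc_repr n)).

Lemma loc_reprP x :
  exists2 u, submonoid u &
    u * ((loc_repr (loc_pi x)).1 * val x.2) =
    u * (x.1 * val (loc_repr (loc_pi x)).2).
Proof. by apply/loc_piP; rewrite loc_piK. Qed.

Lemma loc_addE x y : loc_add (loc_pi x) (loc_pi y) = loc_pi (loc_add0 x y).
Proof.
apply/loc_piP; case: (loc_reprP x) (loc_reprP y) => [u uS e] [w wS e'].
exists (u * w); first exact: submonoidM.
move: (loc_repr (loc_pi x)) (loc_repr (loc_pi y)) e e' => [a s] [b t] /=.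
case: x y => [a' s'] [b' t'] /= e e'.
rewrite !mulrDl !mulrDr; congr (_ + _).
  rewrite [LHS](AC (2*(2*2)) ((2*4*6)*(1*(3*5))))/=.
  by rewrite e [RHS](AC (2*(2*2)) ((2*6*4)*(1*(3*5))))/=.
rewrite [LHS](AC (2*(2*2)) ((1*4*5)*(2*(3*6))))/=.
by rewrite e' [RHS](AC (2*(2*2)) ((1*5*4)*(2*(3*6))))/=.
Qed.

Lemma loc_oppE x : loc_opp (loc_pi x) = loc_pi (loc_opp0 x).
Proof.
apply/loc_piP; case: (loc_reprP x) => [u uS e]; exists u => //=.
by rewrite !mulNr !mulrN e.
Qed.

Lemma loc_mulE x y : loc_mul (loc_pi x) (loc_pi y) = loc_pi (loc_mul0 x y).
Proof.
apply/loc_piP; case: (loc_reprP x) (loc_reprP y) => [u uS e] [w wS e'].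
exists (u * w); first exact: submonoidM.
move: (loc_repr (loc_pi x)) (loc_repr (loc_pi y)) e e' => [a s] [b t] /=.
case: x y => [a' s'] [b' t'] /= e e'.
rewrite [LHS](AC (2*(2*2)) ((1*(3*5))*(2*(4*6))))/= e e'.
by rewrite [RHS](AC (2*(2*2)) ((1*(3*5))*(2*(4*6))))/=.
Qed.

Lemma loc_eq1 x y : x.1 * val y.2 = y.1 * val x.2 -> loc_pi x = loc_pi y.
Proof. by move=> e; apply/loc_piP; exists 1; [exact: Submonoid1|rewrite e]. Qed.

Fact loc_addA : associative loc_add.
Proof.
move=> x y z; rewrite -(loc_piK x) -(loc_piK y) -(loc_piK z) !loc_addE.
apply: loc_eq1 => /=; congr (_ * _); last by rewrite mulrA.
by rewrite !mulrDl !mulrA -addrA; congr (_ + (_ + _)); rewrite mulrAC.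
Qed.
Fact loc_addC : commutative loc_add.
Proof.
move=> x y; rewrite -(loc_piK x) -(loc_piK y) !loc_addE.
by apply: loc_eq1 => /=; rewrite addrC [val (loc_repr y).2 * _]mulrC.
Qed.
Fact loc_add0l : left_id (loc_frac 0 loc_one) loc_add.
Proof.
move=> x; rewrite -(loc_piK x) loc_addE; apply: loc_eq1 => /=.
by rewrite mul0r add0r mulr1 mul1r.
Qed.
Fact loc_addNl : left_inverse (loc_frac 0 loc_one) loc_opp loc_add.
Proof.
move=> x; rewrite -(loc_piK x) loc_oppE loc_addE; apply: loc_eq1 => /=.
by rewrite mulNr addNr !mul0r.
Qed.
HB.instance Definition _ := GRing.isZmodule.Build loc
  loc_addA loc_addC loc_add0l loc_addNl.

Fact loc_mulA : associative loc_mul.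
Proof.
move=> x y z; rewrite -(loc_piK x) -(loc_piK y) -(loc_piK z) !loc_mulE.
by apply: loc_eq1 => /=; rewrite !mulrA.
Qed.
Fact loc_mulC : commutative loc_mul.
Proof.
move=> x y; rewrite -(loc_piK x) -(loc_piK y) !loc_mulE; apply: loc_eq1 => /=.
by rewrite [_.1 * _]mulrC [val (loc_repr y).2 * _]mulrC.
Qed.
Fact loc_mul1l : left_id (loc_frac 1 loc_one) loc_mul.
Proof.
move=> x; rewrite -(loc_piK x) loc_mulE; apply: loc_eq1 => /=.
by rewrite !mul1r.
Qed.
Fact loc_mulDl : left_distributive loc_mul loc_add.
Proof.
move=> x y z; rewrite -(loc_piK x) -(loc_piK y) -(loc_piK z).
rewrite !(loc_addE, loc_mulE); apply: loc_eq1 => /=.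
rewrite !mulrDl; congr (_ + _).
  rewrite [LHS](AC (3*(2*2)) ((1*3)*(4*2*6*5*7)))/=.
  by rewrite [RHS](AC (2*2*3) ((1*2)*(5*3*6*4*7)))/=.
rewrite [LHS](AC (3*(2*2)) ((1*3)*(2*4*6*5*7)))/=.
by rewrite [RHS](AC (2*2*3) ((1*2)*(3*5*6*4*7)))/=.
Qed.
HB.instance Definition _ := GRing.Zmodule_isComPzRing.Build loc
  loc_mulA loc_mulC loc_mul1l loc_mulDl.

End Localization.

(** * The algebra [R_V] of a finite dimensional vector space [V] *)

Section RV.
Variables (k : fieldType) (V : lmodType k).

(* The symmetric algebra of V is the polynomial ring on a basis of V, and
   [linform v] is the image of v in it. *)
Local Notation symV := (mpoly.mpoly (fdim V) k).
Definition linform (v : V) : symV :=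
  \sum_(i < fdim V) fcoord V v 0 i *: 'X_i.

Definition KV : fieldType := {fraction symV}.
Definition KV_const (c : k) : KV := tofrac (mpolyC (fdim V) c).
Definition KV_inv (v : V) : KV := (tofrac (linform v))^-1.

Inductive RV_gen : KV -> Prop :=
| RVgenC c : RV_gen (KV_const c)
| RVgenV v : v != 0 -> RV_gen (KV_inv v)
| RVgenD x y : RV_gen x -> RV_gen y -> RV_gen (x + y)
| RVgenM x y : RV_gen x -> RV_gen y -> RV_gen (x * y).

Definition RV_pred : {pred KV} := fun x => `[< RV_gen x >].

Fact RV_subring : subring_closed RV_pred.
Proof.
have C1 : KV_const 1 = 1 by rewrite /KV_const mpolyC1 tofrac1.
have CN1 : KV_const (-1) = -1.
  by rewrite /KV_const mpolyCN tofracN mpolyC1 tofrac1.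
split=> [|x y /asboolP xR /asboolP yR|x y /asboolP xR /asboolP yR].
- by apply/asboolP; rewrite -C1; apply: RVgenC.
- apply/asboolP; have -> : x - y = x + KV_const (-1) * y by rewrite CN1 mulN1r.
  by apply: RVgenD xR (RVgenM _ yR); apply: RVgenC.
- exact/asboolP/RVgenM.
Qed.

Record RV := MkRV { RV_val : KV; RV_valP : RV_val \in RV_pred }.
HB.instance Definition _ := [isSub for RV_val].
HB.instance Definition _ := [Choice of RV by <:].
HB.instance Definition _ := GRing.SubChoice_isSubComNzRing.Build
  KV RV_pred RV RV_subring.

Fact RV_const_in c : KV_const c \in RV_pred.
Proof. exact/asboolP/RVgenC. Qed.
Definition RV_const (c : k) : RV := MkRV (RV_const_in c).

Fact RV_inv_in v : KV_inv v \in RV_pred.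
Proof.
apply/asboolP; have [->|v0] := eqVneq v 0; last exact: RVgenV.
have -> : KV_inv 0 = KV_const 0; last exact: RVgenC.
rewrite /KV_inv /linform raddf0 big1 => [|i _]; last by rewrite mxE scale0r.
by rewrite /KV_const mpolyC0 tofrac0 invr0.
Qed.
(* The element 1/v, to be used for v != 0. *)
Definition RV_inv (v : V) : RV := MkRV (RV_inv_in v).

End RV.

(** * Tensor products of commutative algebras over a field *)

Section Tensor.
Variables (k : fieldType) (B C : comNzRingType) (f : k -> B) (g : k -> C).

(* B (x)_k C as the base change of B to C, i.e. the C-algebra with generators
   b (x) 1 subject to the relations saying that b |-> b (x) 1 is a homomorphism
   of k-algebras. *)
Local Notation polyB := {malg C[{cmonom B}]}.
Definition tensor_var (b : B) : polyB := << 1 *g ucm b >>.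

Inductive tensor_rel : polyB -> Prop :=
| TensorD b b' :
    tensor_rel (tensor_var (b + b') - (tensor_var b + tensor_var b'))
| TensorM b b' : tensor_rel (tensor_var (b * b') - tensor_var b * tensor_var b')
| TensorC c : tensor_rel (tensor_var (f c) - (g c)%:A).

Definition tensor : Type := ringquot tensor_rel.
HB.instance Definition _ := GRing.ComPzRing.on tensor.
Definition tens (b : B) (c : C) : tensor :=
  ringquot_pi tensor_rel (c *: tensor_var b).

End Tensor.

(** * Homogeneous prime spectra *)

Section Proj.
Variables (R : comPzRingType) (gr : int -> set R).

(* The points of Proj R, where [gr d] is the homogeneous part of degree d of the
   graded ring R: the homogeneous primes not containing all elements of positive
   degree.  This is used both for N-graded rings (with [gr d = 0] for d < 0) and
   for the Z-graded localizations below. *)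
Definition Proj (p : set R) : Prop :=
  [/\ p 0 /\ (forall x y, p x -> p y -> p (x + y)),
      (forall a x, p x -> p (a * x)),
      ~ p 1 /\ (forall x y, p (x * y) -> p x \/ p y),
      (forall x, p x -> exists s : seq R, x = \sum_(y <- s) y /\
         forall y, y \in s -> p y /\ exists d, gr d y)
    & exists (d : int) (x : R), [/\ 0 < d, gr d x & ~ p x]].

End Proj.

(** * Global function fields and their coefficient rings *)

(* A global function field containing k is a finite extension F of k(t). *)
Section FunctionField.
Variables (k : finFieldType) (F : fieldExtType {fraction {poly k}}).

Definition constF : {rmorphism k -> F} :=
  GRing.in_alg F \o (tofrac (R:={poly k}) \o polyC).

(* A place is given by its valuation ring. *)
Record place := Place {
  vring : {pred F};
  vring_subring : subring_closed vring;
  vring_const : forall c, constF c \in vring;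
  vring_total : forall x, x \in vring \/ x^-1 \in vring;
  vring_proper : exists x, x \notin vring }.

Variable oo : place.

Definition regular : {pred F} :=
  fun x => `[< forall P : place, ~ (vring P =i vring oo) -> x \in vring P >].

Fact regular_subring : subring_closed regular.
Proof.
split=> [|x y /asboolP xA /asboolP yA|x y /asboolP xA /asboolP yA];
  apply/asboolP => P Poo; have [P1 PB PM] := vring_subring P => //.
- by apply: PB; [apply: xA|apply: yA].
- by apply: PM; [apply: xA|apply: yA].
Qed.

(* The ring of elements of F that are regular outside the place oo. *)
Record coefring := Coef { coef_val :> F; coef_valP : coef_val \in regular }.
HB.instance Definition _ := [isSub for coef_val].
HB.instance Definition _ := [Choice of coefring by <:].
HB.instance Definition _ := GRing.SubChoice_isSubComNzRing.Build
  F regular coefring regular_subring.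

Local Notation A := coefring.

Fact constA_in c : constF c \in regular.
Proof. by apply/asboolP=> P _; apply: vring_const. Qed.
Definition constA (c : k) : A := Coef (constA_in c).
Fact constA_zmod : zmod_morphism constA.
Proof. by move=> x y; apply: val_inj; rewrite [RHS]rmorphB; apply: rmorphB. Qed.
Fact constA_monoid : monoid_morphism constA.
Proof.
split=> [|x y]; apply: val_inj; first by rewrite [RHS]rmorph1; apply: rmorph1.
by rewrite [RHS]rmorphM; apply: rmorphM.
Qed.
HB.instance Definition _ := GRing.isZmodMorphism.Build k A constA constA_zmod.
HB.instance Definition _ := GRing.isMonoidMorphism.Build k A constA constA_monoid.

Definition principal (a : A) : set A := fun x => exists y, x = y * a.

Definition multiples (a : A) : {pred A^o} := fun x => `[< principal a x >].
Fact multiples_closed a : submod_closed (multiples a).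
Proof.
split=> [|b x y /asboolP[x' ->] /asboolP[y' ->]]; apply/asboolP.
  by exists 0; rewrite mul0r.
by exists (b * x' + y'); rewrite mulrDl -mulrA.
Qed.

(* dim_k (A / (a)), for a != 0. *)
Definition degA (a : A) : nat :=
  fdim (restr constA (quotmod (multiples_closed a))).

(* deg_A x < deg_A y, where deg_A 0 = -oo. *)
Definition degA_lt (x y : A) : bool :=
  (y != 0) && ((x == 0) || (degA x < degA y)%N).

Definition nonzero_proper_ideal (N : set A) : Prop :=
  [/\ N 0 /\ (forall x y, N x -> N y -> N (x + y)),
      (forall a x, N x -> N (a * x)),
      (exists2 x, N x & x != 0)
    & ~ N 1].

Definition Div (N : set A) : set A := fun a => forall x, N x -> principal a x.

(* [submonoid D b] says that b is a finite, possibly empty, product of elements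
   of D. *)
Definition level_assumption (N : set A) : Prop :=
  exists D : set A,
  [/\ (forall d, D d -> Div N d),
      (forall a, a != 0 -> exists b, [/\ b != 0, submonoid D b & degA_lt (a - b) a]),
      (forall a b, D a -> D b -> a <> b -> Div N (a * b)),
      (forall a, Div N a -> submonoid D a)
    & (exists n, forall x, N x <-> principal n x)].

(** ** The modules [V^r_N] *)

Definition Fmod : Type := restr (val : {rmorphism A -> F}) F^o.
HB.instance Definition _ := GRing.Lmodule.on Fmod.

Fact regular_closed : @submod_closed A Fmod regular.
Proof.
have [A1 AB AM] := regular_subring.
have AN x : x \in regular -> - x \in regular.
  by move=> xA; rewrite -sub0r -(subrr x); apply: (AB) => //; apply: AB.
split=> [|a x y xA yA]; first by rewrite -(subrr 1); apply: AB.
rewrite -[y]opprK; apply: (AB); last exact: AN.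
exact: AM (coef_valP a) xA.
Qed.

Definition FmodA : Type := quotmod regular_closed.
HB.instance Definition _ := GRing.Lmodule.on FmodA.
Definition toFmodA (x : F) : FmodA := quotmod_pi regular_closed x.

Section Level.
Variable N : set A.

Definition inv_ideal : set F := fun x => forall a : A, N a -> coef_val a * x \in regular.

Definition VN_pred : {pred FmodA} :=
  fun m => `[< exists2 x, inv_ideal x & m = toFmodA x >].

Fact VN_closed : submod_closed VN_pred.
Proof.
have [A0 AL] := regular_closed.
have [_ _ AM] := regular_subring.
split=> [|a m n /asboolP[x xN ->] /asboolP[y yN ->]]; apply/asboolP.
  exists 0; first by move=> a _; rewrite mulr0.
  by apply: (addIr (toFmodA 0)); rewrite add0r -quotmod_piD addr0.
exists (coef_val a * x + y); last first.
  by rewrite /toFmodA quotmod_piD; congr (_ + _); apply: quotmod_piZ.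
move=> b bN; rewrite mulrDr mulrCA.
exact: (AL a _ _ (xN b bN) (yN b bN)).
Qed.

(* N^-1 / A, as a submodule of F / A. *)
Record VN := MkVN { VN_val : FmodA; VN_valP : VN_val \in VN_pred }.
HB.instance Definition _ := [isSub for VN_val].
HB.instance Definition _ := [Choice of VN by <:].
HB.instance Definition _ := GRing.SubChoice_isSubLmodule.Build
  A FmodA VN_pred VN VN_closed.

Definition VNr (r : nat) : lmodType A := {ffun 'I_r -> VN}.

(* V^r_a = (a^-1 A / A)^r inside V^r_N, for a in Div(N). *)
Definition Va (r : nat) (a : A) : set (VNr r) :=
  fun v => forall j, exists2 x : F,
    coef_val a * x \in regular & VN_val ((v : {ffun 'I_r -> VN}) j) = toFmodA x.

(** ** The rings [R_{A,V^r_N}] and [RS_{A,V^r_N}] *)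

Section Rings.
Variable r : nat.

Definition RVF : comPzRingType :=
  tensor (@RV_const k (restr constA (VNr r))) constF.
Definition RVF_inv (v : VNr r) (x : F) : RVF :=
  tens (@RV_const k (restr constA (VNr r))) constF
    (RV_inv (v : restr constA (VNr r))) x.

Inductive RA_rel : RVF -> Prop :=
| RArel (a : A) (v : VNr r) : Div N a -> ~ Va a v ->
    RA_rel (RVF_inv (a *: v) (coef_val a)
            - \sum_(v' \in @Va r a) RVF_inv (v - v') 1).

Definition RA : comPzRingType := ringquot RA_rel.
(* [1/v (x) 1], for v != 0. *)
Definition RA_inv (v : VNr r) : RA := ringquot_pi RA_rel (RVF_inv v 1).
Definition RA_const (x : F) : RA :=
  ringquot_pi RA_rel (tens (@RV_const k (restr constA (VNr r))) constF 1 x).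

Inductive RA_homog (n : nat) : RA -> Prop :=
| RAhomog0 : RA_homog n 0
| RAhomogD (c : F) (s : seq (VNr r)) y :
    size s = n -> {in s, forall v, v != 0} -> RA_homog n y ->
    RA_homog n (RA_const c * \prod_(v <- s) RA_inv v + y).

(* The F-span of the products of n elements [1/v (x) 1] is the image of the part of
   degree n of R_V (x) F. *)
Definition RA_gr (d : int) : set RA :=
  fun x => if d is Posz n then RA_homog n x else x = 0.

Definition RA_invs : set RA := fun x => exists2 v, v != 0 & x = RA_inv v.
Definition RSA : comPzRingType := loc RA_invs.
Definition RSA_of (x : RA) : RSA := loc_frac x (loc_one RA_invs).

(* Z-grading of the localization: a quotient x / (1/v_1 ... 1/v_m) with x
   homogeneous of degree n has degree n - m. *)
Definition RSA_gr (d : int) : set RSA :=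
  fun y => exists n (x : RA) (s : seq (VNr r)),
    [/\ d = n%:Z - (size s)%:Z, RA_homog n x, {in s, forall v, v != 0}
      & y * RSA_of (\prod_(v <- s) RA_inv v) = RSA_of x].

(* The underlying set of Q_{A,V^r_N}. *)
Definition QA : set (set RA) := Proj RA_gr.
(* The underlying set of the open subscheme Omega_{A,V^r_N} of Q_{A,V^r_N}: the
   image of Proj(RS) in Proj(R) under contraction of primes. *)
Definition Omega : set (set RA) :=
  fun p => exists2 q, Proj RSA_gr q & forall x, p x <-> q (RSA_of x).

End Rings.

(** ** The strata *)

Section Strata.
Variables (s r : nat) (i : {linear VNr s -> VNr r}).

(* f is the homomorphism pi_i; it is determined by these values, and they force it
   to be graded and surjective. *)
Definition is_pi (f : {rmorphism RA r -> RA s}) : Prop :=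
  [/\ (forall c, f (RA_const r c) = RA_const s c),
      (forall v, v != 0 -> f (RA_inv (i v)) = RA_inv v)
    & (forall v, (forall v', i v' <> v) -> f (RA_inv v) = 0)].

(* The image of Omega_{A,V^s_N} under the closed embedding given by contraction of
   primes along pi_i. *)
Definition eps_Omega : set (set (RA r)) :=
  fun p => exists f : {rmorphism RA r -> RA s}, is_pi f /\
    exists2 q, Omega q & forall x, p x <-> q (f x).

End Strata.

(* Omega_W = eps_i(Omega_{A,V^s_N}) for any injective A-linear i with image W. *)
Definition OmegaW (r : nat) (W : set (VNr r)) : set (set (RA r)) :=
  fun p => exists s (i : {linear VNr s -> VNr r}),
    [/\ (1 <= s <= r)%N, injective i, (forall v, W v <-> exists v', i v' = v)
      & eps_Omega i p].

(* Non-zero A-submodules W of V^r_N that are free as A/N-modules, i.e. in which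
   some w_1, ..., w_n generate and have no relations except those with
   coefficients in N.  (N annihilates V^r_N, and V^r_N is finite.) *)
Definition nonzero_free_submodule (r : nat) (W : set (VNr r)) : Prop :=
  (exists2 v, W v & v != 0) /\
  exists n (w : 'I_n -> VNr r),
    (forall v, W v <-> exists c : 'I_n -> A, v = \sum_j c j *: w j) /\
    (forall c : 'I_n -> A, \sum_j c j *: w j = 0 -> forall j, N (c j)).

End Level.
End FunctionField.

(* Main.v *)
(* Let [p] be a point of [Q_{A,V^r_N}], with residue homomorphism [kappa]; put
   [rho v = kappa (1/v)] and [W = {0} \cup {v | rho v <> 0}].  Since
   [1/v 1/w = 1/(v+w) (1/v + 1/w)], the set [W] is a subgroup on which
   [lambda = 1/rho] is additive and injective.  For a divisor [a] of the generator
   [n] of [N], the relations of [R_{A,V^r_N}] state that the additive polynomial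
   [phi_a] with linear coefficient [a] and set of roots [lambda(W[a])] satisfies
   [phi_a(lambda w) = lambda(a w)].  By the level assumption the [phi_a] extend to
   a ring homomorphism [Phi] from [A] to the additive polynomials (a Drinfeld
   module), with [deg Phi_n = |W|].  Comparing the degrees of the [Phi_a] with
   numbers of torsion points shows that [W] is free over [A/N].  A basis of [W] is
   an embedding [i] with image [W]; as [kappa (1/v) = 0] for [v] outside [W], the
   map [kappa] factors through [pi_i] and [p] lies on [Omega_W].  Conversely, a
   point of [Omega_W] determines [W] as [{0} \cup {v | 1/v \notin p}]. *)
Require Import Defs.
From HB Require Import structures.
From mathcomp Require Import all_boot all_algebra all_field all_fingroup all_solvable.
From mathcomp Require Import finmap.
From mathcomp Require Import boolp classical_sets cardinality fsbigop.
From mathcomp Require Import monalg.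
From mathcomp Require Import mpoly.

Set Implicit Arguments.
Unset Strict Implicit.
Unset Printing Implicit Defensive.

Import GRing.Theory.
Local Open Scope ring_scope.

(** * Additive polynomials *)

(** The degree of [Phi a] is tied to torsion only when a divides n, so the freeness of W cannot be
    read off from a rank. Write #|A/nA| = l^sg and #|W| = l^up; the expected rank up/sg is at first
    just a rational number. For a maximal ideal P annihilating a nonzero element of A/nA, the
    torsion W[P] is bounded by counting: there are #|A/nA|^j expansions of length j in base n, two
    of them agree modulo P^m once j is large compared with m, and [Phi] of their difference has
    degree O(#|W|^j) but at least #|W[P]|^m roots. In the limit, #|W[P]|^sg <= #|A/P|^up. A
    devissage carries the bound over to all torsion submodules of W; being an equality for W itself,
    it becomes a lower bound for quotients of W, and this allows an independent family to be
    extended until it spans W. The place of Dedekind theory is taken by one fact, [int_closed],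
    drawn from the valuation rings of F. The other obstacle is that R_V is a subring of a field and
    not given by generators and relations; homomorphisms out of it are obtained by specializing
    rational functions. *)

Lemma deriv_prod_XaddC (R : fieldType) (I : Type) (s : seq I) (P : pred I) (f : I -> R) :
  (forall i, P i -> f i != 0) ->
  (\prod_(i <- s | P i) ('X + (f i)%:P))`_1 =
  (\prod_(i <- s | P i) f i) * \sum_(i <- s | P i) (f i)^-1.
Proof.
move=> f0; elim: s => [|i s IH]; first by rewrite !big_nil mulr0 coefC.
rewrite !big_cons; case: ifP => [Pi|//].
set q := \prod_(_ <- _ | _) ('X + _) in IH *.
have q0 : q`_0 = \prod_(j <- s | P j) f j.
  by rewrite -horner_coef0 horner_prod; apply: eq_bigr => j _; rewrite hornerD hornerX hornerC add0r.
rewrite mulrDl coefD coefXM coefCM /= IH q0 mulrDr mulrA; congr (_ + _).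
by rewrite mulrAC mulfV ?f0 // mul1r.
Qed.

Lemma size_monicB (R : nzRingType) (p q : {poly R}) :
  p \is monic -> q \is monic -> size p = size q -> (size (p - q)%R < size p)%N.
Proof.
move=> pm qm e.
have p0 : (0 < size p)%N by rewrite size_poly_gt0 monic_neq0.
rewrite -(prednK p0) ltnS; apply/leq_sizeP => j; rewrite leq_eqVlt => /orP[/eqP<-|lt].
  rewrite coefB; have := monicP pm; rewrite lead_coefE => ->.
  by rewrite e; have := monicP qm; rewrite lead_coefE => ->; rewrite subrr.
rewrite (prednK p0) in lt.
by rewrite coefB !nth_default ?subrr // -e.
Qed.

(** Additivity is demanded over every extension of K, since over a finite K additivity at the points
    of K gives no identity of polynomials. It is used over the rational function field and over
    fields with adjoined roots. *)
Definition additive_poly (K : fieldType) (P : {poly K}) :=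
  forall (L : fieldType) (j : {rmorphism K -> L}) x y,
    (map_poly j P).[x + y] = (map_poly j P).[x] + (map_poly j P).[y].

Section ProdAdditive.
Variables (K : fieldType) (V : finZmodType) (U : {set V}) (l : V -> K).
Hypothesis U0 : 0 \in U.
Hypothesis UB : {in U &, forall u v, u - v \in U}.
Hypothesis lB : {in U &, forall u v, l (u - v) = l u - l v}.
Hypothesis lI : {in U &, injective l}.

Lemma prod_sub_shift (x y : K) v : v \in U ->
  \prod_(u in U) (l v + y - l u) = \prod_(u in U) (y - l u).
Proof.
move=> vU; have UN u : u \in U -> - u \in U by move=> uU; rewrite -sub0r UB.
have UD u w : u \in U -> w \in U -> u + w \in U.
  by move=> uU wU; rewrite -[w]opprK UB ?UN.
rewrite [LHS](reindex_inj (addIr v)) /=.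
apply: eq_big => [u|u uvU].
  by apply/idP/idP => uU; [rewrite -(addrK v u) UB|apply: UD].
have uU : u \in U by rewrite -(addrK v u) UB.
have -> : l (u + v) = l u + l v.
  have e : l (u + v - v) = l (u + v) - l v by rewrite lB.
  by rewrite addrK in e; rewrite e subrK.
by rewrite opprD addrA [_ + y]addrC addrAC addrK.
Qed.

(** As a polynomial in x, the defect e(x + y) - e(x) - e(y) has degree less than #|U|, because the
    leading terms cancel; and it vanishes at the #|U| distinct values of l, because translation by
    [l v] permutes the factors of e. *)
Lemma prod_XsubC_additive_at x y :
  (\prod_(u in U) ('X - (l u)%:P)).[x + y] =
  (\prod_(u in U) ('X - (l u)%:P)).[x] + (\prod_(u in U) ('X - (l u)%:P)).[y].
Proof.
set e := \prod_(u in U) _.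
pose e1 := \prod_(u in U) ('X - (l u - y)%:P).
have szU (f : V -> K) : size (\prod_(u in U) ('X - (f u)%:P)) = #|U|.+1.
  have -> : \prod_(u in U) ('X - (f u)%:P) = \prod_(z <- [seq f u | u in U]) ('X - z%:P).
    by rewrite big_image.
  by rewrite size_prod_XsubC size_map -cardE.
have U1 : (0 < #|U|)%N by apply/card_gt0P; exists 0.
have em : e \is monic by apply: monic_prod_XsubC.
have e1m : e1 \is monic by apply: monic_prod_XsubC.
pose Q := e1 - e - e.[y]%:P.
have szQ : (size Q <= #|U|)%N.
  apply: leq_trans (size_polyD _ _) _; rewrite geq_max size_polyN.
  rewrite (leq_trans (size_polyC_leq1 _)) // andbT -ltnS -(szU l).
  have -> : size (\prod_(u in U) ('X - (l u)%:P)) = size e1 by rewrite !szU.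
  by apply: size_monicB; rewrite ?szU.
have e1E z : e1.[z] = e.[z + y].
  by rewrite /e1 /e !horner_prod; apply: eq_bigr => u _; rewrite !hornerE opprB addrA.
have Q0 : Q = 0.
  apply/eqP; apply: contraLR szQ => Qn0; rewrite -ltnNge.
  have -> : #|U| = size [seq l u | u in U] by rewrite size_map -cardE.
  apply: max_poly_roots => //; last by rewrite map_inj_in_uniq ?enum_uniq // => u v;
    rewrite !mem_enum; apply: lI.
  apply/allP => z /mapP[v]; rewrite mem_enum => vU ->{z}; rewrite /root /Q !hornerE e1E.
  have -> : e.[l v + y] = e.[y].
    rewrite /e !horner_prod; under eq_bigr do rewrite hornerXsubC.
    by rewrite (prod_sub_shift 0) //; apply: eq_bigr => u _; rewrite !hornerE.
  have -> : e.[l v] = 0.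
    by rewrite /e horner_prod (bigD1 v) //= !hornerE subrr mul0r.
  by rewrite subr0 subrr.
have := congr1 (horner^~ x) Q0; rewrite /Q !hornerE e1E => /eqP.
by rewrite -addrA -opprD subr_eq0 => /eqP.
Qed.
End ProdAdditive.

Lemma prod_XsubC_additive (K : fieldType) (V : finZmodType) (U : {set V}) (l : V -> K) :
  0 \in U -> {in U &, forall u v, u - v \in U} ->
  {in U &, forall u v, l (u - v) = l u - l v} -> {in U &, injective l} ->
  additive_poly (\prod_(u in U) ('X - (l u)%:P)).
Proof.
move=> U0 UB lB lI L j x y.
rewrite rmorph_prod (eq_bigr (fun u => 'X - (j (l u))%:P)); last first.
  by move=> u _; rewrite rmorphB /= map_polyX map_polyC.
apply: (@prod_XsubC_additive_at L V U (j \o l)) => //= u v uU vU.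
  by rewrite /= lB // rmorphB.
by move/fmorph_inj; apply: lI.
Qed.

Lemma additive_polyD (K : fieldType) (P Q : {poly K}) :
  additive_poly P -> additive_poly Q -> additive_poly (P + Q).
Proof. by move=> aP aQ L j x y; rewrite rmorphD !hornerD aP aQ addrACA. Qed.

Lemma additive_polyZ (K : fieldType) c (P : {poly K}) :
  additive_poly P -> additive_poly (c *: P).
Proof. by move=> aP L j x y; rewrite map_polyZ !hornerZ aP mulrDr. Qed.

Lemma additive_polyX (K : fieldType) : additive_poly ('X : {poly K}).
Proof. by move=> L j x y; rewrite map_polyX !hornerX. Qed.

Lemma additive_poly_comp (K : fieldType) (P Q : {poly K}) :
  additive_poly P -> additive_poly Q -> additive_poly (P \Po Q).
Proof. by move=> aP aQ L j x y; rewrite map_comp_poly !horner_comp aQ aP. Qed.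

Lemma tofrac_inj (R : idomainType) : injective (tofrac (R:=R)).
Proof. by move=> x y /eqP; rewrite tofrac_eq => /eqP. Qed.

(** Composition with S is evaluation at the point S of the rational function field, where additivity
    of P applies to the points Q and R. *)
Lemma additive_poly_compD (K : fieldType) (P Q R : {poly K}) :
  additive_poly P -> P \Po (Q + R) = (P \Po Q) + (P \Po R).
Proof.
move=> aP; pose f : {rmorphism {poly K} -> {fraction {poly K}}} := tofrac (R:={poly K}).
have fI : injective f by apply: tofrac_inj.
have fE (S : {poly K}) : f (P \Po S) = (map_poly (f \o polyC) P).[f S].
  by rewrite /comp_poly map_poly_comp -horner_map.
by apply: fI; rewrite fE rmorphD (aP _ (f \o polyC)) -!fE rmorphD.
Qed.

Lemma additive_poly0 (K : fieldType) (P : {poly K}) : additive_poly P -> P.[0] = 0.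
Proof.
move=> aP; have := aP K idfun 0 0; rewrite !map_poly_id // addr0 => /eqP.
by rewrite -subr_eq0 opprD addrA subrr add0r oppr_eq0 => /eqP.
Qed.

Lemma additive_poly_compN (K : fieldType) (P Q : {poly K}) :
  additive_poly P -> P \Po (- Q) = - (P \Po Q).
Proof.
move=> aP; apply/eqP; rewrite -addr_eq0 -additive_poly_compD // addNr.
by rewrite comp_poly0r -horner_coef0 additive_poly0.
Qed.

(** * The support of a point *)

Section Reciprocal.
Variables (A : comNzRingType) (K : fieldType) (iota : {rmorphism A -> K}).
Hypothesis iotaI : injective iota.
Variables (V : finLmodType A) (rho : V -> K).
Hypothesis rho0 : rho 0 = 0.
Hypothesis rhoN : forall v, rho (- v) = - rho v.
Hypothesis rhoM : forall v w, v != 0 -> w != 0 -> v + w != 0 ->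
  rho v * rho w = rho (v + w) * (rho v + rho w).
Variable n : A.
Hypothesis n0 : n != 0.
Hypothesis n_nonunit : forall y, 1 <> y * n.
Hypothesis rho_div : forall a b v, n = a * b -> a *: v != 0 ->
  iota a * rho (a *: v) = \sum_(u | a *: u == 0) rho (v - u).
Hypothesis nV : forall v : V, n *: v = 0.
Hypothesis divV : forall a b (v : V), n = a * b -> a *: v = 0 -> exists w, v = b *: w.
Variables (D : set A) (deg : A -> nat).
Hypothesis D_div : forall d, D d -> exists b, n = d * b.
Hypothesis D_gen : forall a b, n = a * b -> submonoid D a.
Hypothesis D_pair : forall d d', D d -> D d' -> d <> d' -> exists b, n = d * d' * b.
Hypothesis D_approx : forall a, a != 0 ->
  exists b, submonoid D b /\ (a - b = 0 \/ (deg (a - b) < deg a)%N).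

Definition supp_rho : {set V} := [set v | (v == 0) || (rho v != 0)].
Local Notation W := supp_rho.
Definition lam (v : V) : K := (rho v)^-1.

Lemma iota_eq0 a : (iota a == 0) = (a == 0).
Proof. by apply/eqP/eqP => [|->]; rewrite ?rmorph0 // => e; apply: iotaI; rewrite e rmorph0. Qed.

Lemma supp_rho0 : 0 \in W. Proof. by rewrite inE eqxx. Qed.

Lemma supp_rhoD : {in W &, forall v w, v + w \in W}.
Proof.
move=> v w; rewrite !inE.
have [->|v0] := eqVneq v 0; first by rewrite add0r => _ ->.
have [->|w0] := eqVneq w 0; first by rewrite addr0 (negPf v0).
have [//|vw0] := eqVneq (v + w) 0; rewrite !orFb => rv rw.
have := rhoM v0 w0 vw0; apply: contra_eq_neq => ->; rewrite mul0r.
by rewrite mulf_neq0.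
Qed.

Lemma supp_rhoN v : v \in W -> - v \in W.
Proof. by rewrite !inE oppr_eq0 rhoN oppr_eq0. Qed.

Lemma supp_rhoB : {in W &, forall v w, v - w \in W}.
Proof. by move=> v w vW wW; apply: supp_rhoD => //; apply: supp_rhoN. Qed.

Lemma rho_supp v : v \notin W -> rho v = 0.
Proof. by rewrite inE negb_or negbK => /andP[_ /eqP]. Qed.

Lemma lam0 : lam 0 = 0. Proof. by rewrite /lam rho0 invr0. Qed.

Lemma lamN v : lam (- v) = - lam v. Proof. by rewrite /lam rhoN invrN. Qed.

Lemma lam_eq0 v : v \in W -> (lam v == 0) = (v == 0).
Proof.
rewrite inE invr_eq0; have [->|//] := eqVneq v 0; first by rewrite rho0 eqxx.
by move=> _; rewrite orFb => /negPf->.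
Qed.

Lemma lamD : {in W &, forall v w, lam (v + w) = lam v + lam w}.
Proof.
move=> v w vW wW; move: (vW) (wW); rewrite !inE.
have [->|v0] := eqVneq v 0; first by rewrite lam0 !add0r.
have [->|w0] := eqVneq w 0; first by rewrite lam0 !addr0.
have [e|vw0] := eqVneq (v + w) 0.
  by move=> _ _; rewrite e lam0 -[v](addrK w) e add0r lamN addNr.
have := supp_rhoD vW wW; rewrite inE (negPf vw0) !orFb => rvw rv rw.
have e := rhoM v0 w0 vw0; rewrite /lam.
apply: (mulfI (mulf_neq0 rv rw)); rewrite {1}e mulrAC mulfV // mul1r.
by rewrite mulrDr mulrAC mulfV // mul1r mulfK // addrC.
Qed.

Lemma lamB : {in W &, forall v w, lam (v - w) = lam v - lam w}.
Proof. by move=> v w vW wW; rewrite lamD ?supp_rhoN // lamN. Qed.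

Lemma lamI : {in W &, injective lam}.
Proof.
move=> v w vW wW /eqP; rewrite -subr_eq0 -lamB // lam_eq0 ?supp_rhoB //.
by rewrite subr_eq0 => /eqP.
Qed.

Definition Wtors (a : A) : {set V} := [set w in W | a *: w == 0].

Lemma WtorsP a w : reflect (w \in W /\ a *: w = 0) (w \in Wtors a).
Proof. by apply: (iffP setIdP) => -[-> /eqP]. Qed.

Lemma Wtors_sub a w : w \in Wtors a -> w \in W.
Proof. by case/WtorsP. Qed.

Lemma Wtors0 a : 0 \in Wtors a.
Proof. by apply/WtorsP; rewrite supp_rho0 scaler0. Qed.

Lemma WtorsB a : {in Wtors a &, forall v w, v - w \in Wtors a}.
Proof.
move=> v w /WtorsP[vW av] /WtorsP[wW aw]; apply/WtorsP.
by rewrite supp_rhoB // scalerBr av aw subrr.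
Qed.

Lemma WtorsD a : {in Wtors a &, forall v w, v + w \in Wtors a}.
Proof.
move=> v w vW wW; rewrite -[w]opprK; apply: WtorsB => //.
by rewrite -sub0r; apply: WtorsB => //; apply: Wtors0.
Qed.

Definition etors (a : A) : {poly K} := \prod_(w in Wtors a) ('X - (lam w)%:P).

Lemma etors_additive a : additive_poly (etors a).
Proof.
apply: prod_XsubC_additive; first exact: Wtors0; first exact: WtorsB.
  by move=> u v /Wtors_sub uW /Wtors_sub vW; apply: lamB.
by move=> u v /Wtors_sub uW /Wtors_sub vW; apply: lamI.
Qed.

Lemma size_etors a : size (etors a) = #|Wtors a|.+1.
Proof.
have -> : etors a = \prod_(z <- [seq lam u | u in Wtors a]) ('X - z%:P).
  by rewrite big_image.
by rewrite size_prod_XsubC size_map -cardE.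
Qed.

Lemma etors_eq0 a w : w \in W -> ((etors a).[lam w] == 0) = (w \in Wtors a).
Proof.
move=> wW; rewrite horner_prod; apply/idP/idP => [/prodf_eq0[v vW]|wT].
  by rewrite hornerXsubC subr_eq0 => /eqP /lamI-> //; apply: Wtors_sub vW.
by rewrite (bigD1 w) //= hornerXsubC subrr mul0r.
Qed.

(** By additivity, translating [etors a] by x changes the constant coefficient only. The translate
    is a product of factors X + (x - lam w), whose linear coefficient is the constant one times a
    sum of inverses. *)
Lemma etors_shift a x : (etors a).[x] != 0 ->
  (etors a)`_1 = (etors a).[x] * \sum_(w in Wtors a) (x - lam w)^-1.
Proof.
move=> ex.
have e1 : etors a \Po ('X + x%:P) = etors a + (etors a).[x]%:P.
  by rewrite additive_poly_compD ?comp_polyXr ?comp_polyCr //; apply: etors_additive.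
have <- : (etors a \Po ('X + x%:P))`_1 = (etors a)`_1.
  by rewrite e1 coefD coefC /= addr0.
have -> : etors a \Po ('X + x%:P) = \prod_(w in Wtors a) ('X + (x - lam w)%:P).
  rewrite /etors rmorph_prod; apply: eq_bigr => w _.
  by rewrite rmorphB /= comp_polyX comp_polyC polyCB addrA.
rewrite deriv_prod_XaddC => [|w wT].
  by congr (_ * _); rewrite horner_prod; apply: eq_bigr => w _; rewrite hornerXsubC.
move: ex; rewrite horner_prod => /prodf_neq0/(_ w wT).
by rewrite hornerXsubC.
Qed.

Lemma etors1_neq0 a : (etors a)`_1 != 0.
Proof.
rewrite /etors (bigD1 0) ?Wtors0 //= lam0 subr0 coefXM /= -horner_coef0 horner_prod.
apply/prodf_neq0 => w /andP[wT w0]; rewrite !hornerE oppr_eq0 lam_eq0 //.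
exact: Wtors_sub wT.
Qed.

(* For [w] in [W] the relation [rho_div] reads
   [a / lam (a w) = \sum_u 1 / (lam w - lam u)], where [u] runs through the
   [a]-torsion of [W]; the right hand side is the logarithmic derivative of
   [etors a] at [lam w], and [etors a] has constant derivative. *)
Lemma rho_tors a b w : n = a * b -> w \in W -> a *: w != 0 ->
  iota a * rho (a *: w) * (etors a).[lam w] = (etors a)`_1.
Proof.
move=> ab wW aw0; have ew : (etors a).[lam w] != 0.
  by rewrite etors_eq0 // inE (negPf aw0) andbF.
rewrite (etors_shift ew) mulrC (rho_div ab aw0); congr (_ * _).
rewrite (bigID (mem W)) /= [X in _ + X]big1 ?addr0.
  apply: eq_big => [u|u /andP[_ uW]]; first by rewrite [RHS]finset.in_set andbC.
  by rewrite -lamB // /lam invrK.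
move=> u /andP[_ uW]; apply: rho_supp; apply: contra uW => wuW.
by rewrite -(subKr w u) supp_rhoB.
Qed.

Definition phi (a : A) : {poly K} := (iota a / (etors a)`_1) *: etors a.

Lemma div_neq0 a b : n = a * b -> a != 0.
Proof. by move=> ab; apply: contra_neq n0 => a0; rewrite ab a0 mul0r. Qed.

Lemma phi1 a : (phi a)`_1 = iota a.
Proof. by rewrite coefZ divfK // etors1_neq0. Qed.

Lemma phi_additive a : additive_poly (phi a).
Proof. by apply/additive_polyZ/etors_additive. Qed.

Lemma phi_neq0 a : a != 0 -> iota a / (etors a)`_1 != 0.
Proof. by move=> a0; rewrite mulf_neq0 ?invr_eq0 ?etors1_neq0 ?iota_eq0. Qed.

Lemma size_phi a : a != 0 -> size (phi a) = #|Wtors a|.+1.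
Proof. by move=> a0; rewrite size_scale ?size_etors // phi_neq0. Qed.

(** The right hand side of [rho_tors] is nonzero, hence so is rho (a w); this is what puts a w back
    into W. *)
Lemma phi_lam a b w : n = a * b -> w \in W -> a *: w \in W /\ (phi a).[lam w] = lam (a *: w).
Proof.
move=> ab wW; rewrite hornerZ.
have [aw0|aw0] := eqVneq (a *: w) 0.
  rewrite aw0 supp_rho0 lam0; split=> //.
  by have/eqP-> : (etors a).[lam w] == 0; rewrite ?mulr0 // etors_eq0 // inE wW aw0 eqxx.
have e := rho_tors ab wW aw0.
have : iota a * rho (a *: w) * (etors a).[lam w] != 0 by rewrite e etors1_neq0.
rewrite !mulf_eq0 !negb_or -andbA => /and3P[ia ra ea].
split; first by rewrite inE ra orbT.
rewrite -e /lam mulrAC [iota a * rho _ * _]mulrAC invfM mulrA mulfV ?mul1r //.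
by rewrite mulf_neq0.
Qed.

(** If rho (a v) is nonzero, so is some summand rho (v - u) of [rho_div]; then v - u lies in W and
    has the same multiple by a as v. *)
Lemma W_pure a b v : n = a * b -> a *: v \in W -> exists2 w, w \in W & a *: w = a *: v.
Proof.
move=> ab; have [->|av0] := eqVneq (a *: v) 0; first by exists 0; rewrite ?supp_rho0 ?scaler0.
rewrite inE (negPf av0) orFb => rav.
have : iota a * rho (a *: v) != 0.
  by rewrite mulf_neq0 // iota_eq0 (div_neq0 ab).
rewrite (rho_div ab av0) => s0.
case: (pickP (fun u => (a *: u == 0) && (v - u \in W))) => [u /andP[/eqP u0 vuW]|no].
  by exists (v - u) => //; rewrite scalerBr u0 subr0.
case/negP: s0; rewrite big1 // => u u0; apply: rho_supp.
by have := no u; rewrite u0 /= => ->.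
Qed.

(** All roots of [etors (a * b)] are roots of the composite, whose degree is #|W[a]| #|W[b]|. Each
    a-torsion point of W is b times a point of W, so this degree is at most #|W[ab]|. The quotient
    is therefore constant, and the linear coefficients determine it. *)
Lemma phi_comp a b c : n = a * b * c -> phi a \Po phi b = phi (a * b).
Proof.
move=> abc; have na : n = a * (b * c) by rewrite mulrA.
have nb : n = b * (a * c) by rewrite mulrCA mulrA.
have [a0 b0] := (div_neq0 na, div_neq0 nb).
have ab0 := div_neq0 abc.
have dvd : etors (a * b) %| (phi a \Po phi b).
  have -> : etors (a * b) = \prod_(z <- [seq lam u | u in Wtors (a * b)]) ('X - z%:P).
    by rewrite big_image.
  apply: uniq_roots_dvdp; last first.
    rewrite uniq_rootsE map_inj_in_uniq ?enum_uniq // => u v; rewrite !mem_enum.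
    by move=> /Wtors_sub uW /Wtors_sub vW; apply: lamI.
  apply/allP => z /mapP[w]; rewrite mem_enum => /WtorsP[wW abw] ->{z}.
  rewrite /root horner_comp (phi_lam nb wW).2 (phi_lam na (phi_lam nb wW).1).2.
  by rewrite scalerA abw lam0.
have [q qE] := dvdpP _ _ dvd.
have cardle : (#|Wtors a| * #|Wtors b| <= #|Wtors (a * b)|)%N.
  have lift u : exists w, u \in Wtors a -> w \in Wtors (a * b) /\ b *: w = u.
    have [uT|uT] := boolP (u \in Wtors a); last by exists 0.
    have [uW au] := WtorsP _ _ uT.
    (* Here n = (a * c) * b and a * c kills u, so u is divisible by b in V; [W_pure] then moves the
       quotient into W. *)
    have [v uE] : exists v, u = b *: v.
      apply: (@divV (a * c)); first by rewrite mulrAC.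
      by rewrite mulrC -scalerA au scaler0.
    have [w wW wE] : exists2 w, w \in W & b *: w = b *: v.
      by apply: (W_pure nb); rewrite -uE.
    exists w => _; rewrite wE -uE; split=> //; apply/WtorsP; split=> //.
    by rewrite -scalerA wE -uE.
  have [l lP] := choice lift.
  rewrite -cardsX; pose f (x : V * V) := l x.1 + x.2.
  rewrite -(@card_in_imset _ _ f).
    apply/subset_leq_card/fintype.subsetP => _ /imsetP[[u v] /= /setXP[/= uT vT] ->].
    apply: WtorsD; first exact: (lP _ uT).1.
    have [vW bv] := WtorsP _ _ vT.
    by apply/WtorsP; rewrite -scalerA bv scaler0.
  move=> [u v] [u' v'] /setXP[/= uT vT] /setXP[/= uT' vT'] e.
  have bE : u = u'.
    have := congr1 (fun x => b *: x) e; rewrite /f /= !scalerDr.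
    have [[_ ->] [_ ->]] := (WtorsP _ _ vT, WtorsP _ _ vT').
    by rewrite !addr0 (lP _ uT).2 (lP _ uT').2.
  by congr (_, _) => //; move: e; rewrite /f /= bE => /addrI.
have szc : ((size (phi a \Po phi b)).-1 = #|Wtors a| * #|Wtors b|)%N.
  by rewrite size_comp_poly !size_phi.
have phic0 : phi a \Po phi b != 0.
  rewrite -size_poly_gt0; case: (size _) szc => //= e.
  have : (0 < #|Wtors a| * #|Wtors b|)%N.
    by rewrite muln_gt0; apply/andP; split; apply/card_gt0P; exists 0; apply: Wtors0.
  by rewrite -e.
have q0 : q != 0 by apply: contraNneq phic0 => q0; rewrite qE q0 mul0r.
have et0 c' : etors c' != 0 by rewrite -size_poly_gt0 size_etors.
have qC : size q = 1%N.
  have : (size (phi a \Po phi b) <= #|Wtors (a * b)|.+1)%N.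
    by rewrite -(prednK (_ : 0 < size (phi a \Po phi b))%N) ?size_poly_gt0 // ltnS szc.
  rewrite qE size_mul // size_etors addnS /= -addn1 [X in (_ <= X)%N]addnC.
  rewrite [X in (X <= _)%N]addnC [X in (_ <= X)%N]addnC leq_add2l => le1.
  by apply/eqP; rewrite eqn_leq le1 size_poly_gt0.
have /size_poly1P[k k0 kE] : size q == 1%N by rewrite qC.
rewrite qE kE mul_polyC /phi; congr (_ *: _).
apply: (mulIf (etors1_neq0 (a * b))); rewrite divfK ?etors1_neq0 //.
have <- : (phi a \Po phi b)`_1 = k * (etors (a * b))`_1 by rewrite qE kE coefCM.
have z0 c' : (phi c').[0] = 0 by apply/additive_poly0/phi_additive.
(* By the chain rule at 0, the linear coefficient of a composite is the product of the linear
   coefficients. *)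
rewrite -[_`_1]/(_`_(0.+1)) -[LHS]mulr1n -coef_deriv -horner_coef0 deriv_comp.
rewrite hornerM horner_comp z0 !horner_coef0 !coef_deriv !mulr1n !phi1.
by rewrite rmorphM.
Qed.

(** A relation and not a function, because an element of A may be written in many ways in terms of
    D; that the polynomial does not depend on the way is [rep_inj]. *)
Inductive represents : A -> {poly K} -> Prop :=
| RepD d : D d -> represents d (phi d)
| Rep1 : represents 1 'X
| RepAdd a b f g : represents a f -> represents b g -> represents (a + b) (f + g)
| RepMul a b f g : represents a f -> represents b g -> represents (a * b) (f \Po g).

Lemma rep_additive a f : represents a f -> additive_poly f.
Proof.
elim=> {a f} [d _||a b f g _ fa _ ga|a b f g _ fa _ ga].
- exact: phi_additive.
- exact: additive_polyX.
- exact: additive_polyD.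
- exact: additive_poly_comp.
Qed.

Lemma rep_coef0 a f : represents a f -> f`_0 = 0.
Proof. by move/rep_additive/additive_poly0; rewrite horner_coef0. Qed.

Lemma rep_coef1 a f : represents a f -> f`_1 = iota a.
Proof.
elim=> {a f} [d _||a b f g _ fa _ ga|a b f g fR fa gR ga].
- exact: phi1.
- by rewrite coefX rmorph1.
- by rewrite coefD fa ga rmorphD.
rewrite -[_`_1]/(_`_(0.+1)) -[LHS]mulr1n -coef_deriv -horner_coef0 deriv_comp.
rewrite hornerM horner_comp horner_coef0 (rep_coef0 gR) !horner_coef0.
by rewrite !coef_deriv !mulr1n fa ga rmorphM.
Qed.

Lemma rep_lam a f w : represents a f -> w \in W -> a *: w \in W /\ f.[lam w] = lam (a *: w).
Proof.
move=> fR; elim: fR w => {a f} [d Dd||a b f g _ fa _ ga|a b f g fR fa gR ga] w wW.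
- by have [b db] := D_div Dd; apply: phi_lam db wW.
- by rewrite scale1r hornerX.
- have [[aW ae] [bW be]] := (fa w wW, ga w wW).
  by rewrite scalerDl supp_rhoD // hornerD lamD // ae be.
have [bW be] := ga w wW; have [aW ae] := fa _ bW.
by rewrite -scalerA horner_comp be ae.
Qed.

(** For distinct d and d' in D the product d d' divides n, so [phi_comp] applies in both orders.
    Additivity of [phi d] extends this to sums. *)
Lemma rep_comm_D d b g : D d -> represents b g -> phi d \Po g = g \Po phi d.
Proof.
move=> Dd; elim=> {b g} [d' Dd'||a b f g fR fa gR ga|a b f g _ fa _ ga].
- have [->//|ne] := EM (d = d'); have [b bE] := D_pair Dd Dd' ne.
  have bE' : n = d' * d * b by rewrite [d' * d]mulrC.
  by rewrite (phi_comp bE) (phi_comp bE') [d' * d]mulrC.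
- by rewrite comp_polyX comp_polyXr.
- by rewrite additive_poly_compD ?comp_polyD ?fa ?ga //; apply: phi_additive.
- by rewrite comp_polyA fa -comp_polyA ga comp_polyA.
Qed.

(** The nonunit n is a product of elements of D, which cannot all be units. *)
Lemma exists_nonunit_D : exists2 d, D d & forall y, 1 <> y * d.
Proof.
apply: contrapT => no.
have Du d : D d -> exists y, 1 = y * d.
  move=> Dd; apply: contrapT => nu; apply: no; exists d => // y e.
  by apply: nu; exists y.
have sub b : submonoid D b -> exists y, 1 = y * b.
  elim=> [|g s Dg _ [y ys]]; first by exists 1; rewrite mulr1.
  by have [z zg] := Du g Dg; exists (z * y); rewrite mulrACA -ys -zg mulr1.
by have [y] := sub n (@D_gen n 1 (esym (mulr1 n))); apply: n_nonunit.
Qed.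

(* The difference of two representatives commutes with [phi d]; comparing lowest
   coefficients, its order of vanishing [m] satisfies [d ^+ m = d]. *)
Lemma rep_inj a f g : represents a f -> represents a g -> f = g.
Proof.
move=> fR gR; have [d Dd dnu] := exists_nonunit_D.
have [b0 db0] := D_div Dd; have d0 := div_neq0 db0.
pose h := f - g.
have hc : h \Po phi d = phi d \Po h.
  rewrite comp_polyB additive_poly_compD ?additive_poly_compN; try exact: phi_additive.
  by rewrite (rep_comm_D Dd fR) (rep_comm_D Dd gR).
apply/eqP; rewrite -subr_eq0 -/h; apply/negPn/negP => hn0.
have ex : exists m, h`_m != 0.
  by exists (size h).-1; rewrite -lead_coefE lead_coef_eq0.
case: (ex_minnP ex) => m hm mmin.
have hlt i : (i < m)%N -> h`_i = 0.
  by move=> im; apply/eqP; apply: contraTT im => /mmin; rewrite -leqNgt.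
(* Both representatives have constant coefficient 0 and linear coefficient [iota a]. *)
have m1 : (1 < m)%N.
  rewrite ltnNge; apply/negP => le1; case/negP: hm.
  case: m {mmin hlt} le1 => [|[|//]] _.
    by rewrite coefB (rep_coef0 fR) (rep_coef0 gR) subrr.
  by rewrite coefB (rep_coef1 fR) (rep_coef1 gR) subrr.
have XmP (p : {poly K}) r : (forall i, (i < r)%N -> p`_i = 0) ->
    exists q, p = q * 'X^r /\ q`_0 = p`_r.
  move=> pr; exists (drop_poly r p); rewrite coef_drop_poly add0n; split=> //.
  have {1}-> := esym (poly_take_drop r p); rewrite (_ : take_poly r p = 0) ?add0r //.
  by apply/polyP => i; rewrite coef_take_poly coef0; case: ltnP => // /pr.
have [q [hE q0]] := XmP h m hlt.
have [|u [pE u0]] := XmP (phi d) 1%N.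
  by case=> // _; rewrite -horner_coef0; apply/additive_poly0/phi_additive.
rewrite phi1 in u0; rewrite expr1 in pE.
have := congr1 (fun p : {poly K} => p`_m) hc.
have -> : (h \Po phi d)`_m = h`_m * iota d ^+ m.
  rewrite {1}hE comp_polyM rmorphXn /= comp_polyX {2}pE exprMn mulrA coefMXn ltnn subnn.
  rewrite -horner_coef0 hornerM horner_comp horner_exp.
  have -> : (phi d).[0] = 0 by apply/additive_poly0/phi_additive.
  by rewrite !horner_coef0 q0 u0.
have -> : (phi d \Po h)`_m = h`_m * iota d.
  rewrite {1}pE comp_polyM comp_polyX {2}hE mulrA coefMXn ltnn subnn.
  rewrite -horner_coef0 hornerM horner_comp.
  have -> : h.[0] = 0 by rewrite horner_coef0 hlt // ltnW.
  by rewrite !horner_coef0 q0 u0 mulrC.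
move/(mulfI hm); rewrite -(prednK (ltnW m1)) exprS -[RHS]mulr1.
have id0 : iota d != 0 by rewrite iota_eq0.
move/(mulfI id0); rewrite -rmorphXn -(rmorph1 iota) => /iotaI e.
(* An equality d ^+ m.-1 = 1 with a positive exponent makes d a unit. *)
have m0 : (0 < m.-1)%N by rewrite -subn1 subn_gt0.
by apply: (dnu (d ^+ m.-1.-1)); rewrite -exprSr prednK.
Qed.

Lemma rep_submonoid b : submonoid D b -> exists f, represents b f.
Proof.
elim=> [|g s Dg _ [f fR]]; first by exists 'X; apply: Rep1.
by exists (phi g \Po f); apply: RepMul fR; apply: RepD.
Qed.

(** Induction on the degree: up to an element of smaller degree, b is a product of elements of D. As
    the approximation is available for nonzero elements only, 0 is represented as 1 + (-1). *)
Lemma rep_exists a : exists f, represents a f.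
Proof.
have nz b : b != 0 -> exists f, represents b f.
  have [m] := ubnP (deg b); elim: m b => // m IH b; rewrite ltnS => bm b0.
  have [c [cD]] := D_approx b0; have [f fR] := rep_submonoid cD.
  case=> [e|lt]; first by exists f; have/eqP := e; rewrite subr_eq0 => /eqP->.
  have [e|ne] := eqVneq (b - c) 0.
    by exists f; have/eqP := e; rewrite subr_eq0 => /eqP->.
  have [g gR] := IH _ (leq_trans lt bm) ne.
  by exists (g + f); rewrite -(subrK c b); apply: RepAdd.
have [->|/nz//] := eqVneq a 0.
have [f fR] : exists f, represents (-1) f by apply: nz; rewrite oppr_eq0 oner_eq0.
by exists ('X + f); rewrite -(subrr 1); apply: RepAdd => //; apply: Rep1.
Qed.

Definition Phi (a : A) : {poly K} := projT1 (cid (rep_exists a)).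

Lemma PhiP a : represents a (Phi a). Proof. exact: projT2 (cid _). Qed.

Lemma Phi_eq a f : represents a f -> f = Phi a.
Proof. by move=> fR; apply: rep_inj fR (PhiP a). Qed.

Lemma PhiD a b : Phi (a + b) = Phi a + Phi b.
Proof. by rewrite -(@Phi_eq _ (Phi a + Phi b)) //; apply: RepAdd; apply: PhiP. Qed.

Lemma PhiM a b : Phi (a * b) = Phi a \Po Phi b.
Proof. by rewrite -(@Phi_eq _ (Phi a \Po Phi b)) //; apply: RepMul; apply: PhiP. Qed.

Lemma Phi_additive a : additive_poly (Phi a).
Proof. exact: rep_additive (PhiP a). Qed.

Lemma Phi_lam a w : w \in W -> (Phi a).[lam w] = lam (a *: w).
Proof. by move=> wW; have [] := rep_lam (PhiP a) wW. Qed.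

(** Only here does W become an A-submodule: [phi_lam] is limited to divisors of n. *)
Lemma supp_rhoZ a w : w \in W -> a *: w \in W.
Proof. by move=> wW; have [] := rep_lam (PhiP a) wW. Qed.

Lemma Phi_neq0 a : a != 0 -> Phi a != 0.
Proof.
move=> a0; apply: contra_neq a0 => e; apply: iotaI.
by rewrite rmorph0 -(rep_coef1 (PhiP a)) e coef0.
Qed.

Lemma size_Phi_gt1 a : a != 0 -> (1 < size (Phi a))%N.
Proof.
move=> a0; rewrite ltnNge; apply/negP => le1.
have : (Phi a)`_1 = 0 by apply: nth_default.
by rewrite (rep_coef1 (PhiP a)) => /eqP; rewrite iota_eq0 (negPf a0).
Qed.

Lemma Wtors_n : Wtors n = W.
Proof. by apply/setP => w; rewrite inE nV eqxx andbT. Qed.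

Lemma phi_one : phi 1 = 'X.
Proof.
have e : etors 1 = 'X.
  rewrite /etors (_ : Wtors 1 = [set 0]) ?big_set1 ?lam0 ?subr0 //.
  by apply/setP => w; rewrite !inE scale1r; case: eqVneq => [->|]; rewrite ?eqxx ?andbF.
by rewrite /phi e coefX /= rmorph1 divr1 scale1r.
Qed.

(** All partial products in a factorization of n over D divide n, so [phi_comp] collapses the
    composite step by step. *)
Lemma Phi_n : Phi n = phi n.
Proof.
have sub b : submonoid D b -> (exists c, n = b * c) -> represents b (phi b).
  elim=> [_|g s Dg _ IH [c e]]; first by rewrite phi_one; apply: Rep1.
  rewrite -(phi_comp e); apply: RepMul; first exact: RepD.
  by apply: IH; exists (g * c); rewrite e mulrAC mulrA [s * g]mulrC mulrAC.
rewrite -(@Phi_eq _ (phi n)) //; apply: sub; last by exists 1; rewrite mulr1.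
by apply: (@D_gen n 1); rewrite mulr1.
Qed.

Lemma size_Phi_n : (size (Phi n)).-1 = #|W|.
Proof. by rewrite Phi_n size_phi // Wtors_n. Qed.

End Reciprocal.

(** * Extensions by roots, and cardinalities *)

Lemma exists_root_ext (K : fieldType) (p : {poly K}) : (1 < size p)%N ->
  exists (L : fieldType) (j : {rmorphism K -> L}) (x : L), root (map_poly j p) x.
Proof.
move=> p1.
have [q qI qp] : exists2 q : {poly K}, irreducible_poly q & q %| p.
  have [m] := ubnP (size p); elim: m p p1 => // m IH p p1; rewrite ltnS => pm.
  have [pI|pI] := EM (irreducible_poly p); first by exists p.
  have [q [q1 qp nqp]] : exists q : {poly K}, [/\ size q != 1%N, q %| p & ~~ (q %= p)].
    apply: contrapT => no; apply: pI; split=> // q q1 qp.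
    by apply/negPn/negP => nqp; apply: no; exists q.
  have p0 : p != 0 by rewrite -size_poly_gt0 ltnW.
  have q0 : q != 0 by apply: contraNneq p0 => q0; move: qp; rewrite q0 dvd0p.
  have qlt : (size q < size p)%N.
    by rewrite ltn_neqAle dvdp_leq // andbT dvdp_size_eqp.
  have [|r rI rq] := IH q _ (leq_trans qlt pm).
    by case: (size q) q1 (size_poly_gt0 q) => [|[]]; rewrite ?q0.
  by exists r => //; apply: dvdp_trans rq qp.
have [L _ [z zq _]] := irredp_FAdjoin qI.
exists L, (in_alg L), z; have [r ->] := dvdpP _ _ qp.
by rewrite rmorphM rootM zq orbT.
Qed.

Lemma exists_roots_ext (K : fieldType) (s : seq {poly K}) :
  (forall p, p \in s -> (1 < size p)%N) ->
  exists (L : fieldType) (j : {rmorphism K -> L}),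
    forall p, p \in s -> exists x : L, root (map_poly j p) x.
Proof.
elim: s => [_|p s IH ps]; first by exists K, idfun.
have [|L [j jP]] := IH; first by move=> q qs; apply: ps; rewrite in_cons qs orbT.
have [|L' [j' [x xp]]] := @exists_root_ext L (map_poly j p).
  by rewrite size_map_poly ps ?mem_head.
exists L', (j' \o j) => q; rewrite in_cons => /orP[/eqP->|/jP[y yq]].
  by exists x; rewrite map_poly_comp.
by exists (j' y); rewrite map_poly_comp fmorph_root.
Qed.

(** If b < a, the Bernoulli inequality (b + 1)^k >= b^k (1 + k / b) contradicts the bound at k = C
    b. *)
Lemma leq_of_exp_bound (a b C : nat) : (0 < b)%N ->
  (forall k, a ^ k <= C * b ^ k)%N -> (a <= b)%N.
Proof.
move=> b0 H; rewrite leqNgt; apply/negP => ba.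
have bern k : (b ^ k * (b + k) <= b * b.+1 ^ k)%N.
  elim: k => [|k IH]; first by rewrite !expn0 mul1n addn0 muln1.
  rewrite [X in (_ <= _ * X)%N]expnSr mulnA.
  apply: leq_trans (leq_mul IH (leqnn b.+1)); rewrite expnSr -!mulnA leq_mul2l.
  by apply/orP; right; rewrite addnS !mulnS [(b * _)%N]mulnC leq_add2r leq_addr.
have := bern (C * b)%N; apply/negP; rewrite -ltnNge.
have le1 : (b * b.+1 ^ (C * b) <= b * (C * b ^ (C * b)))%N.
  by rewrite leq_mul2l (leq_trans _ (H _)) ?orbT // leq_exp2r // muln_gt0 b0 andbT;
     case: (C) (H 0%N); rewrite ?expn0 ?mul0n.
apply: leq_ltn_trans le1 _.
rewrite mulnA mulnC ltn_mul2l expn_gt0 b0 /= [(b * C)%N]mulnC.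
by rewrite -{1}[(C * b)%N]add0n ltn_add2r.
Qed.

Section SubgroupCard.
Variables (M : finZmodType) (Z : {set M}).
Hypothesis Z0 : 0 \in Z.
Hypothesis ZB : {in Z &, forall u v, u - v \in Z}.

Lemma card_additive (M' : finZmodType) (f : M -> M') :
  (forall x y, f (x - y) = f x - f y) ->
  #|Z| = (#|[set z in Z | f z == 0%R]| * #|[set f z | z in Z]|)%N.
Proof.
move=> fB; have f0 : f 0 = 0 by rewrite -(subrr 0) fB subrr.
have fN x : f (- x) = - f x by rewrite -sub0r fB f0 sub0r.
have ZD : {in Z &, forall u v, u + v \in Z}.
  by move=> u v uZ vZ; rewrite -[v]opprK ZB // -sub0r ZB.
have -> : #|Z| = (\sum_(y in [set f z | z in Z]) #|[set z in Z | f z == 0%R]|)%N.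
  rewrite -sum1_card (partition_big_imset f) /=; apply: eq_bigr => y /imsetP[z zZ ->].
  rewrite sum1dep_card -[RHS](card_imset _ (addrI z)); apply: eq_card => u; rewrite finset.in_set.
  apply/andP/imsetP => [[uZ /eqP fu]|[v]].
    by exists (u - z); rewrite ?inE ?ZB ?fB ?fu ?subrr ?eqxx // addrC subrK.
  rewrite inE => /andP[vZ /eqP fv] ->; rewrite ZD //; split=> //.
  by rewrite -[v]opprK fB fN fv oppr0 subr0.
by rewrite sum_nat_const mulnC.
Qed.

(** By the theorem of Cauchy, a prime dividing #|Z| is the order of an element, hence equal to l. *)
Lemma card_subgroup_pexp (l : nat) : prime l -> (forall m : M, m *+ l = 0) ->
  exists f, #|Z| = (l ^ f)%N.
Proof.
move=> lP lM.
have gZ : group_set Z.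
  apply/group_setP; split=> [//|x y xZ yZ].
  have yZ' : - y \in Z by rewrite -sub0r ZB.
  by have := ZB xZ yZ'; rewrite opprK.
pose G := Group gZ.
have : pgroup l G.
  apply/pgroupP => q qP /(Cauchy qP)[x xG xq].
  by have := order_dvdn x l; rewrite FinRing.zmodXgE lM eqxx xq dvdn_prime2 //.
by move/card_pgroup; exists (logn l #|G|).
Qed.
End SubgroupCard.

(** * Freeness of the support *)

Section CyclicModule.
Variables (A : comNzRingType) (n : A) (E : finLmodType A) (e : E).
Hypothesis domA : forall a b c : A, a != 0 -> a * b = a * c -> b = c.
Hypothesis n0 : n != 0.
Hypothesis e0 : e != 0.
Hypothesis gen : forall z : E, exists a, z = a *: e.
Hypothesis ann : forall a, a *: e = 0 <-> exists b, a = n * b.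
(* Multiplication by [c / n], for [c] not in [n A], does not map the ideal of all
   [a] with [c a / n] in [A] to itself. *)
Hypothesis int_closed : forall c, c *: e != 0 ->
  exists2 a, (c * a) *: e = 0 & forall u, c * a = n * u -> (c * u) *: e != 0.

(** The cyclic module A x is simple, so the annihilator of x is a maximal ideal, denoted P in the
    comments on this section. *)
Definition simple (x : E) := x != 0 /\ forall a, a *: x != 0 -> exists b, b *: (a *: x) = x.

(** E is A / n A with e as the class of 1, and [cf x] lifts x to A. With c = [cf x], the annihilator
    of x is the set of all a for which n divides c a, so multiplication by c / n maps it into A. *)
Definition cf (x : E) : A := projT1 (cid (gen x)).

Lemma cfE x : cf x *: e = x. Proof. by rewrite -(projT2 (cid (gen x))). Qed.

Lemma cfZ a x : (cf x * a) *: e = a *: x.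
Proof. by rewrite mulrC -scalerA cfE. Qed.

Definition orb (x : E) : {set E} := [set z | `[< exists a, z = a *: x >]].

Lemma orbP x z : reflect (exists a, z = a *: x) (z \in orb x).
Proof. by rewrite inE; apply: asboolP. Qed.

Lemma orb0 x : 0 \in orb x. Proof. by apply/orbP; exists 0; rewrite scale0r. Qed.

Lemma orb_id x : x \in orb x. Proof. by apply/orbP; exists 1; rewrite scale1r. Qed.

Lemma orbB x : {in orb x &, forall u v, u - v \in orb x}.
Proof.
by move=> u v /orbP[a ->] /orbP[b ->]; apply/orbP; exists (a - b); rewrite scalerBl.
Qed.

Lemma orb_sub x a : orb (a *: x) \subset orb x.
Proof.
apply/fintype.subsetP => z /orbP[b ->]; apply/orbP.
by exists (b * a); rewrite scalerA.
Qed.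

(** Among the nonzero multiples of z, one generating a submodule of least cardinality is simple. *)
Lemma simple_multiple z : z != 0 -> exists b, simple (b *: z).
Proof.
move=> z0; pose P m := `[< exists2 b, b *: z != 0 & #|orb (b *: z)| = m >].
have ex : exists m, P m.
  by exists #|orb (1 *: z)|; apply/asboolP; exists 1; rewrite ?scale1r.
case: (ex_minnP ex) => m /asboolP[b bz mE] mmin; exists b; split=> // a abz.
have /eqP oE : orb (a *: (b *: z)) == orb (b *: z).
  rewrite eqEcard orb_sub mE mmin //; apply/asboolP; exists (a * b); rewrite -scalerA //.
have : b *: z \in orb (a *: (b *: z)) by rewrite oE orb_id.
by case/orbP => c cE; exists c; rewrite -cE.
Qed.

(** With c = [cf x], [int_closed] yields p in P such that u = c p / n is outside P: p is a
    uniformizer at P, and u is invertible modulo P. *)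
Lemma simple_uniformizer x : simple x ->
  exists p u, [/\ p *: x = 0, cf x * p = n * u & u *: x != 0].
Proof.
move=> [x0 _]; have [|a ca au] := @int_closed (cf x); first by rewrite cfE.
have [u cau] := (ann _).1 ca; exists a, u; split=> //; first by rewrite -cfZ.
by rewrite -cfZ au.
Qed.

(** The P-torsion of E is no larger than A x. As u = c p / n is invertible modulo P, z is a multiple
    of u z; and [cf z] * u = c * ([cf z] * p / n) exhibits u z as a multiple of x. *)
Lemma simple_socle x z : simple x -> (forall a, a *: x = 0 -> a *: z = 0) -> z \in orb x.
Proof.
move=> xS xz; have [p [u [px cpu ux]]] := simple_uniformizer xS.
have [v vux] := xS.2 u ux.
have /ann[f zpf] : (cf z * p) *: e = 0 by rewrite cfZ xz.
have uzE : cf z * u = cf x * f.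
  apply: (domA n0); rewrite mulrCA -cpu mulrCA [cf z * _]mulrC [p * _]mulrC zpf.
  by rewrite mulrCA.
have vz : (1 - v * u) *: z = 0.
  by apply: xz; rewrite scalerBl scale1r -scalerA vux subrr.
apply/orbP; exists (v * f).
move/eqP: vz; rewrite scalerBl scale1r subr_eq0 => /eqP->.
by rewrite -!scalerA -[u *: z]cfZ uzE cfZ.
Qed.

(** The elements (c / n)^i y with i <= m all lie in A. For c = [cf x] this takes the role of
    membership in P^m. *)
Fixpoint divisible (c : A) (m : nat) (y : A) : Prop :=
  if m is m'.+1 then exists2 z, c * y = n * z & divisible c m' z else True.

Lemma divisibleM c m a y : divisible c m y -> divisible c m (a * y).
Proof.
elim: m y a => //= m IH y a [z cz zd]; exists (a * z); last exact: IH.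
by rewrite mulrCA cz mulrCA.
Qed.

Lemma divisibleS c m y : divisible c m.+1 y -> divisible c m y.
Proof. by elim: m y => // m IH y [z cz zd]; exists z => //; apply: IH. Qed.

Lemma divisible_quot c m y : divisible c m.+1 y ->
  exists z t, c ^+ m * y = n ^+ m * z /\ c * z = n * t.
Proof.
elim: m y => [|m IH] y [z cz zd]; first by exists y, z; rewrite !expr0.
have [w [t [cw wt]]] := IH z zd; exists w, t; split=> //.
by rewrite exprSr -mulrA cz mulrCA cw exprS mulrA.
Qed.

(** Pigeonhole modulo P, then recursion: the values g x are at most #|orb x| in number, so one of
    them is taken by many g. Subtracting one such g0 and multiplying by c / n gives as many distinct
    elements of A, and m drops by 1. *)
Lemma divisible_pigeonhole x m (G : seq A) : x != 0 -> uniq G -> (#|orb x| ^ m < size G)%N ->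
  exists g g', [/\ g \in G, g' \in G, g != g' & divisible (cf x) m (g - g')].
Proof.
move=> x0; have c0 : cf x != 0 by apply: contra_neq x0 => c0; rewrite -(cfE x) c0 scale0r.
elim: m G => [|m IH] G uG szG.
  case: G uG szG => [|g [|g' G]] //=; rewrite ?expn0 // => /andP[gG _] _.
  exists g, g'; rewrite mem_head in_cons mem_head orbT; split=> //.
  by apply: contraNneq gG => ->; rewrite mem_head.
have [y yO Gy] : exists2 y, y \in orb x & (#|orb x| ^ m < size [seq g <- G | g *: x == y])%N.
  apply: contrapT => no.
  have : (size G <= \sum_(y in orb x) #|orb x| ^ m)%N.
    have -> : size G = (\sum_(y in orb x) size [seq g <- G | g *: x == y])%N.
      elim: (G) => [|g G' IHG] /=; first by rewrite big1.
      rewrite IHG (bigD1 (g *: x)); last by apply/orbP; exists g.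
      rewrite [in RHS](bigD1 (g *: x)); last by apply/orbP; exists g.
      rewrite /= eqxx -addSn; congr (_ + _)%N; apply: eq_bigr => y /andP[_ yg].
      by rewrite eq_sym (negPf yg).
    apply: leq_sum => y yO; rewrite leqNgt; apply/negP => lt.
    by apply: no; exists y.
  by rewrite sum_nat_const -expnS leqNgt szG.
set H := [seq _ <- _ | _] in Gy.
have [g0 g0H] : exists g0, g0 \in H by case: (H) Gy => // g0 ? _; exists g0; rewrite mem_head.
have /choice[z zP] : forall g, exists z, g \in H -> cf x * (g - g0) = n * z.
  move=> g; have [gH|gH] := boolP (g \in H); last by exists 0.
  have : (cf x * (g - g0)) *: e = 0.
    move: gH g0H; rewrite !mem_filter => /andP[/eqP gy _] /andP[/eqP g0y _].
    by rewrite cfZ scalerBl gy g0y subrr.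
  by case/ann => b bE; exists b.
have zI : {in H &, injective z}.
  move=> g g' gH gH' zE; have := zP g gH; rewrite zE -(zP g' gH') => /(domA c0).
  by move/addIr.
have [||_ [_ [/mapP[g gH ->] /mapP[g' gH' ->] zz zd]]] := IH [seq z g | g <- H].
- by rewrite map_inj_in_uniq // filter_uniq.
- by rewrite size_map.
exists g, g'; split.
- by move: gH; rewrite mem_filter => /andP[].
- by move: gH'; rewrite mem_filter => /andP[].
- by apply: contraNneq zz => ->.
exists (z g - z g') => //.
rewrite [RHS]mulrBr -(zP g gH) -(zP g' gH') -mulrBr; congr (_ * _).
by rewrite opprB addrA subrK.
Qed.

(** Expansions of length j in base n, the digits being the chosen lifts of the elements of E. *)
Fixpoint digits (j : nat) : seq A :=
  if j is j'.+1 then [seq cf z + n * g | z <- enum E, g <- digits j'] else [:: 0].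

Lemma size_digits j : size (digits j) = (#|E| ^ j)%N.
Proof. by elim: j => //= j IH; rewrite size_allpairs IH -cardE expnS. Qed.

Lemma nZ (z : E) a : (n * a) *: z = 0.
Proof.
have [b ->] := gen z; rewrite scalerA; apply/ann; exists (a * b).
by rewrite mulrA.
Qed.

Lemma cf_digit z a : (cf z + n * a) *: e = z.
Proof. by rewrite scalerDl cfE nZ addr0. Qed.

Lemma digits_uniq j : uniq (digits j).
Proof.
elim: j => //= j IH; apply: allpairs_uniq => //; first exact: enum_uniq.
move=> [z g] [z' g'] _ _ /= eq.
have zz : z = z' by rewrite -(cf_digit z g) eq cf_digit.
by congr (_, _) => //; move: eq; rewrite zz => /addrI/(domA n0).
Qed.

(** * Torsion counts in W and the construction of a basis *)

Section Submodule.
Variables (K : fieldType) (V : finLmodType A) (W : {set V}) (lam : V -> K).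
Variable Phi : A -> {poly K}.
Hypothesis W0 : 0 \in W.
Hypothesis WB : {in W &, forall v w, v - w \in W}.
Hypothesis WZ : forall a v, v \in W -> a *: v \in W.
Hypothesis lamB : {in W &, forall v w, lam (v - w) = lam v - lam w}.
Hypothesis lamI : {in W &, injective lam}.
Hypothesis PhiD : forall a b, Phi (a + b) = Phi a + Phi b.
Hypothesis PhiM : forall a b, Phi (a * b) = Phi a \Po Phi b.
Hypothesis Phi_additive : forall a, additive_poly (Phi a).
Hypothesis Phi_lam : forall a w, w \in W -> (Phi a).[lam w] = lam (a *: w).
Hypothesis Phi_neq0 : forall a, a != 0 -> Phi a != 0.
Hypothesis size_Phi_gt1 : forall a, a != 0 -> (1 < size (Phi a))%N.
Hypothesis size_Phi_n : (size (Phi n)).-1 = #|W|.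
Hypothesis nV : forall v : V, n *: v = 0.
Hypothesis annV : forall (J : A -> Prop) a,
  (forall z : E, (forall j, J j -> j *: z = 0) -> a *: z = 0) ->
  forall v : V, (forall j, J j -> j *: v = 0) -> a *: v = 0.

(** For simple x this is the P-torsion W[P]. *)
Definition annW (x : E) : {set V} := [set w in W | `[< forall a, a *: x = 0 -> a *: w = 0 >]].

Lemma annWP x w : reflect (w \in W /\ forall a, a *: x = 0 -> a *: w = 0) (w \in annW x).
Proof. by apply: (iffP setIdP) => -[wW /asboolP]. Qed.

Lemma eq_scale a b x w : w \in annW x -> a *: x = b *: x -> a *: w = b *: w.
Proof.
case/annWP => _ H ab; apply/eqP; rewrite -subr_eq0 -scalerBl H //.
by rewrite scalerBl ab subrr.
Qed.

Lemma nscale a b (w : V) : a *: e = b *: e -> a *: w = b *: w.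
Proof.
move=> ab; have /ann[c abc] : (a - b) *: e = 0 by rewrite scalerBl ab subrr.
apply/eqP; rewrite -subr_eq0 -scalerBl abc mulrC -scalerA nV scaler0 //.
Qed.

Lemma lam_zero : lam 0 = 0. Proof. by rewrite -(subrr 0) lamB // subrr. Qed.

(* Choosing [s] with [n ^+ i s = lam w] in an extension field, the elements
   [cf x ^+ i s] for [i < m] and [w \in annW x] span a set of [#|annW x| ^ m]
   roots of [Phi y]. *)
Lemma divisible_size x m y : simple x -> divisible (cf x) m y -> y != 0 ->
  (#|annW x| ^ m <= (size (Phi y)).-1)%N.
Proof.
move=> xS yd y0; have [p [u [px cpu ux]]] := simple_uniformizer xS.
have [u' uu'] := xS.2 u ux.
pose c := cf x; rewrite -/c in cpu.
(* One extension field in which every equation [Phi (n ^+ i)] = [lam w] with i < m has a root. *)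
pose s := [seq Phi (n ^+ i) - (lam w)%:P | i <- iota 0 m, w <- enum V].
have domX i : n ^+ i != 0.
  elim: i => [|i IH]; first by rewrite expr0 oner_eq0.
  apply: contra_neq IH => ni; apply: (domA n0).
  by rewrite -exprS ni mulr0.
have [q /allpairsP[[i w] /= [_ _ ->]]|L [j jP]] := @exists_roots_ext K s.
  rewrite size_addl ?size_Phi_gt1 // size_polyN.
  exact: leq_ltn_trans (size_polyC_leq1 _) (size_Phi_gt1 _).
pose act a (t : L) : L := (map_poly j (Phi a)).[t].
have actD a t t' : act a (t + t') = act a t + act a t' by apply: Phi_additive.
have act0 a : act a 0 = 0.
  by apply: (addrI (act a 0)); rewrite -actD !addr0.
have actN a t : act a (- t) = - act a t.
  by apply/eqP; rewrite -addr_eq0 -actD addNr act0.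
have actM a b t : act (a * b) t = act a (act b t).
  by rewrite /act PhiM map_comp_poly horner_comp.
have actW a w : w \in W -> act a (j (lam w)) = j (lam (a *: w)).
  by move=> wW; rewrite /act horner_map Phi_lam.
have /choice[r rP] : forall iw : nat * V, exists t : L,
    (iw.1 < m)%N -> act (n ^+ iw.1) t = j (lam iw.2).
  move=> [i w] /=; have [im|_] := boolP (i < m)%N; last by exists 0.
  have [|t] := jP (Phi (n ^+ i) - (lam w)%:P).
    by apply/allpairsP; exists (i, w); rewrite mem_iota mem_enum.
  rewrite /root rmorphB /= map_polyC hornerD hornerN hornerC subr_eq0 => /eqP tE.
  by exists t.
have [T [uT szT Tk]] : exists T : seq L, [/\ uniq T, size T = (#|annW x| ^ m)%N &
    forall t, t \in T -> forall y, divisible c m y -> act y t = 0].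
  have pd i : divisible c i (p ^+ i).
    elim: i => //= i IH; exists (u * p ^+ i); last exact: divisibleM.
    by rewrite exprS [in LHS]mulrA cpu mulrA.
  suff H i : (i <= m)%N -> exists T : seq L, [/\ uniq T, size T = (#|annW x| ^ i)%N &
    forall t, t \in T -> forall y, divisible c i y -> act y t = 0] by apply: H.
  elim: i => [_|i IH im].
    exists [:: 0]; split=> // t; rewrite inE => /eqP-> z _; exact: act0.
  have [T [uT szT Tk]] := IH (ltnW im).
  have key t w z : t \in T -> w \in annW x -> divisible c i z ->
      act z (t + act (c ^+ i) (r (i, w))) = act (c ^+ i * z) (r (i, w)).
    by move=> tT wA zd; rewrite actD (Tk t tT z zd) add0r -actM mulrC.
  exists [seq t + act (c ^+ i) (r (i, w)) | t <- T, w <- enum (annW x)]; split.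
  - apply: allpairs_uniq => //; first exact: enum_uniq.
    move=> [t1 w1] [t2 w2] /allpairsP[[t w] /= [tT wA [-> ->]]].
    move=> /allpairsP[[t' w'] /= [tT' wA' [-> ->]]] /= eq.
    move: wA wA' tT tT'; rewrite !mem_enum => wA wA' tT tT'.
    (* Distinctness: [act (p ^+ i)] kills T and, as c p = n u, sends the new summand to lam (u^i w);
       moreover u acts invertibly on W[P]. *)
    have wE v : v \in annW x -> act (p ^+ i) (act (c ^+ i) (r (i, v))) = j (lam (u ^+ i *: v)).
      move=> vA; have [vW _] := annWP _ _ vA; rewrite -actM mulrC -exprMn cpu exprMn.
      by rewrite mulrC actM (rP (i, v)) //= actW.
    have := congr1 (act (p ^+ i)) eq.
    rewrite !actD (Tk t tT _ (pd i)) (Tk t' tT' _ (pd i)) !add0r !wE // => /fmorph_inj.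
    have [[wW _] [wW' _]] := (annWP _ _ wA, annWP _ _ wA').
    move/lamI => /(_ (WZ _ wW) (WZ _ wW')) /(congr1 (fun z => u' ^+ i *: z)).
    have uK v : v \in annW x -> u' ^+ i *: (u ^+ i *: v) = v.
      move=> vA; rewrite scalerA -[RHS]scale1r; apply: (eq_scale vA).
      rewrite scale1r -exprMn; elim: (i) => [|k IHk]; first by rewrite expr0 scale1r.
      by rewrite exprS -scalerA IHk -scalerA.
    rewrite !uK // => ww; congr (_, _) => //; move: eq; rewrite ww.
    exact: addIr.
  - by rewrite size_allpairs szT -cardE expnSr.
  - move=> s0 /allpairsP[[t w] /= [tT]]; rewrite mem_enum => wA ->{s0} z zd.
    rewrite key //; last exact: divisibleS.
    (* For z' = (c / n)^i z the summand is sent to lam (z' w). Since n divides c z', the element z'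
       lies in P and kills w. *)
    have [z' [t' [-> cz']]] := divisible_quot zd.
    have [wW wx] := annWP _ _ wA.
    rewrite mulrC actM (rP (i, w)) //= actW // wx ?lam_zero ?rmorph0 //.
    by rewrite -cfZ cz' nZ.
have jP0 : map_poly j (Phi y) != 0 by rewrite map_poly_eq0 Phi_neq0.
rewrite -szT -ltnS prednK; last by rewrite size_poly_gt0 Phi_neq0.
rewrite -(size_map_poly j); apply: max_poly_roots => //.
by apply/allP => t tT; rewrite /root -/(act y t) Tk.
Qed.

Lemma Phi0 : Phi 0 = 0.
Proof. by apply: (addrI (Phi 0)); rewrite -PhiD !addr0. Qed.

(** C bounds the degrees of [Phi] at differences of two digits; composing with [Phi n], of degree
    #|W|, accounts for each further digit. *)
Lemma digits_size : exists C, forall j, {in digits j &, forall g g',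
  ((size (Phi (g - g'))).-1 <= C * #|W| ^ j)%N}.
Proof.
pose d z z' := (size (Phi (cf z - cf z'))).-1.
pose C := (\max_(z : E) \max_(z' : E) d z z')%N.
have Cd z z' : (d z z' <= C)%N.
  apply: leq_trans (leq_bigmax z); exact: (leq_bigmax z').
have W1 : (0 < #|W|)%N by apply/card_gt0P; exists 0.
exists C; elim=> [|j IH] g g' /=.
  by rewrite !inE => /eqP-> /eqP->; rewrite subrr Phi0 size_poly0.
move=> /allpairsP[[z h] /= [_ hG ->]] /allpairsP[[z' h'] /= [_ hG' ->]].
rewrite opprD addrACA -mulrBr PhiD PhiM.
have le_pred (p q : nat) : (p <= q)%N -> (p.-1 <= q.-1)%N by case: p q => [|p] [|q].
apply: leq_trans (le_pred _ _ (size_polyD _ _)) _.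
have -> (p q : nat) : (maxn p q).-1 = maxn p.-1 q.-1.
  by case: p q => [|p] [|q] //=; rewrite ?maxn0 ?max0n // maxnSS.
rewrite geq_max size_comp_poly size_Phi_n expnS mulnCA leq_mul2l IH // orbT andbT.
by apply: leq_trans (Cd z z') _; rewrite mulnCA leq_pmulr // muln_gt0 W1 expn_gt0 W1.
Qed.

Variable l : nat.
Hypothesis l_prime : prime l.
Hypothesis lE : forall z : E, z *+ l = 0.
Variables sg up : nat.
Hypothesis cardE_l : #|E| = (l ^ sg)%N.
Hypothesis cardW_l : #|W| = (l ^ up)%N.

Lemma card_orb x : exists f, #|orb x| = (l ^ f)%N.
Proof. by apply: card_subgroup_pexp l_prime lE; [apply: orb0|apply: orbB]. Qed.

Lemma l_gt1 : (1 < l)%N. Proof. exact: prime_gt1. Qed.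

Lemma sg_gt0 : (0 < sg)%N.
Proof.
rewrite lt0n; apply/negP => /eqP s0; have := max_card [set 0; e].
by rewrite cards2 eq_sym e0 cardE_l s0.
Qed.

(* The set [digits j] has [#|E| ^ j] elements of degree at most a constant times
   [#|W| ^ j]; if [#|E| ^ j > #|orb x| ^ m] two of them have a difference to
   which [divisible_size] applies.  Let [m] and [j] go to infinity. *)
Lemma card_annW x : simple x -> (#|annW x| ^ sg <= #|orb x| ^ up)%N.
Proof.
move=> xS; have [f fE] := card_orb x; have [C CP] := digits_size.
have W1 : (0 < #|W|)%N by apply/card_gt0P; exists 0.
rewrite fE -expnM mulnC expnM -cardW_l.
apply: (@leq_of_exp_bound _ _ (C * #|W|)); first by rewrite expn_gt0 W1.
move=> k; rewrite -!expnM -mulnA -expnS.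
(* The exponents satisfy #|orb x| ^ (sg * k) = #|E| ^ (f * k). One more digit makes the inequality
   strict, at the cost of a factor #|W| in the constant. *)
have [|g [g' [gG gG' gg gd]]] :=
    @divisible_pigeonhole x (sg * k) (digits (f * k).+1) xS.1 (digits_uniq _).
  rewrite size_digits cardE_l fE -!expnM ltn_exp2l ?l_gt1 //.
  by rewrite mulnCA mulnS -[X in (X < _)%N]add0n ltn_add2r sg_gt0.
apply: leq_trans (divisible_size xS gd _) (CP _ _ _ gG gG').
by rewrite subr_eq0.
Qed.

Definition annE_set (J : A -> Prop) : {set E} := [set z | `[< forall j, J j -> j *: z = 0 >]].
Definition annW_set (J : A -> Prop) : {set V} :=
  [set w in W | `[< forall j, J j -> j *: w = 0 >]].

Lemma annEP J z : reflect (forall j, J j -> j *: z = 0) (z \in annE_set J).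
Proof. by rewrite inE; apply: asboolP. Qed.

Lemma annWsP J w : reflect (w \in W /\ forall j, J j -> j *: w = 0) (w \in annW_set J).
Proof. by apply: (iffP setIdP) => -[wW /asboolP]. Qed.

Lemma annE0 J : 0 \in annE_set J.
Proof. by apply/annEP => j _; rewrite scaler0. Qed.

Lemma annW0 J : 0 \in annW_set J.
Proof. by apply/annWsP; split=> // j _; rewrite scaler0. Qed.

Lemma annEB J : {in annE_set J &, forall u v, u - v \in annE_set J}.
Proof.
by move=> u v /annEP uJ /annEP vJ; apply/annEP => j Jj; rewrite scalerBr uJ // vJ // subrr.
Qed.

Lemma annWB J : {in annW_set J &, forall u v, u - v \in annW_set J}.
Proof.
move=> u v /annWsP[uW uJ] /annWsP[vW vJ]; apply/annWsP; split; first exact: WB.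
by move=> j Jj; rewrite scalerBr uJ // vJ // subrr.
Qed.

(** The devissage below adjoins one scalar at a time: the kernel of b on the J-torsion is the
    torsion for the enlarged set. *)
Definition addJ (J : A -> Prop) b := fun a => J a \/ a = b.

Lemma annE_split J b : #|annE_set J| =
  (#|annE_set (addJ J b)| * #|[set b *: z | z in annE_set J]|)%N.
Proof.
rewrite (card_additive (annE0 J) (@annEB J) (scalerBr b)); congr (_ * _)%N.
apply: eq_card => z; apply/setIdP/annEP => [[/annEP zJ /eqP bz] j [/zJ|->]//|H].
by split; [apply/annEP => j Jj|apply/eqP]; apply: H; [left|right].
Qed.

Lemma annW_split J b : #|annW_set J| =
  (#|annW_set (addJ J b)| * #|[set b *: z | z in annW_set J]|)%N.
Proof.
rewrite (card_additive (annW0 J) (@annWB J) (scalerBr b)); congr (_ * _)%N.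
apply: eq_card => z; apply/setIdP/annWsP => [[/annWsP[zW zJ] /eqP bz]|[zW H]].
  by split=> // j [/zJ|->].
by split; [apply/annWsP; split=> // j Jj|apply/eqP]; apply: H; [left|right].
Qed.

(** Devissage. A nonzero module b E[J] of least size is simple, say A x. The kernel of b on E[J] is
    smaller than E[J], so induction treats it together with the kernel on W[J]; the image b W[J]
    lies in W[P] and is bounded by [card_annW]. *)
Lemma card_annW_set J : (#|annW_set J| ^ sg <= #|annE_set J| ^ up)%N.
Proof.
have [m] := ubnP #|annE_set J|; elim: m J => // m IH J; rewrite ltnS => Jm.
(* If E[J] = 0, then 1 annihilates E[J], hence by [annV] also W[J]. *)
have [J1|J1] := EM (forall z : E, z \in annE_set J -> z = 0).
  have -> : annW_set J = [set 0].
    apply/setP => w; rewrite [RHS]inE; apply/annWsP/eqP => [[wW wJ]|->]; last first.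
      by split=> // j _; rewrite scaler0.
    rewrite -[w]scale1r; apply: (@annV J) => // z zJ; rewrite scale1r.
    by apply: J1; apply/annEP.
  by rewrite cards1 exp1n expn_gt0; apply/orP; left; apply/card_gt0P; exists 0; apply: annE0.
pose I b := [set b *: z | z in annE_set J].
pose P k := `[< exists2 b, exists2 y, y \in I b & y != 0 & #|I b| = k >].
have ex : exists k, P k.
  have [z zJ z0] : exists2 z, z \in annE_set J & z != 0.
    by apply: contrapT => no; apply: J1 => z zJ; apply/eqP/negPn/negP => z0; apply: no; exists z.
  exists #|I 1|; apply/asboolP; exists 1 => //; exists z => //.
  by apply/imsetP; exists z; rewrite ?scale1r.
case: (ex_minnP ex) => k /asboolP[b [x xI x0] kE] kmin.
have IZ a y : y \in I b -> a *: y \in I b.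
  case/imsetP => z /annEP zJ ->; apply/imsetP; exists (a *: z).
    by apply/annEP => j Jj; rewrite scalerA mulrC -scalerA zJ ?scaler0.
  by rewrite !scalerA mulrC.
have IaE a : [set a *: y | y in I b] = I (a * b).
  apply/setP => y; apply/imsetP/imsetP => [[_ /imsetP[z zJ ->] ->]|[z zJ ->]].
    by exists z => //; rewrite scalerA.
  by exists (b *: z); [apply/imsetP; exists z|rewrite scalerA].
(* By minimality of [I b], a scalar acting on it by a nonzero map acts injectively. *)
have Ia a : (exists2 y, y \in I b & a *: y != 0) -> {in I b &, injective (fun y => a *: y)}.
  move=> [y yI ay]; apply/imset_injP; rewrite IaE eqn_leq -{1}IaE leq_imset_card /=.
  rewrite kE kmin //; apply/asboolP; exists (a * b) => //; exists (a *: y) => //.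
  by rewrite -IaE; apply/imsetP; exists y.
have Ix a y : y \in I b -> a *: x = 0 -> a *: y = 0.
  move=> yI ax; apply/eqP/negPn/negP => ay; case/eqP: x0.
  apply: (Ia a) => //; [by exists y| | by rewrite ax scaler0].
  by rewrite -(scale0r x); apply: IZ.
have OI : orb x \subset I b by apply/fintype.subsetP => y /orbP[a ->]; apply: IZ.
have xS : simple x.
  split=> // a ax; have sz : #|[set a *: y | y in orb x]| = #|orb x|.
    apply: card_in_imset => y y' /(fintype.subsetP OI) yI /(fintype.subsetP OI) yI'.
    by apply: Ia => //; exists x.
  have /eqP oE : [set a *: y | y in orb x] == orb x.
    rewrite eqEcard sz leqnn andbT; apply/fintype.subsetP => _ /imsetP[_ /orbP[c ->] ->].
    by apply/orbP; exists (a * c); rewrite scalerA.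
  have := orb_id x; rewrite -{1}oE => /imsetP[_ /orbP[c ->] xE].
  by exists c; rewrite [RHS]xE !scalerA mulrC.
have IO : I b = orb x.
  apply/eqP; rewrite finset.eqEsubset OI andbT; apply/fintype.subsetP => y yI.
  by apply: (simple_socle xS) => a; apply: Ix.
have Eb := annE_split J b; have Wb := annW_split J b.
have lt : (#|annE_set (addJ J b)| < m)%N.
  apply: leq_trans Jm; rewrite Eb; apply: ltn_Pmulr; last first.
    by apply/card_gt0P; exists 0; apply: annE0.
  have I0 : 0 \in I b by rewrite -(scale0r x); apply: IZ.
  by rewrite -/(I b) (cardsD1 0) (cardsD1 x) I0 finset.in_setD1 x0 xI.
rewrite Eb Wb !expnMn leq_mul ?IH // -/(I b) IO.
apply: leq_trans (card_annW xS); rewrite leq_exp2r ?sg_gt0 //.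
apply/subset_leq_card/fintype.subsetP => _ /imsetP[w /annWsP[wW wJ] ->].
apply/annWP; split=> [|a ax]; first exact: WZ.
rewrite scalerA; apply: (@annV J) => // z zJ.
by rewrite -scalerA; apply: Ix => //; apply/imsetP; exists z => //; apply/annEP.
Qed.

(** As #|E| ^ up = #|W| ^ sg, the upper bound for the kernel of c = [cf x] on W is a lower bound for
    the image c W; on E the image is c E = A x. *)
Lemma card_cfW x : simple x -> (#|orb x| ^ up <= #|[set cf x *: w | w in W]| ^ sg)%N.
Proof.
move=> xS; pose J (_ : A) := False.
have EJ z : z \in annE_set J by apply/annEP.
have cEJ : #|annE_set J| = #|E| by apply: eq_card => z; rewrite EJ.
have WJ : annW_set J = W.
  by apply/setP => w; apply/annWsP/idP => [[]//|wW]; split.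
have Es := annE_split J (cf x); have Ws := annW_split J (cf x).
have cE : [set cf x *: z | z in annE_set J] = orb x.
  apply/setP => z; apply/imsetP/orbP => [[y _ ->]|[a ->]].
    by have [a ->] := gen y; exists a; rewrite scalerA cfZ.
  by exists (a *: e) => //; rewrite scalerA cfZ.
rewrite cEJ in Es; rewrite WJ in Ws; rewrite cE in Es.
have le1 := card_annW_set (addJ J (cf x)).
have e1 : (#|E| ^ up = #|W| ^ sg)%N by rewrite cardE_l cardW_l -!expnM mulnC.
rewrite Es Ws !expnMn in e1.
have pos : (0 < #|annE_set (addJ J (cf x))| ^ up)%N.
  by rewrite expn_gt0; apply/orP; left; apply/card_gt0P; exists 0; apply: annE0.
by rewrite -(leq_pmul2l pos) e1 leq_mul2r le1 orbT.
Qed.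

Definition spanned (d : nat) (w : nat -> V) (v : V) :=
  exists c : 'I_d -> A, v = \sum_(j < d) c j *: w j.

(** [c j *: e = 0] says that n divides [c j]. The family is indexed by nat so that d can grow
    without a change of type. *)
Definition independent (d : nat) (w : nat -> V) :=
  (forall j, (j < d)%N -> w j \in W) /\
  forall c : 'I_d -> A, \sum_(j < d) c j *: w j = 0 -> forall j, c j *: e = 0.

Lemma spannedD d w u v : spanned d w u -> spanned d w v -> spanned d w (u + v).
Proof.
move=> [a ->] [b ->]; exists (fun j => a j + b j); rewrite -big_split /=.
by apply: eq_bigr => j _; rewrite scalerDl.
Qed.

Lemma spannedZ d w a v : spanned d w v -> spanned d w (a *: v).
Proof.
move=> [c ->]; exists (fun j => a * c j); rewrite scaler_sumr.
by apply: eq_bigr => j _; rewrite scalerA.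
Qed.

Lemma WD_sum d (c : 'I_d -> A) (w : nat -> V) : (forall j, (j < d)%N -> w j \in W) ->
  \sum_(j < d) c j *: w j \in W.
Proof.
have WD : {in W &, forall v u, v + u \in W}.
  by move=> v u vW uW; rewrite -[u]opprK WB // -scaleN1r WZ.
move=> wW; apply: (big_ind (fun v => v \in W)) => // j _; apply: WZ; exact: wW.
Qed.

(** Coefficients are taken in the finite module E, so that combinations can be counted. *)
Definition comb d (w : nat -> V) (g : {ffun 'I_d -> E}) : V := \sum_(j < d) cf (g j) *: w j.

Lemma spanned_comb d (w : nat -> V) c : \sum_(j < d) c j *: w j = comb w [ffun j : 'I_d => c j *: e].
Proof. by apply: eq_bigr => j _; apply: nscale; rewrite ffunE cfE. Qed.

Lemma comb_inj d w : independent d w -> injective (@comb d w).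
Proof.
move=> [_ wI] g g' gg; apply/ffunP => j; apply/eqP; rewrite -subr_eq0.
have /wI/(_ j) : \sum_(j < d) (cf (g j) - cf (g' j)) *: w j = 0.
  by under eq_bigr do rewrite scalerBl; rewrite sumrB -/(comb w g) gg subrr.
by rewrite scalerBl !cfE => ->.
Qed.

Lemma card_independent d w : independent d w -> (#|E| ^ d <= #|W|)%N.
Proof.
move=> wI; have -> : (#|E| ^ d)%N = #|[set comb w g | g : {ffun 'I_d -> E}]|.
  by rewrite card_imset ?card_ffun ?card_ord //; apply: comb_inj.
apply/subset_leq_card/fintype.subsetP => _ /imsetP[g _ ->].
exact: WD_sum wI.1.
Qed.

Lemma spanned_all d w : independent d w -> #|W| = (#|E| ^ d)%N ->
  forall v, v \in W <-> spanned d w v.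
Proof.
move=> wI cW v; split=> [vW|[c ->]]; last exact: WD_sum wI.1.
have : [set comb w g | g : {ffun 'I_d -> E}] = W.
  apply/eqP; rewrite eqEcard card_imset ?card_ffun ?card_ord ?cW ?leqnn ?andbT;
    last exact: comb_inj.
  apply/fintype.subsetP => _ /imsetP[g _ ->]; exact: WD_sum wI.1.
move/setP/(_ v); rewrite vW => /imsetP[g _ ->].
by exists (fun j => cf (g j)).
Qed.

Lemma cf_annW x w : w \in W -> cf x *: w \in annW x.
Proof.
move=> wW; apply/annWP; split=> [|a ax]; first exact: WZ.
have /ann[b bE] : (cf x * a) *: e = 0 by rewrite cfZ.
by rewrite scalerA mulrC bE mulrC -scalerA nV scaler0.
Qed.

(** Otherwise c W, for c = [cf x], consists of combinations of w. By independence P kills their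
    coefficients, which thus lie in A x by [simple_socle]; so #|c W| <= #|orb x| ^ d, too few for
    [card_cfW]. *)
Lemma exists_unspanned d w x : independent d w -> (#|E| ^ d < #|W|)%N -> simple x ->
  exists2 u, u \in W & ~ spanned d w (cf x *: u).
Proof.
move=> wI lt xS; apply: contrapT => no.
have le1 : (#|[set cf x *: u | u in W]| <= #|orb x| ^ d)%N.
  pose S := [set g : {ffun 'I_d -> E} | g \in ffun_on (orb x)].
  have <- : #|S| = (#|orb x| ^ d)%N by rewrite cardsE card_ffun_on card_ord.
  have <- := card_imset (mem S) (comb_inj wI).
  apply/subset_leq_card/fintype.subsetP => _ /imsetP[u uW ->].
  have [c cE] : spanned d w (cf x *: u).
    by apply: contrapT => ns; apply: no; exists u.
  apply/imsetP; exists [ffun j => c j *: e]; last by rewrite cE spanned_comb.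
  rewrite finset.in_set; apply/ffun_onP => j; rewrite ffunE; apply: (simple_socle xS) => a ax.
  rewrite scalerA; apply: (wI.2 (fun j => a * c j)).
  have [_ /(_ a ax)] := annWP _ _ (cf_annW x uW); rewrite cE scaler_sumr => s0.
  by rewrite -[RHS]s0; apply: eq_bigr => i _; rewrite scalerA.
have [f fE] := card_orb x.
have f0 : (0 < f)%N.
  rewrite lt0n; apply/negP => /eqP f0.
  have : (#|[set 0%R; x]| <= #|orb x|)%N.
    by apply: subset_leq_card; rewrite finset.subUset !finset.sub1set orb0 orb_id.
  by rewrite cards2 eq_sym xS.1 fE f0 expn0.
have := leq_trans (card_cfW xS) (_ : _ <= (#|orb x| ^ d) ^ sg)%N.
rewrite leq_exp2r ?sg_gt0 // => /(_ le1).
rewrite -expnM fE -!expnM leq_exp2l ?l_gt1 // leq_pmul2l // leqNgt.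
by move: lt; rewrite cardE_l cardW_l -expnM ltn_exp2l ?l_gt1 // mulnC => ->.
Qed.

(** Chinese remainders: a simple x' outside A x has another annihilator, so some scalar fixes x and
    kills x'. Take the product of these over the finite module E. *)
Lemma simple_separator x : simple x -> exists2 t, t *: x = x &
  forall x', simple x' -> t *: x' = 0 \/ x' \in orb x.
Proof.
move=> xS.
have /choice[t tP] : forall x', exists t, t *: x = x /\ (simple x' -> t *: x' = 0 \/ x' \in orb x).
  move=> x'; have [[a ax' ax]|no] := EM (exists2 a, a *: x' = 0 & a *: x != 0).
    have [b bax] := xS.2 a ax; exists (b * a); rewrite -!scalerA; split=> // _; left.
    by rewrite ax' scaler0.
  exists 1; rewrite scale1r; split=> // x'S; right.
  have sub a : a *: x' = 0 -> a *: x = 0.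
    by move=> ax'; apply/eqP/negPn/negP => ax; apply: no; exists a.
  apply: (simple_socle xS) => a ax; apply/eqP/negPn/negP => ax'.
  have [b bax] := x'S.2 a ax'; case/eqP: xS.1.
  have := sub (1 - b * a); rewrite !scalerBl !scale1r -!scalerA bax subrr ax scaler0 subr0.
  exact.
exists (\prod_(x' : E) t x') => [|x' x'S].
  apply: (big_ind (fun t => t *: x = x)) => [|a b ax bx|x' _]; first exact: scale1r.
    by rewrite -scalerA bx ax.
  exact: (tP x').1.
have [tx'|] := (tP x').2 x'S; last by right.
by left; rewrite (bigD1 x') //= mulrC -scalerA tx' scaler0.
Qed.

(** Take u with the fewest simple x for which [cf x *: u] is spanned. If such an x remains, add t v,
    where v is not spanned at x and t separates x: nothing changes at simple elements outside A x,
    and all those in A x stop being bad. *)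
Lemma exists_independent_mod d w : independent d w -> (#|E| ^ d < #|W|)%N ->
  exists2 u, u \in W & forall x, simple x -> ~ spanned d w (cf x *: u).
Proof.
move=> wI lt.
pose B u : {set E} := [set x | `[< simple x /\ spanned d w (cf x *: u) >]].
have BP u x : reflect (simple x /\ spanned d w (cf x *: u)) (x \in B u).
  by rewrite finset.in_set; apply: asboolP.
pose bad u := #|B u|.
pose P k := `[< exists2 u, u \in W & bad u = k >].
have ex : exists k, P k by exists (bad 0); apply/asboolP; exists 0.
case: (ex_minnP ex) => k /asboolP[u uW uk] kmin; exists u => // x xS xu.
have [v vW vx] := exists_unspanned wI lt xS.
have [t tx tP] := simple_separator xS.
have WD : u + t *: v \in W.
  by rewrite -[t *: v]opprK WB // -scaleN1r !WZ.
have : (bad (u + t *: v)%R < bad u)%N.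
  have notO x' : simple x' -> x' \in orb x -> ~ spanned d w (cf x' *: (u + t *: v)).
    move=> x'S /orbP[f x'E] sp; apply: vx.
    have fx0 : f *: x != 0 by rewrite -x'E; exact: x'S.1.
    have [g gx] := xS.2 f fx0.
    have gf (y : V) : g *: (cf x' *: y) = cf x *: y.
      rewrite scalerA; apply: nscale.
      by rewrite -scalerA !cfE x'E.
    have := spannedZ g sp; rewrite gf scalerDr => sp'.
    have := spannedD sp' (spannedZ (-1) xu).
    rewrite scaleN1r addrAC subrr add0r.
    have -> // : cf x *: (t *: v) = cf x *: v.
    by rewrite scalerA; apply: nscale; rewrite mulrC -scalerA cfE tx.
  apply/proper_card/properP; split.
    apply/fintype.subsetP => x' /BP[x'S sp]; apply/BP; split=> //.
    have [tx'|/notO] := tP x' x'S; last by case.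
    move: sp; rewrite scalerDr scalerA.
    rewrite (_ : (cf x' * t) *: v = 0) ?addr0 //.
    by rewrite (@nscale _ 0) ?scale0r // cfZ.
  exists x; first by apply/BP.
  by apply/BP => -[_]; apply: notO => //; apply: orb_id.
by rewrite ltnNge uk kmin //; apply/asboolP; exists (u + t *: v).
Qed.

(** In a relation whose coefficient a at the new vector u has a e != 0, some multiple b a e is
    simple, and the relation times b would put [cf (b a e)] u into the span of w. *)
Lemma independent_extend d w : independent d w -> (#|E| ^ d < #|W|)%N ->
  exists w', independent d.+1 w'.
Proof.
move=> wI lt; have [u uW uS] := exists_independent_mod wI lt.
exists (fun j => if (j < d)%N then w j else u); split=> [j _|c].
  by case: ifP => // /wI.1.
rewrite big_ord_recr /= ltnn.
under eq_bigr do rewrite ltn_ord.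
set a := c ord_max => s0.
have ae : a *: e = 0.
  apply/eqP/negPn/negP => /simple_multiple[b bS]; apply: (uS _ bS).
  rewrite (@nscale _ (b * a)); last by rewrite cfE scalerA.
  have : spanned d w (\sum_(j < d) c (widen_ord (leqnSn d) j) *: w j).
    by exists (fun j => c (widen_ord (leqnSn d) j)).
  move/eqP: s0; rewrite addr_eq0 => /eqP-> /(spannedZ (- b)).
  by rewrite scaleNr scalerN opprK scalerA.
have au : a *: u = 0 by rewrite (@nscale _ 0) ?scale0r.
rewrite au addr0 in s0 => j.
have [jd|jd] := ltnP j d; last first.
  by rewrite (_ : j = ord_max) //; apply/val_inj/eqP; rewrite eqn_leq jd -ltnS ltn_ord.
have := wI.2 _ s0 (Ordinal jd); congr (_ *: _ = _); congr (c _).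
exact: val_inj.
Qed.

Lemma exists_basis : exists d w, independent d w /\ #|W| = (#|E| ^ d)%N.
Proof.
have E1 : (1 < #|E|)%N.
  by rewrite cardE_l -[1%N](expn0 l) ltn_exp2l ?l_gt1 ?sg_gt0.
suff H k d w : (#|W| - #|E| ^ d < k)%N -> independent d w ->
    exists d w, independent d w /\ #|W| = (#|E| ^ d)%N.
  by apply: (@H _ 0%N (fun _ => 0) (ltnSn _)); split=> // c _ [].
elim: k d w => // k IH d w; rewrite ltnS => le1 wI.
have := card_independent wI; rewrite leq_eqVlt => /orP[/eqP eq|lt].
  by exists d, w.
have [w' w'I] := independent_extend wI lt; apply: IH w'I.
apply: leq_trans le1; apply: ltn_sub2l => //.
by rewrite ltn_exp2l.
Qed.

End Submodule.
End CyclicModule.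

(** * Homomorphisms out of the ring of reciprocals *)

Lemma build_rmorphism (R S : pzRingType) (f : R -> S) :
  zmod_morphism f -> monoid_morphism f -> exists g : {rmorphism R -> S}, g =1 f.
Proof.
move=> fa fm.
pose fA := GRing.isZmodMorphism.Build R S f fa.
pose fM := GRing.isMonoidMorphism.Build R S f fm.
pose g : {rmorphism R -> S} := HB.pack f fA fM.
by exists g.
Qed.

Lemma fraction_repr (D : idomainType) (x : {fraction D}) :
  exists p q : D, q != 0 /\ x * tofrac q = tofrac p.
Proof.
rewrite -[x](@generic_quotient.reprK _ _ x); set r := generic_quotient.repr x.
exists (\n_r), (\d_r); split; first exact: denom_ratioP.
unlock tofrac; rewrite -[LHS]FracField.pi_mul; apply/eqmodP => /=.
by rewrite /FracField.equivf /= /FracField.mulf !numden_Ratio ?mulf_neq0 ?oner_neq0 ?denom_ratioP //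
  !mulr1 mulrC.
Qed.

Lemma fraction_lift (D : idomainType) (L : fieldType) (f : {rmorphism D -> L}) :
  injective f -> exists g : {rmorphism {fraction D} -> L}, forall x, g (tofrac x) = f x.
Proof.
move=> fI; have f0 q : q != 0 -> f q != 0.
  by move=> q0; apply: contra_neq q0 => e; apply: fI; rewrite e rmorph0.
have /choice[g gP] : forall x : {fraction D}, exists y : L, forall p q, q != 0 ->
    x * tofrac q = tofrac p -> y * f q = f p.
  move=> x; have [p [q [q0 xE]]] := fraction_repr x.
  exists (f p / f q) => p' q' q'0 xE'.
  apply: (mulIf (f0 q q0)); rewrite mulrAC divfK ?f0 // -!rmorphM; congr (f _).
  apply: tofrac_inj; rewrite !rmorphM /= -xE -xE'.
  by rewrite mulrAC.
have t0 q : q != 0 -> tofrac q != 0 :> {fraction D} by move=> q0; rewrite tofrac_eq0.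
have ga : zmod_morphism g.
  move=> x y; have [p [q [q0 xE]]] := fraction_repr x; have [p' [q' [q'0 yE]]] := fraction_repr y.
  apply: (mulIf (f0 (q * q') (mulf_neq0 q0 q'0))).
  rewrite (gP (x - y) (p * q' - p' * q)) ?mulf_neq0 //; last first.
    by rewrite rmorphB !rmorphM /= -xE -yE mulrBl mulrA; congr (_ - _); rewrite mulrCA mulrC.
  rewrite rmorphB !rmorphM -(gP x p q) // -(gP y p' q') // mulrBl mulrA; congr (_ - _).
  by rewrite [in RHS]mulrCA [RHS]mulrC.
have gm : monoid_morphism g.
  split; first by have := gP 1 1 1; rewrite !rmorph1 !mulr1 oner_neq0; apply.
  move=> x y; have [p [q [q0 xE]]] := fraction_repr x; have [p' [q' [q'0 yE]]] := fraction_repr y.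
  apply: (mulIf (f0 (q * q') (mulf_neq0 q0 q'0))).
  rewrite (gP (x * y) (p * p')) ?mulf_neq0 //; last by rewrite !rmorphM /= -xE -yE mulrACA.
  by rewrite !rmorphM -(gP x p q) // -(gP y p' q') // mulrACA.
have [h hE] := build_rmorphism ga gm.
exists h => x; rewrite hE.
by have := gP (tofrac x) x 1; rewrite !rmorph1 !mulr1 oner_neq0; apply.
Qed.

(** * Values of rational functions at a point *)

Section Specialization.
Variables (E : fieldType) (t : E).
Local Notation L := {fraction {poly E}}.

(** The rational function x is regular at t, with value y. *)
Definition specializes (x : L) (y : E) := exists a b : {poly E},
  [/\ b.[t] != 0, x * tofrac b = tofrac a & y * b.[t] = a.[t]].

Lemma specializes_poly p : specializes (tofrac p) p.[t].
Proof. by exists p, 1; rewrite rmorph1 hornerC !mulr1 oner_eq0. Qed.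

Lemma specializesD x y x' y' : specializes x y -> specializes x' y' ->
  specializes (x + x') (y + y').
Proof.
move=> [a [b [b0 xE yE]]] [a' [b' [b'0 xE' yE']]].
exists (a * b' + a' * b), (b * b'); split; first by rewrite hornerM mulf_neq0.
  rewrite rmorphD !rmorphM /= -xE -xE' mulrDl mulrA; congr (_ + _).
  by rewrite mulrCA mulrC.
rewrite hornerD !hornerM -yE -yE' mulrDl mulrA; congr (_ + _).
by rewrite mulrCA mulrC.
Qed.

Lemma specializesM x y x' y' : specializes x y -> specializes x' y' ->
  specializes (x * x') (y * y').
Proof.
move=> [a [b [b0 xE yE]]] [a' [b' [b'0 xE' yE']]].
exists (a * a'), (b * b'); split; first by rewrite hornerM mulf_neq0.
  by rewrite !rmorphM /= -xE -xE' mulrACA.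
by rewrite !hornerM -yE -yE' mulrACA.
Qed.

Lemma specializesV x y : specializes x y -> y != 0 -> specializes x^-1 y^-1.
Proof.
move=> [a [b [b0 xE yE]]] y0; have at0 : a.[t] != 0 by rewrite -yE mulf_neq0.
have nz (p : {poly E}) : p.[t] != 0 -> tofrac p != 0 :> L.
  by rewrite tofrac_eq0; apply: contraNneq => ->; rewrite horner0.
have x0 : x != 0.
  by apply: contraTneq (nz a at0) => x0; rewrite -xE x0 mul0r eqxx.
by exists b, a; split=> //; [rewrite -xE|rewrite -yE]; rewrite mulKf.
Qed.

Lemma specializes_fun x y y' : specializes x y -> specializes x y' -> y = y'.
Proof.
move=> [a [b [b0 xE yE]]] [a' [b' [b'0 xE' yE']]].
have : a * b' = a' * b.
  by apply: tofrac_inj; rewrite !rmorphM /= -xE -xE' mulrAC.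
move/(congr1 (horner^~ t)); rewrite !hornerM -yE -yE' mulrAC => e.
by apply: (mulIf b'0); apply: (mulIf b0).
Qed.
End Specialization.

Lemma specializes_pole (E : fieldType) (a b : E) : b != 0 ->
  specializes 0 (tofrac a%:P + tofrac b%:P / tofrac 'X)^-1 0.
Proof.
move=> b0.
have gen (F : fieldType) (x y t : F) : t != 0 -> t * x + y != 0 -> (x + y / t)^-1 * (t * x + y) = t.
  move=> t0 s0; have -> : t * x + y = (x + y / t) * t by rewrite mulrDl divfK // mulrC.
  rewrite mulKf //; apply: contra_neq s0 => s0.
  by rewrite -(mul0r t) -s0 mulrDl divfK // mulrC.
pose p : {poly E} := 'X * a%:P + b%:P.
have p0 : p.[0] = b by rewrite /p hornerD hornerM hornerX !hornerC mul0r add0r.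
exists 'X, p; split; rewrite ?p0 ?hornerX ?mul0r //.
rewrite /p tofracD tofracM gen //; first by rewrite tofrac_eq0 polyX_eq0.
rewrite -tofracM -tofracD tofrac_eq0 -/p; apply: contra_neq b0 => p00.
by rewrite -p0 p00 horner0.
Qed.

Section RVhom.
Variables (k : fieldType) (V : lmodType k).

Lemma fcoordZ a (v : V) : fcoord V (a *: v) = a *: fcoord V v.
Proof. exact: linearZ. Qed.

Lemma fcoordD (u v : V) : fcoord V (u + v) = fcoord V u + fcoord V v.
Proof. exact: raddfD. Qed.

Lemma fcoord0 : fcoord V 0 = 0.
Proof. exact: raddf0. Qed.

Lemma linformD (u v : V) : linform (u + v) = linform u + linform v.
Proof.
rewrite /linform -big_split /=; apply: eq_bigr => i _.
by rewrite raddfD mxE scalerDl.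
Qed.

Lemma linformZ a (v : V) : linform (a *: v) = a *: linform v.
Proof.
rewrite /linform scaler_sumr; apply: eq_bigr => i _.
by rewrite fcoordZ mxE scalerA.
Qed.

Lemma linformB (u v : V) : linform (u - v) = linform u - linform v.
Proof. by rewrite linformD -scaleN1r linformZ scaleN1r. Qed.

Lemma linform0 : linform (0 : V) = 0.
Proof. by rewrite -(scale0r (0 : V)) linformZ scale0r. Qed.

Lemma linform_eq0 (v : V) : injective (fcoord V) -> linform v = 0 -> v = 0.
Proof.
move=> fI e; apply: fI; rewrite raddf0; apply/rowP => i; rewrite mxE.
have := congr1 (fun p => p@_U_(i)%MM) e; rewrite /linform raddf_sum mcoeff0 /=.
rewrite (bigD1 i) //= mcoeffZ mcoeffXU eqxx mulr1 big1 ?addr0 // => j ji.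
by rewrite mcoeffZ mcoeffXU (negPf ji) mulr0.
Qed.

Lemma RV_hom (B : comPzRingType) (c : {rmorphism k -> B}) (b : V -> B)
    (R : KV V -> B -> Prop) :
  (forall a, R (KV_const V a) (c a)) ->
  (forall v, v != 0 -> R (KV_inv v) (b v)) ->
  (forall x y x' y', R x y -> R x' y' -> R (x + x') (y + y')) ->
  (forall x y x' y', R x y -> R x' y' -> R (x * x') (y * y')) ->
  (forall x y y', R x y -> R x y' -> y = y') ->
  exists h : {rmorphism RV V -> B}, (forall a, h (RV_const V a) = c a) /\
    (forall v, v != 0 -> h (RV_inv v) = b v).
Proof.
move=> RC RI RD RM Rf.
have ex (x : RV V) : exists y, R (RV_val x) y.
  have /asboolP := RV_valP x; elim=> [a|v v0|{}x y _ [x' xR] _ [y' yR]|{}x y _ [x' xR] _ [y' yR]].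
  - by exists (c a).
  - by exists (b v); apply: RI.
  - by exists (x' + y'); apply: RD.
  - by exists (x' * y'); apply: RM.
have /choice[h hP] := ex.
have ha : zmod_morphism h.
  move=> x y; apply: Rf (hP _) _.
  have -> : RV_val (x - y) = RV_val x + KV_const V (-1) * RV_val y.
    by rewrite /KV_const mpolyCN tofracN mpolyC1 tofrac1 mulN1r.
  have -> : h x - h y = h x + c (-1) * h y by rewrite rmorphN1 mulN1r.
  by apply: RD => //; apply: RM.
have hm : monoid_morphism h.
  split; last first.
    move=> x y; have hxy : R (RV_val x * RV_val y) (h (x * y)) := hP (x * y).
    by apply: (Rf _ _ _ hxy); apply: RM (hP x) (hP y).
  apply: Rf (hP _) _; rewrite -(rmorph1 c).
  have -> : RV_val 1 = KV_const V 1 by rewrite /KV_const mpolyC1 tofrac1.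
  exact: RC.
have [g gE] := build_rmorphism ha hm.
exists g; split=> [a|v v0]; rewrite gE; apply: Rf (hP _) _ => //=; exact: RI.
Qed.
End RVhom.

Lemma mpoly_ind_gen (k : fieldType) (m : nat) (P : mpoly m k -> Prop) :
  (forall c, P (mpolyC m c)) -> (forall i, P 'X_i) ->
  (forall p q, P p -> P q -> P (p + q)) -> (forall p q, P p -> P q -> P (p * q)) ->
  forall p, P p.
Proof.
move=> PC PX PD PM; apply: mpolyind => [|c u p _ _ Pp]; first by rewrite -(mpolyC0 m k).
apply: PD => //; rewrite -mul_mpolyC; apply: (PM) => //.
rewrite mpolyXE_id; apply: (big_ind P) => [||i _]; [by rewrite -mpolyC1; apply: PC|exact: PM|].
elim: (u i) => [|e IH]; first by rewrite expr0 -mpolyC1; apply: PC.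
by rewrite exprS; apply: PM.
Qed.

Section SymMap.
Variables (k : fieldType) (U V : lmodType k) (f : U -> V).
Hypothesis fD : forall u v, f (u + v) = f u + f v.
Hypothesis fZ : forall a u, f (a *: u) = a *: f u.
Hypothesis UB : bijective (fcoord U).

Lemma fcoord_basis : exists e : 'I_(fdim U) -> U, forall u, u = \sum_i fcoord U u 0 i *: e i.
Proof.
have [g fg gf] := UB; exists (fun i => g (delta_mx 0 i)) => u.
rewrite -[LHS]fg [fcoord U u in LHS]row_sum_delta; apply: (can_inj fg).
rewrite gf (big_morph _ (@fcoordD k U) (@fcoord0 k U)); apply: eq_bigr => i _.
by rewrite fcoordZ gf.
Qed.

Lemma sym_map : exists s : {rmorphism mpoly (fdim U) k -> mpoly (fdim V) k},
  (forall c, s (mpolyC _ c) = mpolyC _ c) /\ forall u, s (linform u) = linform (f u).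
Proof.
have [e eE] := fcoord_basis.
pose s := mmap (@mpolyC (fdim V) k) (fun i => linform (f (e i))).
have f0 : f 0 = 0 by apply: (addIr (f 0)); rewrite -fD !add0r.
have sX i : s 'X_i = linform (f (e i)) by rewrite /s mmapX mmap1U.
have sZ c p : s (c *: p) = c *: s p by rewrite /s mmapZ mul_mpolyC.
exists s; split=> [c|u]; first exact: mmapC.
rewrite {2}[u]eE (big_morph f fD f0) (big_morph _ (@linformD k V) (@linform0 k V)).
rewrite {1}/linform raddf_sum; apply: eq_bigr => i _.
by rewrite fZ linformZ -sX; apply: sZ.
Qed.
End SymMap.

(** * Embeddings of the field K_V into its rational function field *)

Section FieldExtension.
Variables (k : fieldType) (V : lmodType k) (a : 'I_(fdim V) -> mpoly (fdim V) k).
Local Notation L := {fraction {poly KV V}}.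
Local Notation T := (tofrac 'X : L).

Definition cstL : {rmorphism KV V -> L} := tofrac (R:={poly KV V}) \o polyC.

(** If v goes to A under the linear map with X_i going to [a i], then [psi0] sends v to A + (v - A)
    / T. Its value at T = 1 is v again, whence injectivity. Taking a = 0 leads to the grading, a
    projection to the restriction to a subspace. *)
Definition psi0 : mpoly (fdim V) k -> L :=
  mmap (cstL \o (tofrac (R:=mpoly (fdim V) k) \o @mpolyC (fdim V) k))
    (fun i => cstL (tofrac (a i)) + cstL (tofrac ('X_i - a i)) / T).
HB.instance Definition _ := GRing.RMorphism.on psi0.

Lemma specializes_cst t x : specializes t (cstL x) x.
Proof. by have := specializes_poly t x%:P; rewrite hornerC. Qed.

Lemma psi0C c : psi0 (mpolyC _ c) = cstL (KV_const V c).
Proof. by rewrite /psi0 mmapC. Qed.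

Lemma psi0X i : psi0 'X_i = cstL (tofrac (a i)) + cstL (tofrac ('X_i - a i)) / T.
Proof. by rewrite /psi0 mmapX mmap1U. Qed.

Lemma psi0_specializes p : specializes 1 (psi0 p) (tofrac p).
Proof.
elim/mpoly_ind_gen: p => [c|i|p q ps qs|p q ps qs].
- by rewrite psi0C; apply: specializes_cst.
- have e : tofrac 'X_i = tofrac (a i) + tofrac ('X_i - a i) :> KV V.
    by rewrite -tofracD subrKC.
  rewrite psi0X [X in specializes _ _ X]e.
  apply: specializesD; first exact: specializes_cst.
  rewrite -[X in specializes _ _ X]divr1; apply: specializesM; first exact: specializes_cst.
  apply: specializesV; last exact: oner_neq0.
  by have := specializes_poly 1 ('X : {poly KV V}); rewrite hornerX.
- by rewrite !rmorphD; apply: specializesD.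
- by rewrite !rmorphM; apply: specializesM.
Qed.

Lemma psi0_inj : injective psi0.
Proof.
move=> p q pq; apply: tofrac_inj; apply: specializes_fun (psi0_specializes p) _.
by rewrite pq; apply: psi0_specializes.
Qed.

Lemma psi_exists : exists psi : {rmorphism KV V -> L},
  forall p, psi (tofrac p) = psi0 p.
Proof. exact: fraction_lift psi0_inj. Qed.

Lemma psi0_linform v A : \sum_i fcoord V v 0 i *: a i = A ->
  psi0 (linform v) = cstL (tofrac A) + cstL (tofrac (linform v - A)) / T.
Proof.
move=> <-; rewrite /linform -sumrB !rmorph_sum mulr_suml -big_split /=; apply: eq_bigr => i _.
rewrite -scalerBr -!mul_mpolyC !rmorphM /= psi0C psi0X mulrDr; congr (_ + _).
by rewrite mulrA.
Qed.
End FieldExtension.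

(** The embedding that divides every v by T sends 1 / v to T / v, hence [RV V] into the polynomials
    in T with coefficients in [RV V]. *)
Lemma RV_grading (k : fieldType) (V : lmodType k) :
  exists h : {rmorphism RV V -> {poly RV V}}, (forall c, h (RV_const V c) = (RV_const V c)%:P) /\
    (forall v, v != 0 -> h (RV_inv v) = (RV_inv v)%:P * 'X).
Proof.
have [psi psiE] := psi_exists (fun _ : 'I_(fdim V) => 0).
pose vl : {rmorphism RV V -> KV V} := \val.
have [c cE] : exists c : {rmorphism k -> {poly RV V}}, c =1 fun x => (RV_const V x)%:P.
  apply: build_rmorphism => [x y|].
    rewrite -polyCB; congr (_%:P); apply: val_inj => /=.
    by rewrite /KV_const mpolyCB tofracB.
  split=> [|x y].
    by rewrite -polyC1; congr (_%:P); apply: val_inj; rewrite /= /KV_const mpolyC1 tofrac1.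
  by rewrite -polyCM; congr (_%:P); apply: val_inj; rewrite /= /KV_const mpolyCM tofracM.
have [||x y x' y' xy xy'|x y x' y' xy xy'|x y y' xy|h [hC hV]] :=
    @RV_hom k V {poly RV V} c (fun v => (RV_inv v)%:P * 'X)
      (fun x P => psi x = tofrac (map_poly vl P)).
- by move=> x; rewrite cE map_polyC /= /KV_const psiE psi0C.
- move=> v v0; have -> : map_poly vl ((RV_inv v)%:P * 'X) = (KV_inv v)%:P * 'X.
    by rewrite rmorphM; congr (_ * _); [apply: map_polyC|apply: map_polyX].
  rewrite {1}/KV_inv fmorphV psiE (@psi0_linform _ _ _ _ 0); last first.
    by rewrite big1 // => i _; rewrite scaler0.
  rewrite tofrac0 rmorph0 add0r subr0 invfM invrK -fmorphV tofracM.
  exact: erefl.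
- by rewrite !rmorphD xy xy'.
- by rewrite !rmorphM xy xy'.
- by rewrite xy => /tofrac_inj/(map_inj_poly val_inj (rmorph0 vl)).
by exists h; split=> // x; rewrite hC cE.
Qed.

Section Restriction.
Variables (k : fieldType) (U V : lmodType k) (i : U -> V).
Hypothesis iD : forall u v, i (u + v) = i u + i v.
Hypothesis iZ : forall a u, i (a *: u) = a *: i u.
Hypothesis iI : injective i.
Hypothesis UB : bijective (fcoord U).
Hypothesis VB : bijective (fcoord V).

Lemma linear_retraction : exists j : V -> U, [/\ forall u v, j (u + v) = j u + j v,
  forall a u, j (a *: u) = a *: j u & cancel i j].
Proof.
have [gU fgU gfU] := UB; have [gV fgV gfV] := VB.
have gUD x y : gU (x + y) = gU x + gU y.
  by apply: (can_inj fgU); rewrite fcoordD !gfU.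
have gUZ c x : gU (c *: x) = c *: gU x.
  by apply: (can_inj fgU); rewrite fcoordZ !gfU.
have i0 : i 0 = 0 by apply: (addIr (i 0)); rewrite -iD !add0r.
pose M := \matrix_(l < fdim U) fcoord V (i (gU (delta_mx 0 l))).
have ME u : fcoord U u *m M = fcoord V (i u).
  rewrite mulmx_sum_row -[u in RHS]fgU {2}[fcoord U u]row_sum_delta.
  have gU0 : gU 0 = 0 by apply: (addIr (gU 0)); rewrite -gUD !add0r.
  rewrite (big_morph gU gUD gU0) (big_morph i iD i0) (big_morph _ (@fcoordD k V) (@fcoord0 k V)); apply: eq_bigr => l _.
  by rewrite gUZ iZ fcoordZ rowK.
have Mf : row_free M.
  apply/row_freeP; apply/row_freeP; rewrite -kermx_eq0; apply/rowV0P => v /sub_kermxP vM.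
  have := ME (gU v); rewrite gfU vM => e.
  rewrite -[v]gfU -[RHS]fcoord0; congr (fcoord U _); apply: iI.
  by rewrite i0; apply: (can_inj fgV); rewrite -e fcoord0.
exists (fun v => gU (fcoord V v *m pinvmx M)); split=> [u v|a u|u].
- by rewrite fcoordD mulmxDl gUD.
- by rewrite fcoordZ -scalemxAl gUZ.
- by rewrite -ME -mulmxA mulmxVp // mulmx1 fgU.
Qed.

(* The relation defining the homomorphism is the specialization at [T = 0] of
   the embedding of [KV V] into [KV V (T)] that fixes [i U] and divides a
   complement of [i U] by [T]: there [1 / (u + w / T) = T / (u T + w)]. *)
Lemma RV_restriction : exists h : {rmorphism RV V -> RV U},
  [/\ forall c, h (RV_const V c) = RV_const U c,
   forall u, u != 0 -> h (RV_inv (i u)) = RV_inv u &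
   forall v, v != 0 -> (forall u, i u <> v) -> h (RV_inv v) = 0].
Proof.
have [j [jD jZ ji]] := linear_retraction.
have [si [siC siE]] := sym_map iD iZ UB.
have [sj [sjC sjE]] := sym_map jD jZ VB.
have UI : injective (fcoord U) := bij_inj UB.
have VI : injective (fcoord V) := bij_inj VB.
(* The retraction j makes [si] injective, so that it extends to the fraction fields as [emb]. *)
have sij p : sj (si p) = p.
  elim/mpoly_ind_gen: p => [c|l|p q IHp IHq|p q IHp IHq]; last first.
  - by rewrite !rmorphM IHp IHq.
  - by rewrite !rmorphD IHp IHq.
  - have [gU fgU gfU] := UB.
    have -> : 'X_l = linform (gU (delta_mx 0 l)).
      rewrite /linform gfU (bigD1 l) //= mxE !eqxx scale1r big1 ?addr0 // => m ml.
      by rewrite mxE (negPf ml) andbF scale0r.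
    by rewrite siE sjE ji.
  - by rewrite siC sjC.
have [|emb embE] := @fraction_lift _ (KV V) (tofrac (R:=mpoly (fdim V) k) \o si).
  by move=> p q /= /tofrac_inj/(congr1 sj); rewrite !sij.
pose q v := i (j v).
have [e eE] := fcoord_basis VB.
have [psi psiE] := psi_exists (fun l : 'I_(fdim V) => linform (q (e l))).
have AE v : \sum_l fcoord V v 0 l *: linform (q (e l)) = linform (q v).
  have q0 : q 0 = 0 by apply: (addIr (q 0)); rewrite -iD -jD !add0r.
  have qD u w : q (u + w) = q u + q w by rewrite /q jD iD.
  rewrite {2}[v]eE (big_morph q qD q0) (big_morph _ (@linformD k V) (@linform0 k V)).
  by apply: eq_bigr => l _; rewrite /q jZ iZ linformZ.
have psiV v : psi (tofrac (linform v)) =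
    cstL V (tofrac (linform (q v))) + cstL V (tofrac (linform (v - q v))) / tofrac 'X.
  by rewrite psiE (psi0_linform (AE v)) linformB.
have lin0 v : v != 0 -> tofrac (linform v) != 0 :> KV V.
  by rewrite tofrac_eq0; apply: contra_neq; apply: linform_eq0.
pose vl : {rmorphism RV U -> KV U} := \val.
have [c cE] : exists c : {rmorphism k -> RV U}, c =1 fun x => RV_const U x.
  apply: build_rmorphism => [x y|].
    by apply: val_inj; rewrite /= /KV_const mpolyCB tofracB.
  split=> [|x y]; apply: val_inj; first by rewrite /= /KV_const mpolyC1 tofrac1.
  by rewrite /= /KV_const mpolyCM tofracM.
(* The test [q v == v] decides whether v lies in the image of i; if not, 1 / v acquires a zero at T
   = 0. *)
have [||x y x' y' xy xy'|x y x' y' xy xy'|x y y' xy xy'|h [hC hV]] :=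
    @RV_hom k V (RV U) c (fun v => if q v == v then RV_inv (j v) else 0)
      (fun x y => specializes 0 (psi x) (emb (vl y))).
- move=> x; rewrite cE /= {1}/KV_const psiE psi0C /KV_const embE /= siC.
  exact: specializes_cst.
- move=> v v0; rewrite /KV_inv fmorphV psiV; have [qv|qv] := eqVneq (q v) v.
    have -> : emb (vl (RV_inv (j v))) = (tofrac (linform v))^-1.
      by rewrite -[vl _]/(KV_inv (j v)) /KV_inv fmorphV embE /= siE -/(q v) qv.
    rewrite qv subrr linform0 tofrac0 rmorph0 mul0r addr0 -fmorphV.
    exact: specializes_cst.
  rewrite !rmorph0; apply: specializes_pole.
  by rewrite lin0 // subr_eq0 eq_sym.
- by rewrite !rmorphD; apply: specializesD.
- by rewrite !rmorphM; apply: specializesM.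
- by apply/val_inj/(fmorph_inj emb)/(specializes_fun xy).
exists h; split=> [x|u u0|v v0 nv]; first by rewrite hC cE.
  have iu0 : i u != 0.
    apply: contra_neq u0 => iu; apply: iI; rewrite iu.
    by apply/esym/(addIr (i 0)); rewrite -iD !add0r.
  by rewrite hV // /q ji eqxx.
by rewrite hV //; case: eqP => // qv; case: (nv (j v)).
Qed.
End Restriction.

(** * Homomorphisms out of ring quotients and tensor products *)

Lemma ringquot_hom (P S : comPzRingType) (G : set P) (f : {rmorphism P -> S}) :
  (forall g, G g -> f g = 0) ->
  exists h : {rmorphism ringquot G -> S}, forall x, h (ringquot_pi G x) = f x.
Proof.
move=> fG; have f0 x : ideal_span G x -> f x = 0.
  elim=> [|a g z Gg _ IH]; first exact: rmorph0.
  by rewrite rmorphD rmorphM (fG g Gg) mulr0 IH addr0.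
pose h (m : ringquot G) : S := f (ringquot_repr m).
have hE x : h (ringquot_pi G x) = f x.
  apply/eqP; rewrite -subr_eq0 -rmorphB; apply/eqP/f0/ringquot_piP.
  by rewrite ringquot_piK.
have piN (x : P) : - ringquot_pi G x = ringquot_pi G (- x).
  apply/eqP; rewrite eq_sym -addr_eq0 -ringquot_piD addNr; apply/eqP.
  by apply: (addIr (ringquot_pi G 0)); rewrite -ringquot_piD !add0r.
have hB : zmod_morphism h.
  move=> x y; rewrite -(ringquot_piK x) -(ringquot_piK y) piN -ringquot_piD !hE.
  exact: rmorphB.
have hM : monoid_morphism h.
  split=> [|x y]; first by rewrite -(rmorph1 f) -hE.
  rewrite -(ringquot_piK x) -(ringquot_piK y).
  by rewrite [_ * _ in LHS](@ringquot_piM P G) !hE rmorphM.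
have [g gE] := build_rmorphism hB hM.
by exists g => x; rewrite gE hE.
Qed.

Lemma ringquot_pi_morph (P : comPzRingType) (G : set P) :
  exists f : {rmorphism P -> ringquot G}, f =1 ringquot_pi G.
Proof.
apply: build_rmorphism.
  move=> x y; apply/eqP; rewrite eq_sym subr_eq -ringquot_piD subrK //.
by split=> // x y; rewrite -ringquot_piM.
Qed.

Lemma ringquot_rel (P : comPzRingType) (G : set P) (x y : P) :
  G (x - y) -> ringquot_pi G x = ringquot_pi G y.
Proof.
move=> xy; apply/ringquot_piP.
by have := IdealSpanD 1 xy (IdealSpan0 G); rewrite mul1r addr0.
Qed.

Lemma malg_ind (C : comNzRingType) (I : choiceType) (P : {malg C[{cmonom I}]} -> Prop) :
  (forall c, P << c *g (mone : {cmonom I}) >>) -> (forall i, P << 1 *g ucm i >>) ->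
  (forall x y, P x -> P y -> P (x + y)) -> (forall x y, P x -> P y -> P (x * y)) ->
  forall x, P x.
Proof.
move=> PC PU PD PM x; rewrite (monalgE x).
apply: (big_ind P) => [||m _]; [by rewrite -(@monalgU0 _ C (mone : {cmonom I})); apply: PC|exact: PD|].
have -> : << monalg.mcoeff m x *g m >> =
    << monalg.mcoeff m x *g (mone : {cmonom I}) >> * << 1 *g m >> :> {malg C[{cmonom I}]}.
  by rewrite malgM_def fgmulUU mulr1 mul1m.
apply: (PM) => //.
have [d] := ubnP (monalg.mdeg m); elim: d m => // d IH m; rewrite ltnS => md.
have [->|m1] := eqVneq m (mone : {cmonom I}); first exact: PC.
have [i im] : exists i, m i != 0%N.
  apply: contrapT => no; case/eqP: m1; apply/eqP/cmP => i; rewrite cm1.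
  by apply/eqP/negPn/negP => mi; apply: no; exists i.
have mE : m = (mmul (ucm i) (divcm m (ucm i))).
  apply/eqP/cmP => j; rewrite cmM divcmE cmU.
  by case: eqVneq => [<-|_]; rewrite ?add0n ?subn0 // subnKC // lt0n.
rewrite mE; have -> : << 1 *g (mmul (ucm i) (divcm m (ucm i))) >> =
    << 1 *g ucm i >> * << 1 *g divcm m (ucm i) >> :> {malg C[{cmonom I}]}.
  by rewrite malgM_def fgmulUU mulr1.
apply: (PM) => //; apply: IH.
by apply: leq_trans md; rewrite [X in (_ < monalg.mdeg X)%N]mE monalg.mdegM monalg.mdegU.
Qed.

Section TensorHom.
Variables (k : fieldType) (B C : comNzRingType) (f : {rmorphism k -> B}) (g : {rmorphism k -> C}).

Lemma malg_hom (S : comNzRingType) (al : B -> S) (ga : {rmorphism C -> S}) :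
  exists h : {rmorphism {malg C[{cmonom B}]} -> S},
    (forall c, h c%:A = ga c) /\ forall b, h (tensor_var C b) = al b.
Proof.
pose u (m : {cmonom B}) : S := \prod_(i <- finsupp m) al i ^+ m i.
have uE (m : {cmonom B}) (d : {fset B}) : (finsupp m `<=` d)%fset -> u m = \prod_(i <- d) al i ^+ m i.
  move=> md; rewrite /u (big_fset_incl _ md) // => i _ im.
  by move: im; rewrite -cmE_eq0 => /eqP->; rewrite expr0.
have um : mmorphism u.
  split; last by rewrite /u mdom1 big_seq_fset0.
  move=> m m'; rewrite (uE m (finsupp (mmul m m'))) ?(uE m' (finsupp (mmul m m'))).
  - rewrite -big_split /=; apply: eq_bigr => i _; rewrite cmM exprD //.
  - by rewrite mdomD fsubsetUr.
  - by rewrite mdomD fsubsetUl.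
pose uI := isMultiplicative.Build _ _ u um.
pose u' : {mmorphism {cmonom B} -> S} := HB.pack u uI.
exists (monalg.mmap ga u'); split=> [c|b].
  by rewrite -[c%:A]mul_malgC mulr1 [LHS]monalg.mmapC.
transitivity (ga 1 * u (ucm b)); first exact: monalg.mmapU.
by rewrite rmorph1 mul1r /u mdomU big_seq_fset1 cmUU expr1.
Qed.

Lemma tensor_hom_nz (S : comNzRingType) (al : {rmorphism B -> S}) (ga : {rmorphism C -> S}) :
  (forall c, al (f c) = ga (g c)) ->
  exists h : {rmorphism tensor f g -> S}, forall b c, h (tens f g b c) = al b * ga c.
Proof.
move=> fg; have [h [hC0 hV0]] := malg_hom al ga.
have [q [qE qB qD qM [qC qV]]] : exists q : {malg C[{cmonom B}]} -> S,
    [/\ forall x, h x = q x, forall x y, q (x - y) = q x - q y,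
        forall x y, q (x + y) = q x + q y, forall x y, q (x * y) = q x * q y &
        (forall c, q c%:A = ga c) /\ (forall b, q (tensor_var C b) = al b)].
  by exists h; split=> // x y; [exact: (rmorphB h)|exact: (rmorphD h)|exact: (rmorphM h)].
have hR y : tensor_rel f g y -> h y = 0.
  have q0 u v : q u = q v -> q (u - v) = 0 by move=> e; rewrite qB e subrr.
  move=> yR; apply: etrans (qE y) _; case: yR => [b b'|b b'|c]; apply: q0.
  - apply: etrans (qV _) (esym (etrans (qD _ _) _)).
    exact: etrans (congr2 +%R (qV b) (qV b')) (esym (rmorphD al b b')).
  - apply: etrans (qV _) (esym (etrans (qM _ _) _)).
    exact: etrans (congr2 *%R (qV b) (qV b')) (esym (rmorphM al b b')).
  - exact: etrans (qV _) (etrans (fg c) (esym (qC _))).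
have [r rE] := ringquot_hom hR.
exists r => b c; rewrite rE qE; have -> : c *: tensor_var C b = c%:A * tensor_var C b.
  exact: etrans (congr1 ( *:%R c) (esym (mul1r (tensor_var C b)))) (scalerAl c 1 _).
apply: etrans (qM _ _) (etrans (congr2 *%R (qC c) (qV b)) _); exact: mulrC.
Qed.

(** A target with 1 = 0 is treated apart: [malg_hom] expects a nonzero ring, and into the zero ring
    every map is a homomorphism. *)
Lemma tensor_hom (S : comPzRingType) (al : {rmorphism B -> S}) (ga : {rmorphism C -> S}) :
  (forall c, al (f c) = ga (g c)) ->
  exists h : {rmorphism tensor f g -> S}, forall b c, h (tens f g b c) = al b * ga c.
Proof.
move=> fg; have [S1|S1] := eqVneq (1 : S) 0.
  have S0 (x y : S) : x = y by rewrite -[x]mul1r -[y]mul1r S1 !mul0r.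
  have [h _] : exists h : {rmorphism tensor f g -> S}, h =1 fun _ => 0.
    by apply: build_rmorphism => [x y|]; [apply: S0|split=> [|x y]; apply: S0].
  by exists h => b c; apply: S0.
pose S1m := GRing.PzSemiRing_isNonZero.Build S S1.
pose S' : comNzRingType := HB.pack S S1m.
exact: (@tensor_hom_nz S' al ga fg).
Qed.

Lemma tens1E c : tens f g 1 c = ringquot_pi (tensor_rel f g) (malgC c).
Proof.
apply/esym/ringquot_piP.
pose M : comNzRingType := {malg C[{cmonom B}]}.
have gen (R : comNzRingType) (y t o : R) : o = 1 -> - y * (t - o) + 0 = y - y * t.
  by move=> ->; rewrite addr0 mulNr mulrBr mulr1 opprB.
have o1 : (g 1)%:A = 1 :> M := etrans (congr1 (fun z => z%:A) (rmorph1 g)) (scale1r 1).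
have f1 : tensor_var C (f 1) = tensor_var C 1 := congr1 (tensor_var C) (rmorph1 f).
have e := gen M (malgC c) (tensor_var C (f 1)) (g 1)%:A o1.
have e' : malgC c * tensor_var C (f 1) = c *: tensor_var C 1 :> M :=
  etrans (mul_malgC c _) (congr1 ( *:%R c) f1).
have sp := IdealSpanD (- malgC c) (TensorC f g 1) (IdealSpan0 (tensor_rel f g)).
exact: eq_ind _ (ideal_span (tensor_rel f g)) sp _
         (etrans e (congr1 (fun z : M => malgC c - z) e')).
Qed.

Lemma tensr1E b : tens f g b 1 = ringquot_pi (tensor_rel f g) (tensor_var C b).
Proof. by rewrite /tens; congr (ringquot_pi _ _); apply: scale1r. Qed.

Lemma tensE b c : tens f g b c = tens f g b 1 * tens f g 1 c.
Proof.
rewrite tensr1E tens1E; apply: esym; apply: etrans (ringquot_piM _ _ _) _.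
rewrite /tens; congr (ringquot_pi _ _).
by apply: etrans (mulrC _ _) _; apply: mul_malgC.
Qed.

Lemma tens_const c : tens f g (f c) 1 = tens f g 1 (g c).
Proof.
rewrite tensr1E tens1E; apply: etrans (ringquot_rel (TensorC f g c)) _.
congr (ringquot_pi _ _).
exact: etrans (esym (mul_malgC _ _)) (mulr1 _).
Qed.

Lemma tensl_morph : exists al : {rmorphism B -> tensor f g}, forall b, al b = tens f g b 1.
Proof.
have D b b' : tens f g (b + b') 1 = tens f g b 1 + tens f g b' 1.
  rewrite !tensr1E; apply: etrans (ringquot_rel (TensorD f g b b')) _.
  exact: ringquot_piD.
apply: build_rmorphism => [b b'|].
  by apply/eqP; rewrite eq_sym subr_eq -D subrK.
split=> [|b b'].
  rewrite -(rmorph1 f) tens_const rmorph1 tens1E //.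
rewrite !tensr1E; apply: etrans (ringquot_rel (TensorM f g b b')) _.
exact: esym (ringquot_piM _ _ _).
Qed.

Lemma tensr_morph : exists ga : {rmorphism C -> tensor f g}, forall c, ga c = tens f g 1 c.
Proof.
have [p pE] := ringquot_pi_morph (tensor_rel f g).
exists (p \o @malgC {cmonom B} C) => c.
by rewrite tens1E; apply: pE.
Qed.

Lemma tens_ind (P : tensor f g -> Prop) :
  (forall c, P (tens f g 1 c)) -> (forall b, P (tens f g b 1)) ->
  (forall x y, P x -> P y -> P (x + y)) -> (forall x y, P x -> P y -> P (x * y)) ->
  forall x, P x.
Proof.
move=> PC PB PD PM x; rewrite -(ringquot_piK x).
elim/malg_ind: (ringquot_repr x) => [c|b|y z Py Pz|y z Py Pz].
- by rewrite -tens1E; apply: PC.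
- by have := PB b; rewrite tensr1E.
- by rewrite ringquot_piD; apply: PD.
- by rewrite -ringquot_piM; apply: PM.
Qed.
End TensorHom.

(** * The torsion modules *)

Section CoefficientRing.
Variables (k : finFieldType) (F : fieldExtType {fraction {poly k}}) (oo : place F).
Local Notation A := (coefring oo).

Lemma coef_valI : injective (@coef_val k F oo). Proof. exact: val_inj. Qed.
Lemma coef_valM (a b : A) : coef_val (a * b) = coef_val a * coef_val b.
Proof. by []. Qed.
Lemma coef_valB (a b : A) : coef_val (a - b) = coef_val a - coef_val b.
Proof. by []. Qed.
Lemma coef_val_eq0 (a : A) : (coef_val a == 0) = (a == 0).
Proof. by apply/eqP/eqP => [e|->//]; apply: coef_valI; rewrite e. Qed.

Lemma coef_mulI (a b c : A) : a != 0 -> a * b = a * c -> b = c.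
Proof.
rewrite -coef_val_eq0 => a0 e; apply: coef_valI; apply: (mulfI a0).
by rewrite -!coef_valM e.
Qed.

Lemma toFmodAD (x y : F) : toFmodA oo (x + y) = toFmodA oo x + toFmodA oo y.
Proof. exact: quotmod_piD. Qed.

Lemma toFmodAZ (a : A) (x : F) : a *: toFmodA oo x = toFmodA oo (coef_val a * x).
Proof. exact: quotmod_piZ. Qed.

Lemma toFmodA_eq0 (x : F) : toFmodA oo x = 0 <-> x \in regular oo.
Proof.
have -> : (0 : FmodA oo) = toFmodA oo 0.
  by apply: (addIr (toFmodA oo 0)); rewrite add0r -toFmodAD addr0.
by have := quotmod_piP (regular_closed oo) x 0; rewrite subr0.
Qed.

Variable N : set A.

Lemma VN_valZ a (v : VN N) : VN_val (a *: v) = a *: VN_val v.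
Proof. by []. Qed.

Lemma VaE r a (v : VNr N r) : Va a v <-> a *: v = 0.
Proof.
split=> [av|av j].
  apply/ffunP => j; rewrite !ffunE; apply: val_inj => /=.
  have [x ax ->] := av j.
  by rewrite toFmodAZ; apply/toFmodA_eq0.
have /asboolP[x _ xE] := VN_valP ((v : {ffun 'I_r -> VN N}) j).
exists x => //; apply/toFmodA_eq0; rewrite -toFmodAZ -xE.
have := congr1 (fun f : {ffun 'I_r -> VN N} => VN_val (f j)) av.
by rewrite !ffunE.
Qed.

Section Principal.
Variable n : A.
Hypothesis n0 : n != 0.
Hypothesis NE : forall x, N x <-> principal n x.

Lemma mem_level x : N x <-> exists b, x = n * b.
Proof. by rewrite NE; split=> -[y ->]; exists y; rewrite mulrC. Qed.

Lemma DivE a : Div N a <-> exists b, n = a * b.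
Proof.
split=> [|[b nE] x /mem_level[y ->]]; last by exists (b * y); rewrite nE -mulrA mulrC.
have /[swap]/[apply] : N n by apply/mem_level; exists 1; rewrite mulr1.
by case=> y ->; exists y; rewrite mulrC.
Qed.

Lemma VN_gen_in : toFmodA oo (coef_val n)^-1 \in VN_pred N.
Proof.
apply/asboolP; exists (coef_val n)^-1 => // _ /mem_level[b ->].
by rewrite coef_valM mulrAC divff ?coef_val_eq0 // mul1r coef_valP.
Qed.

Definition VN_gen : VN N := MkVN VN_gen_in.

Lemma VN_genP (z : VN N) : exists a, z = a *: VN_gen.
Proof.
have /asboolP[x xN xE] := VN_valP z.
have nx : coef_val n * x \in regular oo by apply: xN; apply/mem_level; exists 1; rewrite mulr1.
exists (Coef nx); apply: val_inj; rewrite /= xE toFmodAZ /=.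
by rewrite mulrAC divff ?coef_val_eq0 // mul1r.
Qed.

Lemma VN_ann a : a *: VN_gen = 0 <-> exists b, a = n * b.
Proof.
split=> [/(congr1 (@VN_val _ _ _ _))|[b ->]].
  rewrite VN_valZ toFmodAZ => /toFmodA_eq0 an; exists (Coef an); apply: coef_valI.
  by rewrite coef_valM /= mulrCA divff ?coef_val_eq0 // mulr1.
apply: val_inj; rewrite /= toFmodAZ; apply/toFmodA_eq0.
by rewrite coef_valM mulrAC divff ?coef_val_eq0 // mul1r coef_valP.
Qed.

Lemma VNr_n r (v : VNr N r) : n *: v = 0.
Proof.
apply/ffunP => j; rewrite !ffunE; have [a ->] := VN_genP (v j).
by rewrite scalerA; apply/VN_ann; exists a.
Qed.

Lemma VNr_div r a b (v : VNr N r) : n = a * b -> a *: v = 0 -> exists w, v = b *: w.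
Proof.
move=> nab av.
have /choice[c cP] : forall j, exists c, (v : {ffun 'I_r -> VN N}) j = b *: c.
  move=> j; have [x xE] := VN_genP ((v : {ffun 'I_r -> VN N}) j).
  have := congr1 (fun f : {ffun 'I_r -> VN N} => f j) av; rewrite !ffunE xE scalerA.
  case/VN_ann => y; rewrite nab -mulrA => /coef_mulI xy.
  exists (y *: VN_gen); rewrite scalerA -xy //.
  by apply: contra_neq n0 => a0; rewrite nab a0 mul0r.
by exists [ffun j => c j]; apply/ffunP => j; rewrite !ffunE.
Qed.

Lemma VNr_ann r (J : A -> Prop) a :
  (forall z : VN N, (forall j, J j -> j *: z = 0) -> a *: z = 0) ->
  forall v : VNr N r, (forall j, J j -> j *: v = 0) -> a *: v = 0.
Proof.
move=> H v vJ; apply/ffunP => i; rewrite !ffunE; apply: H => j Jj.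
have := congr1 (fun f : {ffun 'I_r -> VN N} => f i) (vJ j Jj).
by rewrite !ffunE.
Qed.

(* If [c / n] were to map the ideal [p = {a | n divides c * a}] to itself then,
   [p] generating a principal ideal in the valuation ring of every place
   [P <> oo], [c / n] would lie in all of these rings. *)
Lemma VN_int_closed (E : seq (VN N)) : (forall z, z \in E) -> forall c, c *: VN_gen != 0 ->
  exists2 a, (c * a) *: VN_gen = 0 & forall u, c * a = n * u -> (c * u) *: VN_gen != 0.
Proof.
move=> EP c c0; apply: contrapT => no.
have stab a u : c * a = n * u -> (c * u) *: VN_gen = 0.
  move=> cau; apply/eqP/negPn/negP => cu; apply: no; exists a; first by apply/VN_ann; exists u.
  by move=> u' /esym; rewrite cau => /(coef_mulI n0)->.
case/eqP: c0; apply/VN_ann.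
suff yA : coef_val c / coef_val n \in regular oo.
  by exists (Coef yA); apply: coef_valI; rewrite coef_valM /= mulrCA divff ?coef_val_eq0 // mulr1.
apply/asboolP => P Poo; have [O1 OB OM] := vring_subring P.
have O0 : 0 \in vring P by rewrite -(subrr 1) OB.
have OD x y : x \in vring P -> y \in vring P -> x + y \in vring P.
  by move=> xO yO; rewrite -[y]opprK -[- y]sub0r OB // OB.
have OA (a : A) : coef_val a \in vring P by have /asboolP := coef_valP a; apply.
have /choice[rep repP] := VN_genP.
pose p a := (c * a) *: VN_gen = 0.
(* Finitely many generators of the ideal p: n, and representatives of its classes modulo n. *)
pose s := n :: [seq rep z | z <- E & `[< p (rep z) >]].
have sp a : a \in s -> p a.
  rewrite in_cons => /orP[/eqP->|/mapP[z + ->]].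
    by apply/VN_ann; exists c; rewrite mulrC.
  by rewrite mem_filter => /andP[/asboolP].
(* An element of least valuation at P; it generates p in the valuation ring. *)
have [g gs [g0 gmax]] : exists2 g, g \in s & g != 0 /\ forall h, h \in s ->
    coef_val h / coef_val g \in vring P.
  rewrite /s; elim: [seq _ | _ <- _ & _] => [|h t [g gt [g0 gmax]]].
    exists n; rewrite ?mem_head //; split=> // h; rewrite inE => /eqP->.
    by rewrite divff ?coef_val_eq0.
  have [h0|h0] := eqVneq h 0.
    exists g; first by move: gt; rewrite !in_cons => /orP[]->; rewrite ?orbT.
    split=> // x; rewrite !in_cons orbCA => /orP[/eqP->|xt]; last by apply: gmax; rewrite in_cons.
    by rewrite h0 mul0r.
  have [hg|gh] := vring_total P (coef_val h / coef_val g).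
    exists g; first by move: gt; rewrite !in_cons => /orP[]->; rewrite ?orbT.
    split=> // x; rewrite !in_cons orbCA => /orP[/eqP->//|xt].
    by apply: gmax; rewrite in_cons.
  rewrite invfM invrK mulrC in gh.
  exists h; first by rewrite !in_cons eqxx orbT.
  split=> // x; rewrite !in_cons orbCA => /orP[/eqP->|xt].
    by rewrite divff ?coef_val_eq0.
  have xg : coef_val x / coef_val g \in vring P by apply: gmax; rewrite in_cons.
  have -> : coef_val x / coef_val h = coef_val x / coef_val g * (coef_val g / coef_val h).
    by rewrite mulrA divfK ?coef_val_eq0.
  exact: OM.
have /VN_ann[u cgu] := sp g gs.
have pu := stab g u cgu.
have gF0 : coef_val g != 0 by rewrite coef_val_eq0.
have nF0 : coef_val n != 0 by rewrite coef_val_eq0.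
(* u = c g / n is in p again by [stab], so u / g lies in the valuation ring of P. *)
have -> : coef_val c / coef_val n = coef_val u / coef_val g.
  apply: (mulIf gF0); apply: (mulfI nF0); rewrite divfK // mulrA [_ * (_ / _)]mulrC divfK //.
  by rewrite -!coef_valM cgu.
pose z := u *: VN_gen.
have [b ub] : exists b, u - rep z = n * b.
  by apply/VN_ann; rewrite scalerBl -repP subrr.
have pz : p (rep z).
  by rewrite /p -scalerA -repP /z scalerA.
have -> : coef_val u = coef_val (rep z) + coef_val n * coef_val b.
  by rewrite -coef_valM -ub coef_valB subrKC.
rewrite mulrDl mulrAC; apply: OD; last by apply: OM (OA b); apply: gmax; rewrite mem_head.
apply: gmax; rewrite in_cons; apply/orP; right; apply/mapP; exists z => //.
by rewrite mem_filter EP andbT; apply/asboolP.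
Qed.
End Principal.
End CoefficientRing.

(** * Finite modules *)

(** The second case is the default value of [fdcoord], which has no coordinates at all. *)
Lemma fcoord_dichotomy (k : fieldType) (V : lmodType k) :
  bijective (fcoord V) \/ forall v : V, linform v = 0.
Proof.
rewrite /linform /fcoord /fdim /fdcoord; case: pselect => [h|_]; first by left; case: (cid h).
by right=> v; rewrite big_ord0.
Qed.

Lemma fcoord_bij (k : fieldType) (V : lmodType k) (m : nat) (c : {linear V -> 'rV[k]_m}) :
  bijective c -> bijective (fcoord V).
Proof.
move=> cB; rewrite /fcoord /fdim /fdcoord; case: pselect => [h|[]]; first by case: (cid h).
by exists (existT _ m c).
Qed.

(** An injection into k^m becomes a bijection once its values are expressed in a basis of the space
    they span. *)
Lemma fcoord_bij_finite (k : fieldType) (V : lmodType k) (m : nat) (f : V -> 'rV[k]_m)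
    (s : seq V) :
  (forall u v, f (u + v) = f u + f v) -> (forall a u, f (a *: u) = a *: f u) ->
  injective f -> (forall v, v \in s) -> bijective (fcoord V).
Proof.
move=> fD fZ fI sV.
pose M := \matrix_(i < size s) f (nth 0 s i); pose B := row_base M.
have fM v : (f v <= B)%MS.
  rewrite eq_row_base; have vs := sV v; have iv : (index v s < size s)%N by rewrite index_mem.
  have <- : row (Ordinal iv) M = f v by rewrite rowK /= nth_index.
  exact: row_sub.
pose c v : 'rV[k]_(\rank M) := f v *m pinvmx B.
have cK v : c v *m B = f v by rewrite mulmxKpV.
have cB : zmod_morphism c.
  move=> u v; rewrite /c -mulmxBl; congr (_ *m _).
  by rewrite -scaleN1r fD fZ scaleN1r.
have cZ : scalable c by move=> a v; rewrite /c fZ -scalemxAl.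
pose cBm := GRing.isZmodMorphism.Build V 'rV[k]_(\rank M) c cB.
pose cZm := GRing.isScalable.Build k V 'rV[k]_(\rank M) *:%R c cZ.
pose cl : {linear V -> 'rV[k]_(\rank M)} := HB.pack c cBm cZm.
apply: (@fcoord_bij k V _ cl).
have f0 : f 0 = 0 by apply: (addIr (f 0)); rewrite -fD !add0r.
have /choice[g gP] : forall w : 'rV[k]_(\rank M), exists v, f v = w *m B.
  move=> w; have /submxP[u uE] : (w *m B <= M)%MS by rewrite -(eq_row_base M) submxMl.
  exists (\sum_i u 0 i *: nth 0 s i); rewrite uE mulmx_sum_row (big_morph f fD f0).
  by apply: eq_bigr => i _; rewrite rowK fZ.
exists g => [v|w]; first by apply: fI; rewrite gP cK.
by rewrite /= /c gP -mulmxA mulmxVp ?mulmx1 // row_base_free.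
Qed.

Lemma finite_enum (k : finFieldType) (V : lmodType k) : bijective (fcoord V) ->
  exists e : seq V, Finite.axiom e.
Proof.
move=> [g fg gf]; exists [seq g w | w <- enum 'rV[k]_(fdim V)]; apply: Finite.uniq_enumP.
  by rewrite (map_inj_uniq (can_inj gf)) enum_uniq.
by move=> v; apply/mapP; exists (fcoord V v); rewrite ?mem_enum ?fg.
Qed.

Lemma axiom_mem (T : eqType) (e : seq T) : Finite.axiom e -> forall x, x \in e.
Proof. by move=> eP x; rewrite -has_pred1 has_count eP. Qed.

Lemma index_pickleK (T : eqType) (e : seq T) : Finite.axiom e ->
  pcancel (fun x => index x e) (fun i => onth e i).
Proof.
move=> eP x; have xe := axiom_mem eP x; have iv : (index x e < size e)%N by rewrite index_mem.
by rewrite onthE (nth_map x) ?nth_index.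
Qed.

(** The finite structure is a function of the enumeration e, as e is extracted from a point at which
    some 1 / v does not vanish. *)
Definition fin_lmod (A : nzRingType) (V : lmodType A) (e : seq V) (eP : Finite.axiom e) :
  finLmodType A :=
  HB.pack (GRing.Lmodule.sort V) (isCountable.Build V (index_pickleK eP)) (isFinite.Build V eP).

Lemma fsum_finType (T : finType) (R : nmodType) (P : T -> Prop) (f : T -> R) :
  \sum_(x \in [set x | P x]) f x = \sum_(x | `[< P x >]) f x.
Proof.
rewrite -(@big_filter _ _ _ _ (index_enum T)) [RHS]fsbig_seq ?filter_uniq ?index_enum_uniq //.
suff -> : [set x | P x]%classic = [set` [seq x <- index_enum T | `[< P x >]]]%classic by [].
apply/seteqP; split=> x /=.
  by move=> Px; rewrite mem_filter mem_index_enum andbT; apply/asboolP.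
by rewrite mem_filter => /andP[/asboolP].
Qed.

(** * The graded ring and its presentation *)

Lemma invf_mulE (K : fieldType) (x y : K) : x != 0 -> y != 0 -> x + y != 0 ->
  x^-1 * y^-1 = (x + y)^-1 * (x^-1 + y^-1).
Proof.
move=> x0 y0 xy0; apply: (mulfI xy0); rewrite [RHS]mulrA mulfV // mul1r.
by rewrite mulrDl [x * _]mulrA mulfV // mul1r [y * _]mulrCA mulfV // mulr1 addrC.
Qed.

Section RVidentities.
Variables (k : fieldType) (V : lmodType k).

Fact RV_const_zmod : zmod_morphism (@RV_const k V).
Proof. by move=> x y; apply: val_inj; rewrite /= /KV_const mpolyCB tofracB. Qed.
Fact RV_const_monoid : monoid_morphism (@RV_const k V).
Proof.
split=> [|x y]; apply: val_inj; first by rewrite /= /KV_const mpolyC1 tofrac1.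
by rewrite /= /KV_const mpolyCM tofracM.
Qed.
HB.instance Definition _ := GRing.isZmodMorphism.Build k (RV V) (@RV_const k V) RV_const_zmod.
HB.instance Definition _ := GRing.isMonoidMorphism.Build k (RV V) (@RV_const k V) RV_const_monoid.

Lemma RV_inv0 : RV_inv (0 : V) = 0.
Proof. by apply: val_inj; rewrite /= /KV_inv linform0 tofrac0 invr0. Qed.

Lemma RV_invN (v : V) : RV_inv (- v) = - RV_inv v.
Proof.
apply: val_inj; rewrite /= /KV_inv -[- v]add0r linformB linform0 sub0r tofracN.
by rewrite invrN.
Qed.

Lemma RV_inv_mul (v w : V) : injective (fcoord V) -> v != 0 -> w != 0 -> v + w != 0 ->
  RV_inv v * RV_inv w = RV_inv (v + w) * (RV_inv v + RV_inv w).
Proof.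
move=> fI v0 w0 vw0; apply: val_inj; rewrite /= /KV_inv linformD.
have nz u : u != 0 -> tofrac (linform u) != 0 :> KV V.
  by rewrite tofrac_eq0; apply: contra_neq; apply: linform_eq0.
have := nz _ vw0; rewrite linformD tofracD => xy0.
exact: invf_mulE (nz v v0) (nz w w0) xy0.
Qed.
End RVidentities.

Section RAring.
Variables (k : finFieldType) (F : fieldExtType {fraction {poly k}}) (oo : place F).
Local Notation A := (coefring oo).
Variables (N : set A) (r : nat).
Local Notation V := (VNr N r).
Local Notation RVV := (RV (restr (constA oo) V)).

Local Notation tf := (@RV_const k (restr (constA oo) V)).
Local Notation tg := (constF F).

Lemma RA_embed : exists (al : {rmorphism RVV -> RA N r}) (ga : {rmorphism F -> RA N r}),
  [/\ forall v : V, al (RV_inv (v : restr (constA oo) V)) = RA_inv v,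
      forall c, ga c = RA_const N r c,
      forall c, al (RV_const _ c) = ga (constF F c) &
      forall P : RA N r -> Prop, (forall c, P (ga c)) -> (forall b, P (al b)) ->
        (forall x y, P x -> P y -> P (x + y)) -> (forall x y, P x -> P y -> P (x * y)) ->
        forall x, P x].
Proof.
have [al alE] := tensl_morph tf tg.
have [ga gaE] := tensr_morph tf tg.
have [p pE] := ringquot_pi_morph (@RA_rel k F oo N r).
exists (p \o al), (p \o ga); split=> [v|c|c|P PC PB PD PM x] /=.
- by rewrite pE alE.
- by rewrite pE gaE.
- have e : al (RV_const (restr (constA oo) V) c) = ga (constF F c).
    apply: etrans (alE _) _; apply: etrans (tens_const tf tg c) _; exact: esym (gaE _).
  by rewrite e.
rewrite -(ringquot_piK x) -pE.
elim/(@tens_ind k _ _ tf tg): (ringquot_repr x) => [c|b|y z Py Pz|y z Py Pz].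
- exact: eq_ind _ (fun z => P (p z)) (PC c) _ (gaE c).
- exact: eq_ind _ (fun z => P (p z)) (PB b) _ (alE b).
- by rewrite (rmorphD p); apply: PD.
- by rewrite (rmorphM p); apply: PM.
Qed.

Lemma RA_ind (P : RA N r -> Prop) :
  (forall c, P (RA_const N r c)) -> (forall v, P (RA_inv v)) ->
  (forall x y, P x -> P y -> P (x + y)) -> (forall x y, P x -> P y -> P (x * y)) ->
  forall x, P x.
Proof.
have [al [ga [alE gaE agree ind]]] := RA_embed => PC PV PD PM.
apply: ind => // [c|b]; first by rewrite gaE; apply: PC.
suff H z : RV_gen z -> forall b : RVV, RV_val b = z -> P (al b).
  by apply: H (erefl (RV_val b)); apply/asboolP/RV_valP.
move=> zR {b}; elim: zR => [c|v v0|x y xR IHx yR IHy|x y xR IHx yR IHy] b bE.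
- have -> : b = RV_const _ c by apply: val_inj.
  by rewrite agree gaE; apply: PC.
- have -> : b = @RV_inv k (restr (constA oo) V) v by apply: val_inj.
  by rewrite alE; apply: PV.
- have xP : x \in @RV_pred k (restr (constA oo) V) by apply/asboolP.
  have yP : y \in @RV_pred k (restr (constA oo) V) by apply/asboolP.
  have -> : b = MkRV xP + MkRV yP by apply: val_inj.
  by rewrite rmorphD; apply: PD; [apply: IHx|apply: IHy].
have xP : x \in @RV_pred k (restr (constA oo) V) by apply/asboolP.
have yP : y \in @RV_pred k (restr (constA oo) V) by apply/asboolP.
have -> : b = MkRV xP * MkRV yP by apply: val_inj.
by rewrite rmorphM; apply: PM; [apply: IHx|apply: IHy].
Qed.

Section Finite.
Variables (e : seq V) (eP : Finite.axiom e).
Local Notation X := (fin_lmod eP).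

Lemma Va_sum (R : nmodType) (a : A) (f : V -> R) :
  \sum_(v \in @Va k F oo N r a) f v = \sum_(u : X | a *: u == 0) f u.
Proof.
apply: etrans (@fsum_finType X R (fun v => Va a v) f) _; apply: eq_bigl => u.
by apply/asboolP/eqP => /VaE.
Qed.

Lemma RA_relation (a : A) (v : V) : Div N a -> a *: v <> 0 ->
  RA_const N r (coef_val a) * RA_inv (a *: v) = \sum_(u : X | a *: u == 0) RA_inv (v - u).
Proof.
move=> aN av.
have [p pE] := ringquot_pi_morph (@RA_rel k F oo N r).
have rel : RA_rel (RVF_inv (a *: v) (coef_val a)
            - \sum_(v' \in @Va k F oo N r a) RVF_inv (v - v') 1).
  by apply: RArel => // /VaE.
have := ringquot_rel rel.
rewrite -!pE Va_sum rmorph_sum => e1.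
have -> : \sum_(u : X | a *: u == 0) RA_inv (v - u) =
    \sum_(u : X | a *: u == 0) p (RVF_inv (v - u) 1).
  by apply: eq_bigr => u _; rewrite pE.
rewrite -e1; apply: etrans (mulrC _ _) _.
have e2 : p (RVF_inv (a *: v) (coef_val a)) = p (RVF_inv (a *: v) 1) * p (tens tf tg 1 (coef_val a)).
  exact: etrans (congr1 p (tensE tf tg _ _)) (rmorphM p _ _).
exact: esym (etrans e2 (congr2 *%R (pE _) (pE _))).
Qed.

Lemma RA_hom (S : comPzRingType) (al : {rmorphism RVV -> S}) (ga : {rmorphism F -> S}) :
  (forall c, al (RV_const _ c) = ga (constF F c)) ->
  (forall (a : A) (v : V), Div N a -> a *: v <> 0 ->
    ga (coef_val a) * al (RV_inv (a *: v : restr (constA oo) V)) =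
    \sum_(u : X | a *: u == 0) al (RV_inv (v - u : restr (constA oo) V))) ->
  exists h : {rmorphism RA N r -> S}, (forall c, h (RA_const N r c) = ga c) /\
    forall v, h (RA_inv v) = al (RV_inv (v : restr (constA oo) V)).
Proof.
move=> agree rel; have [h hE] := tensor_hom (f := tf) (g := tg) agree.
have hV v c : h (RVF_inv v c) = ga c * al (RV_inv (v : restr (constA oo) V)).
  exact: etrans (hE _ _) (mulrC _ _).
have hC c : h (tens tf tg 1 c) = ga c.
  by apply: etrans (hE _ _) _; rewrite rmorph1 mul1r.
have hR y : @RA_rel k F oo N r y -> h y = 0.
  case=> a v aN av; apply: etrans (rmorphB h _ _) _; apply/eqP; rewrite subr_eq0; apply/eqP.
  apply: etrans (hV _ _) _; apply: etrans (rel a v aN _) _; first by move/VaE.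
  apply: esym; apply: etrans (congr1 h (Va_sum a _)) _; apply: etrans (rmorph_sum h _ _ _) _.
  by apply: eq_bigr => u _; apply: etrans (hV _ _) _; rewrite rmorph1 mul1r.
have [q qE] := ringquot_hom hR.
exists q; split=> [c|v]; apply: etrans (qE _) _; first exact: hC.
by apply: etrans (hV _ _) _; rewrite rmorph1 mul1r.
Qed.
End Finite.
End RAring.

(** K is the fraction field of R / p. The quotient starts out as a possibly zero ring; the
    structures up to integral domain are added in turn, with inverses of units obtained by
    choice. *)
Lemma residue_field (R : comPzRingType) (p : set R) :
  p 0 -> (forall x y, p x -> p y -> p (x + y)) -> (forall a x, p x -> p (a * x)) ->
  ~ p 1 -> (forall x y, p (x * y) -> p x \/ p y) ->
  exists (K : fieldType) (ka : {rmorphism R -> K}), forall x, p x <-> ka x = 0.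
Proof.
move=> p0 pD pM p1 pP.
have spanP x : ideal_span p x <-> p x.
  split=> [|px]; last by rewrite -[x]mul1r -[1 * x]addr0; apply: IdealSpanD px (IdealSpan0 p).
  by elim=> // a g y pg _ py; apply: pD => //; apply: pM.
have [f fE] := ringquot_pi_morph p.
have fp x : f x = 0 <-> p x.
  rewrite -(rmorph0 f) !fE; split=> [/ringquot_piP|px]; first by rewrite subr0 => /spanP.
  by apply/ringquot_piP; rewrite subr0; apply/spanP.
have fS y : exists x, y = f x by exists (ringquot_repr y); rewrite fE ringquot_piK.
have S1 : (1 : ringquot p) != 0 by apply/eqP; rewrite -(rmorph1 f) => /fp.
pose S1m := GRing.PzSemiRing_isNonZero.Build (ringquot p) S1.
pose D1 : comNzRingType := HB.pack (ringquot p) S1m.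
pose un (x : D1) := `[< exists y, y * x = 1 >].
have /choice[iv ivP] : forall x : D1, exists y, if un x then y * x = 1 else y = x.
  move=> x; rewrite /un; case: asboolP => [[y yx]|_]; [by exists y|by exists x].
have mulV : {in un, left_inverse 1 iv *%R}.
  by move=> x ux; have := ivP x; rewrite (ux : un x = true).
have unP (x y : D1) : y * x = 1 -> x \in un.
  by move=> yx; apply/asboolP; exists y.
have ivO : {in [predC un], iv =1 id}.
  by move=> x ux; have := ivP x; rewrite (negbTE (ux : ~~ un x)).
pose Um := GRing.ComNzRing_hasMulInverse.Build D1 mulV unP ivO.
pose D2 : comUnitRingType := HB.pack D1 Um.
have dom (x y : D2) : x * y = 0 -> (x == 0) || (y == 0).
  have [a ->] := fS x; have [b ->] := fS y.
  have e : (f a : D2) * f b = f (a * b) := esym (rmorphM f a b).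
  rewrite e => /fp/pP[]/fp ->; rewrite eqxx ?orbT //.
pose Im := GRing.ComUnitRing_isIntegral.Build D2 dom.
pose D : idomainType := HB.pack D2 Im.
pose t : {rmorphism D -> {fraction D}} := tofrac (R:=D).
pose f' : {rmorphism R -> D} := f.
exists {fraction D}, (t \o f') => x; rewrite -fp /=; split=> [e|].
  by rewrite [f' x]e rmorph0.
by move/eqP; rewrite tofrac_eq0 => /eqP.
Qed.

Lemma mulr_monomial (R : comPzRingType) (T : Type) (c d : R) (f : T -> R) (s t : seq T) :
  c * \prod_(v <- s) f v * (d * \prod_(v <- t) f v) = c * d * \prod_(v <- s ++ t) f v.
Proof. by rewrite big_cat mulrACA. Qed.

(** * Homogeneous elements and homogeneous kernels *)

Section RAgrading.
Variables (k : finFieldType) (F : fieldExtType {fraction {poly k}}) (oo : place F).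
Local Notation A := (coefring oo).
Variables (N : set A) (r : nat).
Local Notation V := (VNr N r).
Local Notation kV := (restr (constA oo) V).

Lemma RA_const_morph : exists ga : {rmorphism F -> RA N r}, forall c, ga c = RA_const N r c.
Proof. by have [al [ga [_ gaE _ _]]] := @RA_embed k F oo N r; exists ga. Qed.

Lemma RA_inv0 : RA_inv (0 : V) = 0.
Proof.
have [al [ga [alE _ _ _]]] := @RA_embed k F oo N r.
by rewrite -alE -[RHS](rmorph0 al); congr (al _); apply: (@RV_inv0 k kV).
Qed.

Lemma RA_invN (v : V) : RA_inv (- v) = - RA_inv v.
Proof.
have [al [ga [alE _ _ _]]] := @RA_embed k F oo N r.
by rewrite -!alE -[RHS](rmorphN al); congr (al _); apply: (@RV_invN k kV).
Qed.

Lemma RA_inv_mul (v w : V) : injective (fcoord kV) -> v != 0 -> w != 0 -> v + w != 0 ->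
  RA_inv v * RA_inv w = RA_inv (v + w) * (RA_inv v + RA_inv w).
Proof.
have [al [ga [alE _ _ _]]] := @RA_embed k F oo N r => fI v0 w0 vw0.
rewrite -!alE -(rmorphD al) -!(rmorphM al); congr (al _).
exact: (@RV_inv_mul k kV).
Qed.

(** Without coordinates every linear form, hence every 1 / v, is 0. Finite dimensionality thus
    follows from the existence of a point. *)
Lemma fcoord_of_RA_inv (v : V) : RA_inv v <> 0 -> bijective (fcoord kV).
Proof.
have [//|l0 v0] := fcoord_dichotomy kV; case: v0.
have [al [ga [alE _ _ _]]] := @RA_embed k F oo N r.
rewrite -alE -[RHS](rmorph0 al); congr (al _); apply: val_inj.
by rewrite /= /KV_inv l0 tofrac0 invr0.
Qed.

Lemma homogD n (x y : RA N r) : RA_homog n x -> RA_homog n y -> RA_homog n (x + y).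
Proof.
move=> xh yh; elim: xh => [|c s z sz s0 _ IH]; first by rewrite add0r.
by rewrite -addrA; apply: RAhomogD.
Qed.

Lemma homog_monomial n c (s : seq V) : size s = n -> {in s, forall v, v != 0} ->
  RA_homog n (RA_const N r c * \prod_(v <- s) RA_inv v).
Proof. by move=> sz s0; rewrite -[X in RA_homog n X]addr0; apply: RAhomogD => //; apply: RAhomog0. Qed.

Lemma homog_const c : RA_homog 0 (RA_const N r c).
Proof.
have := @homog_monomial 0 c [::] erefl; rewrite big_nil mulr1; apply.
by move=> v; rewrite in_nil.
Qed.

Lemma RA_const1 : RA_const N r 1 = 1.
Proof. by have [ga gaE] := RA_const_morph; rewrite -gaE rmorph1. Qed.

Lemma RA_constM c d : RA_const N r (c * d) = RA_const N r c * RA_const N r d.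
Proof. by have [ga gaE] := RA_const_morph; rewrite -!gaE rmorphM. Qed.

Lemma homog_inv v : v != 0 -> RA_homog 1 (RA_inv v : RA N r).
Proof.
move=> v0; have := @homog_monomial 1 1 [:: v] erefl; rewrite big_seq1 RA_const1 mul1r.
by apply=> u; rewrite inE => /eqP->.
Qed.

Lemma monomialM c d (s t : seq V) :
  RA_const N r c * \prod_(v <- s) RA_inv v * (RA_const N r d * \prod_(v <- t) RA_inv v) =
  RA_const N r (c * d) * \prod_(v <- s ++ t) RA_inv v.
Proof.
exact: etrans (mulr_monomial _ _ _ s t) (congr1 (fun z => z * _) (esym (RA_constM c d))).
Qed.

Lemma homogM n m (x y : RA N r) : RA_homog n x -> RA_homog m y -> RA_homog (n + m) (x * y).
Proof.
have eqh (z z' : RA N r) : z = z' -> RA_homog (n + m) z' -> RA_homog (n + m) z by move->.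
move=> xh yh; elim: xh => [|c s z sz s0 _ IH].
  by apply: (eqh _ _ (mul0r y)); apply: RAhomog0.
apply: (eqh _ _ (mulrDl _ _ _)); refine (homogD _ IH).
elim: yh => [|d t w tz t0 _ IHw].
  by apply: (eqh _ _ (mulr0 _)); apply: RAhomog0.
apply: (eqh _ _ (mulrDr _ _ _)); refine (homogD _ IHw).
apply: (eqh _ _ (monomialM _ _ _ _)).
apply: homog_monomial; first by rewrite size_cat sz tz.
by move=> v; rewrite mem_cat => /orP[/s0|/t0].
Qed.

Lemma homog_prod (s : seq V) : {in s, forall v, v != 0} ->
  RA_homog (size s) (\prod_(v <- s) RA_inv v : RA N r).
Proof. by move=> s0; have := @homog_monomial _ 1 s erefl s0; rewrite RA_const1 mul1r. Qed.

Lemma homog_decomposition (x : RA N r) : exists s : seq (nat * RA N r),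
  x = \sum_(p <- s) p.2 /\ forall p, p \in s -> RA_homog p.1 p.2.
Proof.
elim/RA_ind: x => [c|v|x y [s [-> sh]] [t [-> th]]|x y [s [-> sh]] [t [-> th]]].
- exists [:: (0%N, RA_const N r c)]; rewrite big_seq1; split=> // p.
  by rewrite inE => /eqP->; apply: homog_const.
- have [->|v0] := eqVneq v 0.
    by exists [::]; rewrite big_nil RA_inv0; split=> // p; rewrite in_nil.
  exists [:: (1%N, RA_inv v)]; rewrite big_seq1; split=> // p.
  by rewrite inE => /eqP->; apply: homog_inv.
- exists (s ++ t); rewrite big_cat; split=> // p.
  by rewrite mem_cat => /orP[/sh|/th].
exists [seq ((p.1 + q.1)%N, p.2 * q.2) | p <- s, q <- t]; split.
  rewrite big_allpairs_dep mulr_suml; apply: eq_bigr => p _; rewrite mulr_sumr.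
  by apply: eq_bigr.
move=> _ /allpairsP[[p q] /= [ps qt ->]] /=.
by apply: homogM; [apply: sh|apply: th].
Qed.

(** The sum of the homogeneous parts of [RA] is not known here to be direct. But [de] records
    degrees as powers of X, so if [de x] = 0, the coefficients of [de x] show that each component of
    any decomposition of x is in the kernel of ka. *)
Lemma homog_kernel (K : fieldType) (ka : RA N r -> K) (de : {rmorphism RA N r -> {poly K}})
    (x : RA N r) :
  (forall n y, RA_homog n y -> de y = (ka y)%:P * 'X^n) -> de x = 0 ->
  exists s : seq (RA N r), x = \sum_(y <- s) y /\
    forall y, y \in s -> ka y = 0 /\ exists d, RA_gr d y.
Proof.
move=> deE dex.
have [s [xE sh]] := homog_decomposition x.
pose y i := \sum_(p <- s | p.1 == i) p.2.
have yh i : RA_homog i (y i).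
  rewrite /y big_seq_cond; apply: (big_ind (@RA_homog _ _ _ N r i)) => [|a b|p /andP[ps /eqP<-]].
  - exact: RAhomog0.
  - exact: homogD.
  - exact: sh.
pose M := (\max_(p <- s) p.1).+1.
have xy : x = \sum_(i < M) y i.
  rewrite xE /y (exchange_big_dep xpredT) //= big_seq [RHS]big_seq; apply: eq_bigr => p ps.
  have pM : (p.1 < M)%N by rewrite ltnS; apply: leq_bigmax_seq.
  by rewrite (big_pred1 (Ordinal pM)) // => i; rewrite -val_eqE eq_sym.
exists [seq y i | i : 'I_M]; split; first by rewrite big_image.
move=> _ /mapP[i _ ->]; split; last by exists (Posz i); apply: yh.
have := congr1 (fun q : {poly K} => q`_i) dex; rewrite xy rmorph_sum coef0.
under eq_bigr do rewrite (deE _ _ (yh _)).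
rewrite coef_sum (bigD1 i) //= coefCM coefXn eqxx mulr1 big1 ?addr0 // => j ji.
by rewrite coefCM coefXn eq_sym val_eqE (negPf ji) mulr0.
Qed.

Section Finite.
Variables (e : seq V) (eP : Finite.axiom e).
Local Notation X := (fin_lmod eP).
Variables (K : fieldType) (ka : {rmorphism RA N r -> K}).

(** The relations of [RA] are homogeneous of degree 1 in the 1 / v, so they survive replacing ka (1
    / v) by ka (1 / v) X. *)
Lemma RA_grading : exists de : {rmorphism RA N r -> {poly K}},
  forall n x, RA_homog n x -> de x = (ka x)%:P * 'X^n.
Proof.
have [al [ga [alE gaE agree _]]] := @RA_embed k F oo N r.
have [h [hC hV]] := RV_grading kV.
pose m : {rmorphism {poly RV kV} -> {poly K}} := map_poly (ka \o al).
have mC b : m b%:P = (ka (al b))%:P by rewrite [LHS]map_polyC.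
have mh (v : V) : m (h (RV_inv (v : kV))) = (ka (RA_inv v))%:P * 'X.
  have [->|v0] := eqVneq v 0.
    by rewrite RA_inv0 !(rmorph0 ka) mul0r [RV_inv _](@RV_inv0 k kV) !rmorph0.
  by rewrite hV // rmorphM mC [m 'X]map_polyX alE.
pose g : {rmorphism F -> {poly K}} := polyC \o (ka \o ga).
have [||de [deC deV]] := @RA_hom k F oo N r e eP {poly K} (m \o h) g.
- by move=> c; rewrite /= hC mC agree.
- move=> a v aN av; rewrite -[LHS]/(g _ * m (h _)) mh.
  have -> : \sum_(u : X | a *: u == 0) (m \o h) (RV_inv (v - u : kV)) =
      \sum_(u : X | a *: u == 0) (ka (RA_inv (v - u)))%:P * 'X.
    by apply: eq_bigr => u _; apply: mh.
  rewrite -mulr_suml -[\sum_(i | _) _](rmorph_sum polyC) -(rmorph_sum ka).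
  rewrite -(RA_relation eP aN av) (rmorphM ka) (rmorphM polyC) mulrA.
  by congr (_ * _ * _); rewrite -gaE.
exists de => n x; elim=> [|c s y sz s0 _ IH]; first by rewrite !rmorph0 mul0r.
rewrite !rmorphD IH mulrDl; congr (_ + _).
rewrite !rmorphM deC /= gaE -mulrA; congr (_ * _).
rewrite -sz; elim: s {sz s0} => [|v s IHs]; first by rewrite !big_nil !rmorph1 mul1r.
rewrite !big_cons !rmorphM IHs deV [X in X * _]mh exprS.
by rewrite mulrACA.
Qed.

End Finite.
End RAgrading.

(** * The homomorphisms attached to embeddings *)

Section Extension.
Variables (k : fieldType) (U V : lmodType k) (i : U -> V).
Hypothesis iD : forall u v, i (u + v) = i u + i v.
Hypothesis iZ : forall a u, i (a *: u) = a *: i u.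
Hypothesis iI : injective i.
Hypothesis UB : bijective (fcoord U).
Hypothesis VB : bijective (fcoord V).

Lemma RV_extension : exists h : {rmorphism RV U -> RV V},
  (forall c, h (RV_const U c) = RV_const V c) /\ forall u, h (RV_inv u) = RV_inv (i u).
Proof.
have [j [jD jZ ji]] := linear_retraction iD iZ iI UB VB.
have [si [siC siE]] := sym_map iD iZ UB.
have [sj [sjC sjE]] := sym_map jD jZ VB.
have sij p : sj (si p) = p.
  elim/mpoly_ind_gen: p => [c|l|p q IHp IHq|p q IHp IHq]; last first.
  - by rewrite !rmorphM IHp IHq.
  - by rewrite !rmorphD IHp IHq.
  - have [gU fgU gfU] := UB.
    have -> : 'X_l = linform (gU (delta_mx 0 l)).
      rewrite /linform gfU (bigD1 l) //= mxE !eqxx scale1r big1 ?addr0 // => m ml.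
      by rewrite mxE (negPf ml) andbF scale0r.
    by rewrite siE sjE ji.
  - by rewrite siC sjC.
have [|emb embE] := @fraction_lift _ (KV V) (tofrac (R:=mpoly (fdim V) k) \o si).
  by move=> p q /= /tofrac_inj/(congr1 sj); rewrite !sij.
pose c : {rmorphism k -> RV V} := @RV_const k V.
have [||x y x' y' /= xy xy'|x y x' y' /= xy xy'|x y y' /= xy|h [hC hV]] :=
    @RV_hom k U (RV V) c (fun u => RV_inv (i u)) (fun x y => emb x = RV_val y).
- by move=> a; rewrite /KV_const embE /= siC.
- by move=> v _; rewrite /KV_inv fmorphV embE /= siE.
- by rewrite rmorphD xy xy'.
- by rewrite rmorphM xy xy'.
- by rewrite xy; apply: val_inj.
exists h; split=> [a|u]; first exact: hC.
have [->|/hV//] := eqVneq u 0.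
have i0 : i 0 = 0 by apply: (addIr (i 0)); rewrite -iD !add0r.
by rewrite i0 !RV_inv0 rmorph0.
Qed.
End Extension.

Lemma sum_injection (T1 T2 : finType) (R : nmodType) (i : T1 -> T2) (P : pred T2)
    (G : T2 -> R) : injective i -> (forall u, P u -> (forall w, i w <> u) -> G u = 0) ->
  \sum_(u | P u) G u = \sum_(w | P (i w)) G (i w).
Proof.
move=> iI G0; rewrite [RHS](partition_big i P) //; apply: eq_bigr => u Pu.
case: (pickP (fun w => i w == u)) => [w /eqP wu|no].
  rewrite (big_pred1 w) ?wu // => x /=; rewrite -wu (inj_eq iI).
  by apply/andP/eqP => [[_ /eqP]//|->]; rewrite eqxx wu.
rewrite G0 // => [|w /eqP]; last by rewrite no.
by rewrite big_pred0 // => w; rewrite no andbF.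
Qed.

Lemma subr_shift (G : zmodType) (x y u v u0 : G) :
  y = v - (u0 + u) -> v = x + u0 -> x - y = u.
Proof. by move=> -> ->; rewrite addrKA subKr. Qed.

Section Embedding.
Variables (k : finFieldType) (F : fieldExtType {fraction {poly k}}) (oo : place F).
Local Notation A := (coefring oo).
Variables (N : set A) (n : A).
Hypothesis n0 : n != 0.
Hypothesis NE : forall x, N x <-> principal n x.
Variables (s r : nat) (i : {linear VNr N s -> VNr N r}).
Hypothesis iI : injective i.
Local Notation kU := (restr (constA oo) (VNr N s)).
Local Notation kV := (restr (constA oo) (VNr N r)).
Variables (e : seq (VNr N r)) (eP : Finite.axiom e).
Hypothesis VB : bijective (fcoord kV).
Local Notation ik := (i : kU -> kV).

Let ikD (u v : kU) : ik (u + v) = ik u + ik v. Proof. exact: (raddfD i). Qed.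
Let ikZ a (u : kU) : ik (a *: u) = a *: ik u. Proof. exact: (linearZZ i (constA oo a) u). Qed.

Lemma fcoord_bij_sub : bijective (fcoord kU).
Proof.
have /choice[g gP] : forall v : VNr N r, exists u : VNr N s, (exists u, i u = v) -> i u = v.
  by move=> v; have [[u uv]|no] := pselect (exists u, i u = v); [exists u|exists 0].
apply: (@fcoord_bij_finite k kU _ (fun u => fcoord kV (ik u)) [seq g v | v <- e]).
- by move=> u v; rewrite ikD fcoordD.
- by move=> a u; rewrite ikZ fcoordZ.
- by move=> u v /(bij_inj VB)/iI.
move=> u; apply/mapP; exists (i u); first exact: axiom_mem.
by apply: iI; rewrite gP //; exists u.
Qed.

Variables (es : seq (VNr N s)) (esP : Finite.axiom es).
Local Notation X := (fin_lmod eP).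
Local Notation Y := (fin_lmod esP).

(** The relation for a and v = i w + u0 with a u0 = 0 becomes the one for a and w after a
    translation by u0. For all other v both sides are 0: if a v = i w, then w = a w0 for some w0,
    and v - i w0 would be a-torsion. *)
Lemma pi_exists : exists f : {rmorphism RA N r -> RA N s}, is_pi i f.
Proof.
have [h [hC hi h0]] := RV_restriction ikD ikZ iI fcoord_bij_sub VB.
have [al [ga [alE gaE agree _]]] := @RA_embed k F oo N s.
pose T (v : VNr N r) : RA N s := al (h (RV_inv (v : kV))).
have Ti u : T (i u) = RA_inv u.
  have [->|u0] := eqVneq u 0; last by rewrite /T hi.
  rewrite RA_inv0 raddf0 /T -[RHS](rmorph0 al); congr (al _); rewrite -[RHS](rmorph0 h).
  by congr (h _); apply: (@RV_inv0 k kV).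
have T0 v : (forall u, i u <> v) -> T v = 0.
  move=> no; rewrite /T h0 ?rmorph0 //; apply/eqP => v0; apply: (no 0).
  by rewrite raddf0 v0.
have [||f [fC fV]] := @RA_hom k F oo N r e eP (RA N s) (al \o h) ga.
- by move=> c /=; rewrite hC agree.
- move=> a v aN av.
  change (ga (coef_val a) * T (a *: v) = \sum_(u : X | a *: u == 0) T (v - u)).
  have [[w [u0 [vE au0]]]|no] := pselect (exists w u0, v = i w + u0 /\ a *: u0 = 0).
    have avE : a *: v = i (a *: w) by rewrite vE scalerDr au0 addr0 linearZ.
    have aw : a *: w <> 0 by move=> aw; apply: av; rewrite avE aw raddf0.
    rewrite avE Ti gaE (RA_relation esP aN aw) (reindex_inj (@addrI X u0)).
    rewrite (@sum_injection Y X _ i) => [|//|u _ no].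
      apply: eq_big => [u|u _]; last by rewrite vE addrKA -raddfB Ti.
      by rewrite scalerDr au0 add0r -linearZ -(raddf0 i) (inj_eq iI).
    apply: T0 => u' u'E; apply: (no ((w : VNr N s) - u')).
    exact: etrans (raddfB i w u') (subr_shift u'E vE).
  rewrite big1 => [|u /eqP au]; last first.
    by apply: T0 => w wE; apply: no; exists w, u; split=> //; rewrite wE subrK.
  rewrite T0 ?mulr0 // => w wE; apply: no.
  have /(DivE NE)[a' nE] := aN.
  have a'w : a' *: w = 0.
    apply: iI; apply: etrans (linearZZ i a' w) _.
    by rewrite wE scalerA mulrC -nE raddf0; apply: (VNr_n n0 NE).
  have [w0 w0E] := VNr_div n0 NE (etrans nE (mulrC _ _)) a'w.
  exists w0, (v - i w0); split; first by rewrite subrKC.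
  by rewrite scalerBr -wE w0E linearZ subrr.
exists f; split=> [c|v _|v no]; first by rewrite fC gaE.
- by rewrite fV; apply: Ti.
by rewrite fV; apply: T0.
Qed.

(** The relation of [RA N s] at w follows from the one of [RA N r] at i w, since ka kills the
    summands outside the image of i. *)
Lemma factor_through_pi (K : fieldType) (ka : {rmorphism RA N r -> K}) :
  (forall v, (forall u, i u <> v) -> ka (RA_inv v) = 0) ->
  exists ka' : {rmorphism RA N s -> K},
    (forall c, ka' (RA_const N s c) = ka (RA_const N r c)) /\
    (forall u, ka' (RA_inv u) = ka (RA_inv (i u))).
Proof.
move=> ka0; have [h [hC hi]] := RV_extension ikD ikZ iI fcoord_bij_sub VB.
have [al [ga [alE gaE agree _]]] := @RA_embed k F oo N r.
have [||f [fC fV]] := @RA_hom k F oo N s es esP K (ka \o (al \o h)) (ka \o ga).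
- by move=> c /=; rewrite hC agree.
- move=> a w aN aw; pose T (u : VNr N s) : K := ka (al (h (RV_inv (u : kU)))).
  have TE u : T u = ka (RA_inv (i u)) by rewrite /T hi alE.
  change (ka (ga (coef_val a)) * T (a *: w) = \sum_(u : Y | a *: u == 0) T (w - u)).
  have iaw : i (a *: w) = a *: i w := linearZZ i a w.
  under eq_bigr do rewrite TE.
  rewrite TE gaE -rmorphM iaw (RA_relation eP aN) => [|aw0]; last first.
    by apply: aw; apply: iI; rewrite iaw aw0 raddf0.
  rewrite rmorph_sum (@sum_injection Y X _ i) => [|//|u _ no].
    apply: eq_big => [u|u _]; last by rewrite -raddfB.
    by rewrite -linearZ -(raddf0 i) (inj_eq iI).
  apply: ka0 => u' u'E; apply: (no ((w : VNr N s) - u')).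
  exact: etrans (raddfB i w u') (etrans (congr1 (fun z => i w - z) u'E) (subKr _ _)).
exists f; split=> [c|u]; first by rewrite fC /= gaE.
by rewrite fV /= hi alE.
Qed.
End Embedding.

(** * Homogeneous primes of the localization *)

Section LocalizationTheory.
Variables (R : comPzRingType) (G : set R).
Local Notation t x := (loc_frac x (loc_one G)).

Lemma loc_morph : exists f : {rmorphism R -> loc G}, forall x, f x = t x.
Proof.
apply: build_rmorphism => [x y|]; last split=> // x y; apply: esym.
  rewrite /loc_frac -[- loc_pi _]/(loc_opp _) loc_oppE.
  apply: etrans (loc_addE _ _) _; apply: loc_eq1 => /=; rewrite !mulr1.
  by [].
by apply: etrans (loc_mulE _ _) _; apply: loc_eq1 => /=; rewrite !mulr1.
Qed.

Lemma loc_frac_repr y : y = loc_frac (loc_repr y).1 (loc_repr y).2 :> loc G.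
Proof. by rewrite -[LHS]loc_piK; case: (loc_repr y). Qed.

Lemma loc_frac_den x (s : denom G) : loc_frac x s * t (val s) = t x.
Proof. by apply: etrans (loc_mulE _ _) _; apply: loc_eq1 => /=; rewrite !mulr1. Qed.

Lemma loc_unit s : submonoid G s -> exists z, z * t s = 1.
Proof. by move=> sS; exists (loc_frac 1 (mkdenom sS)); apply: (loc_frac_den 1 (mkdenom sS)). Qed.

Lemma loc_eqP x y : t x = t y -> exists2 u, submonoid G u & u * x = u * y.
Proof. by move/loc_piP => [u uS /=]; rewrite !mulr1; exists u. Qed.

(** The extension of p to the localization, tested on a chosen numerator; for a prime p avoiding G
    the choice does not matter, by [loc_extendE]. *)
Definition loc_extend (p : set R) : set (loc G) := fun y => p (loc_repr y).1.

Section Extend.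
Variable p : set R.
Hypotheses (p0 : p 0) (pD : forall x y, p x -> p y -> p (x + y)).
Hypotheses (pM : forall a x, p x -> p (a * x)) (p1 : ~ p 1).
Hypothesis pP : forall x y, p (x * y) -> p x \/ p y.
Hypothesis pG : forall g, G g -> ~ p g.

Lemma submonoid_notin s : submonoid G s -> ~ p s.
Proof. by elim=> [|g z Gg _ IH] //; case/pP => //; apply: pG. Qed.

Lemma loc_extendE x s : loc_extend p (loc_frac x s) <-> p x.
Proof.
have pMl a y : p (y * a) -> ~ p a -> p y by move/pP => [].
rewrite /loc_extend; have [u uS] := loc_reprP (x, s).
case: (loc_repr _) => y w /= e; split=> pxy.
  have : p (u * (y * val s)) by apply: (pM); rewrite mulrC; apply: pM.
  by rewrite e => /pP[/(submonoid_notin uS)//|/pMl]; apply; apply/submonoid_notin/denomP.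
have : p (u * (x * val w)) by apply: (pM); rewrite mulrC; apply: pM.
by rewrite -e => /pP[/(submonoid_notin uS)//|/pMl]; apply; apply/submonoid_notin/denomP.
Qed.

Lemma loc_extend_prime : [/\ loc_extend p 0 /\
    (forall x y, loc_extend p x -> loc_extend p y -> loc_extend p (x + y)),
  (forall a x, loc_extend p x -> loc_extend p (a * x)) &
  ~ loc_extend p 1 /\
    (forall x y, loc_extend p (x * y) -> loc_extend p x \/ loc_extend p y)].
Proof.
have frac (y : loc G) : exists x s, y = loc_frac x s.
  by exists (loc_repr y).1, (loc_repr y).2; apply: loc_frac_repr.
split.
- split=> [|y z]; first exact/(loc_extendE 0 (loc_one G)).
  have [x [s ->]] := frac y; have [x' [s' ->]] := frac z.
  move=> /loc_extendE xp /loc_extendE x'p.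
  have -> : loc_frac x s + loc_frac x' s' = loc_frac (x * val s' + x' * val s) (loc_den s s').
    exact: loc_addE.
  by apply/loc_extendE; apply: (pD); rewrite mulrC; apply: pM.
- move=> y z; have [x [s ->]] := frac y; have [x' [s' ->]] := frac z.
  move=> /loc_extendE x'p.
  have -> : loc_frac x s * loc_frac x' s' = loc_frac (x * x') (loc_den s s') by exact: loc_mulE.
  by apply/loc_extendE; apply: pM.
split=> [|y z]; first by move/(loc_extendE 1 (loc_one G)).
have [x [s ->]] := frac y; have [x' [s' ->]] := frac z.
have -> : loc_frac x s * loc_frac x' s' = loc_frac (x * x') (loc_den s s') by exact: loc_mulE.
by move/loc_extendE/pP => [] ?; [left|right]; apply/loc_extendE.
Qed.
End Extend.
End LocalizationTheory.

Lemma clear_step (R S : comPzRingType) (f : {rmorphism R -> S}) (T : Type) (g : T -> R)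
    (w w' : seq T) (x : R) (t : seq R) (y : S) (l : seq S) :
  y * f (\prod_(v <- w') g v) = f x ->
  (\sum_(z <- l) z) * f (\prod_(v <- w) g v) = f (\sum_(z <- t) z) ->
  (\sum_(z <- y :: l) z) * f (\prod_(v <- w' ++ w) g v) =
  f (\sum_(z <- x * \prod_(v <- w) g v :: [seq \prod_(v <- w') g v * z | z <- t]) z).
Proof.
move=> yE tE; rewrite !big_cons big_map -mulr_sumr big_cat rmorphD !rmorphM -yE -tE.
by rewrite mulrDl mulrA; congr (_ + _); rewrite mulrCA.
Qed.

Section Localized.
Variables (k : finFieldType) (F : fieldExtType {fraction {poly k}}) (oo : place F).
Local Notation A := (coefring oo).
Variables (N : set A) (s : nat).
Local Notation V := (VNr N s).
Local Notation prodinv w := (\prod_(v <- w) RA_inv v : RA N s).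

Lemma submonoid_prod (w : seq V) : {in w, forall v, v != 0} ->
  submonoid (@RA_invs k F oo N s) (prodinv w).
Proof.
elim: w => [|v w IH] w0; first by rewrite big_nil; apply: Submonoid1.
rewrite big_cons; apply: SubmonoidM; first by exists v; rewrite ?w0 ?mem_head.
by apply: IH => u uw; apply: w0; rewrite in_cons uw orbT.
Qed.

Lemma submonoid_seq u : submonoid (@RA_invs k F oo N s) u ->
  exists2 w : seq V, {in w, forall v, v != 0} & u = prodinv w.
Proof.
elim=> [|g z [v v0 ->] _ [w w0 ->]].
  by exists [::]; rewrite ?big_nil // => v; rewrite in_nil.
exists (v :: w); rewrite ?big_cons // => x; rewrite in_cons => /orP[/eqP->//|]; exact: w0.
Qed.

Variable q : set (RSA N s).
Hypothesis qP : Proj (@RSA_gr k F oo N s) q.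

Lemma RSA_notin u : submonoid (@RA_invs k F oo N s) u -> ~ q (RSA_of u).
Proof.
case: qP => _ qM [q1 _] _ _ /loc_unit[z zu] qu; apply: q1.
by rewrite -zu; apply: qM.
Qed.

Lemma RSA_of_morph : exists t : {rmorphism RA N s -> RSA N s}, forall x, t x = RSA_of x.
Proof. exact: loc_morph. Qed.

(** A homogeneous fraction of positive degree outside q has a nonzero numerator of positive degree,
    which involves some 1 / v; its image is a unit and not in q. *)
Lemma RSA_nonzero_vector : exists2 v : V, v != 0 & RA_inv v <> 0.
Proof.
have [t tE] := RSA_of_morph.
case: (qP) => -[q0 qD] qM _ _ [d [y [d0 [n [x [w [dE xh w0 yE]]]] yq]]].
have xq : ~ q (RSA_of x).
  have [z zw] := loc_unit (submonoid_prod w0).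
  move=> xq; apply: yq; rewrite -[y]mulr1 -zw -/(RSA_of _) mulrCA; apply: (qM).
  by rewrite yE.
case: xh dE xq => [_ []|c [|v l] y' ln l0 _ dE _]; first by rewrite -tE rmorph0.
  by move: d0; rewrite dE -ln /= sub0r Num.Theory.oppr_gt0.
exists v; first by rewrite l0 ?mem_head.
move=> v0; apply: (@RSA_notin (RA_inv v)); last by rewrite v0 -tE rmorph0.
rewrite -[RA_inv v]mulr1; apply: SubmonoidM (Submonoid1 _).
by exists v => //; rewrite l0 ?mem_head.
Qed.

Lemma RSA_clear (l : seq (RSA N s)) : (forall y, y \in l -> q y /\ exists d, RSA_gr d y) ->
  exists (w : seq V) (t : seq (RA N s)), [/\ {in w, forall v, v != 0},
    forall z, z \in t -> q (RSA_of z) /\ exists n, RA_homog n z &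
    (\sum_(y <- l) y) * RSA_of (prodinv w) = RSA_of (\sum_(z <- t) z)].
Proof.
case: qP => _ qM _ _ _; have [f fE] := RSA_of_morph.
elim: l => [|y l IH] lP.
  exists [::], [::]; split=> //; by rewrite !big_nil mul0r -fE rmorph0.
have [|w [t [w0 tP tE]]] := IH; first by move=> z zl; apply: lP; rewrite in_cons zl orbT.
have [yq [d [n [x [w' [dE xh w'0 yE]]]]]] := lP y (mem_head _ _).
exists (w' ++ w), (x * prodinv w :: [seq prodinv w' * z | z <- t]); split.
- by move=> v; rewrite mem_cat => /orP[/w'0|/w0].
- move=> z; rewrite in_cons => /orP[/eqP->|/mapP[{}z zt ->]].
    split; last by exists (n + size w)%N; apply: homogM => //; apply: homog_prod.
    by rewrite -fE rmorphM !fE -yE mulrC mulrA mulrC mulrA; apply: (qM).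
  have [zq [m zh]] := tP z zt; split; first by rewrite -fE rmorphM !fE; apply: qM.
  by exists (size w' + m)%N; apply: homogM => //; apply: homog_prod.
rewrite -!fE in yE tE *.
exact: clear_step yE tE.
Qed.

End Localized.

(** * The strata *)

Lemma rmorph_sum_eq0 (R S : pzRingType) (f : {rmorphism R -> S}) (l : seq R) :
  (forall x, x \in l -> f x = 0) -> f (\sum_(x <- l) x) = 0.
Proof. by move=> f0; rewrite rmorph_sum big_seq big1. Qed.

(** Cancels, in the domain K[X], the denominator g and the factor u coming from equality of
    fractions; their images are nonzero monomials. *)
Lemma clear_eq0 (R : comPzRingType) (K : fieldType) (de : {rmorphism R -> {poly K}})
    (u x g z : R) (a b : K) (m n : nat) : u * (x * g) = u * z -> de z = 0 ->
  de u = a%:P * 'X^m -> de g = b%:P * 'X^n -> a != 0 -> b != 0 -> de x = 0.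
Proof.
move=> /(congr1 de) + dz du dg a0 b0; rewrite !rmorphM dz mulr0 du dg => /eqP.
rewrite !mulf_eq0 !polyC_eq0 (negPf a0) (negPf b0) !expf_eq0 !polyX_eq0 !andbF !orbF.
by move/eqP.
Qed.

Section Strata.
Variables (k : finFieldType) (F : fieldExtType {fraction {poly k}}) (oo : place F).
Local Notation A := (coefring oo).
Variables (N : set A) (r : nat).

Lemma pi_homog s (i : {linear VNr N s -> VNr N r}) (f : {rmorphism RA N r -> RA N s}) n x :
  is_pi i f -> RA_homog n x -> RA_homog n (f x).
Proof.
case=> fC fi f0; elim=> [|c w y sz w0 _ IH]; first by rewrite rmorph0; apply: RAhomog0.
have eqh (z z' : RA N s) : z = z' -> RA_homog n z' -> RA_homog n z by move->.
apply: (eqh _ _ (rmorphD f _ _)); refine (homogD _ IH).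
have -> : f (RA_const N r c * \prod_(v <- w) RA_inv v) =
    RA_const N s c * \prod_(v <- w) f (RA_inv v).
  by apply: etrans (rmorphM f _ _) _; apply: congr2 (fC c) (rmorph_prod f _ _ _).
rewrite -[n]add0n; apply: homogM; first exact: homog_const.
rewrite -sz; elim: w w0 {sz} => [|v w IHw] w0.
  by rewrite big_nil -RA_const1; apply: homog_const.
rewrite big_cons -[size _]/(1 + size w)%N; apply: homogM; last first.
  by apply: IHw => u uw; apply: w0; rewrite in_cons uw orbT.
have [[u uv]|no] := pselect (exists u, i u = v).
  have u0 : u != 0.
    by apply: contraNneq (w0 v (mem_head _ _)) => u0; rewrite -uv u0 raddf0.
  by rewrite -uv fi //; apply: homog_inv.
by rewrite f0; [apply: RAhomog0|move=> u uv; apply: no; exists u].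
Qed.

Lemma OmegaW_supp (W : set (VNr N r)) p : OmegaW W p ->
  forall v, W v <-> v = 0 \/ ~ p (RA_inv v).
Proof.
case=> s [i [_ _ Wi [f [[fC fi f0] [q0 [q qP q0E] pE]]]]] v.
have [qq _ _ _ _] := qP; have [t tE] := @RSA_of_morph k F oo N s.
rewrite Wi; have [->|v0] := eqVneq v 0.
  by split=> _; [left|exists 0; rewrite raddf0].
split=> [[u uv]|[/eqP|]]; first last.
- move=> pv; apply: contrapT => no; apply: pv; apply/pE/q0E; rewrite f0 -?tE ?rmorph0; first exact: qq.1.
  by move=> u uv; apply: no; exists u.
- by rewrite (negPf v0).
have u0 : u != 0 by apply: contraNneq v0 => u0; rewrite -uv u0 raddf0.
right; rewrite -uv => /pE/q0E; rewrite fi //; apply: (RSA_notin qP).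
rewrite -[RA_inv u]mulr1; apply: SubmonoidM (Submonoid1 _); by exists u.
Qed.

Lemma OmegaW_disjoint (W W' : set (VNr N r)) p : OmegaW W p -> OmegaW W' p -> W = W'.
Proof.
move=> Wp W'p; apply/seteqP.
by split=> v; rewrite (OmegaW_supp Wp) (OmegaW_supp W'p).
Qed.

(** The point to prove is that the contraction of q is homogeneous. The image in the localization of
    an element of the contraction is a sum of homogeneous fractions in q; clearing denominators
    shows that [de \o f] kills the element, and [homog_kernel] applies. *)
Lemma OmegaW_QA (W : set (VNr N r)) p : OmegaW W p -> QA p.
Proof.
case=> s [i [_ iI _ [f [fpi [q0 [q qP q0E] pE]]]]].
have [[q_0 qD] qM [q1 qq] qh _] := qP; have [t tE] := @RSA_of_morph k F oo N s.
have pE' x : p x <-> q (t (f x)) by rewrite pE q0E tE.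
have [u u0 uinv] := RSA_nonzero_vector qP.
have [es esP] := finite_enum (fcoord_of_RA_inv uinv).
pose p' (y : RA N s) := q (t y).
have [|y z|a y|//||K [ka kaE]] := @residue_field _ p'.
- by rewrite /p' rmorph0.
- by rewrite /p' rmorphD; apply: qD.
- by rewrite /p' rmorphM; apply: qM.
- by rewrite /p' rmorph1.
- by move=> y z; rewrite /p' rmorphM; apply: qq.
have [de deE] := RA_grading esP ka.
have kaU (w : seq (VNr N s)) : {in w, forall v, v != 0} -> ka (\prod_(v <- w) RA_inv v) != 0.
  move=> w0; apply/eqP => /kaE; rewrite /p' tE.
  exact: RSA_notin qP _ (submonoid_prod w0).
have de0 y : q (t y) -> de y = 0.
  rewrite tE => /qh[l [yE lP]]; have [w [z [w0 zP zE]]] := RSA_clear qP lP.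
  rewrite -yE -!tE -(rmorphM t) !tE in zE.
  have [u' /submonoid_seq[w' w'0 ->] e] := loc_eqP zE.
  have dz : de (\sum_(x <- z) x) = 0.
    apply: rmorph_sum_eq0 => x /zP[xq [n xh]].
    have kx : ka x = 0 by apply: (iffLR (kaE x)); rewrite /p' tE.
    by apply: etrans (deE n x xh) _; rewrite kx mul0r.
  exact: clear_eq0 e dz (deE _ _ (homog_prod w'0)) (deE _ _ (homog_prod w0))
    (kaU w' w'0) (kaU w w0).
split.
- split=> [|x y]; first by rewrite pE' !rmorph0.
  by rewrite !pE' !rmorphD; apply: qD.
- by move=> a x; rewrite !pE' !rmorphM; apply: qM.
- split=> [|x y]; first by rewrite pE' !rmorph1.
  by rewrite !pE' !rmorphM; apply: qq.
- move=> x /pE' /de0 dex.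
  have [|l [xE lP]] := @homog_kernel k F oo N r K (ka \o f) (de \o f) x _ dex.
    by move=> n y yh; apply: deE; apply: pi_homog fpi yh.
  exists l; split=> [|y /lP[ky yh]]; first exact: xE.
  by split; [apply: (iffRL (pE' y)); apply: (iffRL (kaE _)); exact: ky|exact: yh].
have iu0 : i u != 0 by rewrite -(raddf0 i) (inj_eq iI).
exists 1, (RA_inv (i u)); split=> [//||/pE']; first exact: homog_inv.
have [_ fi _] := fpi; rewrite (fi u u0) tE; apply: (RSA_notin qP).
rewrite -[RA_inv u]mulr1; apply: SubmonoidM (Submonoid1 _); by exists u.
Qed.
End Strata.

(** * Points whose support is the image of an embedding *)

Section FreeStratum.
Variables (k : finFieldType) (F : fieldExtType {fraction {poly k}}) (oo : place F).
Local Notation A := (coefring oo).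
Variables (N : set A) (n : A).
Hypothesis n0 : n != 0.
Hypothesis NE : forall x, N x <-> principal n x.
Local Notation gen := (VN_gen n0 NE).

(** VN is cyclic with generator [gen] and annihilator n A, and n kills [VNr N r]; so the j-th copy
    of [gen] may be sent to [w j]. *)
Lemma free_embedding r d (w : 'I_d -> VNr N r) :
  (forall c : 'I_d -> A, \sum_j c j *: w j = 0 -> forall j, c j *: gen = 0) ->
  exists i : {linear VNr N d -> VNr N r}, injective i /\
    forall v, (exists u, i u = v) <-> exists c : 'I_d -> A, v = \sum_j c j *: w j.
Proof.
move=> ind; have /choice[cf cfP] := VN_genP n0 NE.
have congw a b v : a *: gen = b *: gen -> a *: v = b *: v :> VNr N r.
  move/eqP; rewrite -subr_eq0 -scalerBl => /eqP/VN_ann[y aby].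
  by apply/eqP; rewrite -subr_eq0 -scalerBl aby mulrC -scalerA (VNr_n n0 NE) scaler0.
pose g (v : VNr N d) : VNr N r := \sum_j cf ((v : {ffun 'I_d -> VN N}) j) *: w j.
have gB : zmod_morphism g.
  move=> u v; rewrite /g -sumrB; apply: eq_bigr => j _; rewrite -scalerBl; apply: congw.
  by rewrite scalerBl -!cfP !ffunE.
have gZ : scalable g.
  move=> a u; rewrite /g scaler_sumr; apply: eq_bigr => j _; rewrite scalerA; apply: congw.
  by rewrite -scalerA -!cfP !ffunE.
pose gBm := GRing.isZmodMorphism.Build (VNr N d) (VNr N r) g gB.
pose gZm := GRing.isScalable.Build A (VNr N d) (VNr N r) *:%R g gZ.
pose i : {linear VNr N d -> VNr N r} := HB.pack g gBm gZm.
exists i; split=> [|v].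
  apply: raddf_inj => u gu; apply/ffunP => j; rewrite [LHS]cfP ffunE.
  exact: ind gu j.
split=> [[u <-]|[c ->]]; first by exists (fun j => cf ((u : {ffun 'I_d -> VN N}) j)).
exists ([ffun j => c j *: gen] : {ffun 'I_d -> VN N}); apply: eq_bigr => j _.
by apply: congw; rewrite -cfP ffunE.
Qed.

Variables (r d : nat) (i : {linear VNr N d -> VNr N r}).
Hypothesis iI : injective i.
Local Notation kV := (restr (constA oo) (VNr N r)).
Variables (p : set (RA N r)) (K : fieldType) (ka : {rmorphism RA N r -> K}).
Hypothesis pQ : QA p.
Hypothesis kaE : forall x, p x <-> ka x = 0.
Hypothesis iE : forall v, (exists u, i u = v) <-> v = 0 \/ ka (RA_inv v) <> 0.

Lemma pi_surj (f : {rmorphism RA N r -> RA N d}) : is_pi i f -> forall y, exists x, f x = y.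
Proof.
case=> fC fi _; elim/RA_ind => [c|u|y z [x <-] [x' <-]|y z [x <-] [x' <-]].
- by exists (RA_const N r c).
- have [->|u0] := eqVneq u 0; first by exists 0; rewrite RA_inv0 rmorph0.
  by exists (RA_inv (i u)); rewrite fi.
- by exists (x + x'); rewrite rmorphD.
by exists (x * x'); rewrite rmorphM.
Qed.

(** ka factors as ka' o f with f = pi_i. The kernel of ka' contains no 1 / u with u != 0, so it
    extends to the localization; its homogeneity comes from p through the surjectivity of f. *)
Lemma stratum_QA (u1 : VNr N d) : u1 != 0 -> eps_Omega i p.
Proof.
move=> u10.
have ka1 : ka (RA_inv (i u1)) <> 0.
  have /iE[|//] : exists u, i u = i u1 by exists u1.
  by move/eqP; rewrite -(raddf0 i) (inj_eq iI) (negPf u10).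
have VB : bijective (fcoord kV).
  by apply: fcoord_of_RA_inv (i u1) _ => e; apply: ka1; rewrite e rmorph0.
have [e eP] := finite_enum VB.
have [es esP] := finite_enum (fcoord_bij_sub iI eP VB).
have [f fpi] := pi_exists n0 NE iI eP VB esP; have [fC fi f0] := fpi.
have [|ka' [kaC kaV]] := factor_through_pi iI eP VB esP (ka := ka).
  move=> v no; apply/eqP/negPn/negP => /eqP kv.
  by have [u uv] : exists u, i u = v; [apply/iE; right|apply: (no u)].
have ka'f x : ka' (f x) = ka x.
  elim/RA_ind: x => [c|v|x y xE yE|x y xE yE]; last 1 first.
  - by rewrite !rmorphM xE yE.
  - by rewrite fC kaC.
  - have [->|v0] := eqVneq v 0; first by rewrite RA_inv0 !rmorph0.
    have [[u uv]|no] := pselect (exists u, i u = v).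
      by rewrite -uv fi ?kaV //; apply: contraNneq v0 => u0; rewrite -uv u0 raddf0.
    rewrite f0 ?rmorph0; last by move=> u uv; apply: no; exists u.
    apply/esym/eqP/negPn/negP => /eqP kv; apply: no; apply/iE; by right.
  - by rewrite !rmorphD xE yE.
pose p' (y : RA N d) := ka' y = 0.
have [p'0 p'1] : p' 0 /\ ~ p' 1.
  by rewrite /p' rmorph0 rmorph1; split=> //; apply/eqP/oner_neq0.
have p'D x y : p' x -> p' y -> p' (x + y) by rewrite /p' rmorphD => -> ->; rewrite addr0.
have p'M a x : p' x -> p' (a * x) by rewrite /p' rmorphM => ->; rewrite mulr0.
have p'P x y : p' (x * y) -> p' x \/ p' y.
  by rewrite /p' rmorphM => /eqP; rewrite mulf_eq0 => /orP[]/eqP; [left|right].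
have p'G g : @RA_invs k F oo N d g -> ~ p' g.
  case=> u u0 ->; rewrite /p' kaV => kiu; have /iE[/eqP|//] : exists v, i v = i u by exists u.
  by rewrite -(raddf0 i) (inj_eq iI) (negPf u0).
have qE := @loc_extendE _ _ p' p'M p'1 p'P p'G.
have [qD qM qP] := loc_extend_prime p'0 p'D p'M p'1 p'P p'G.
have p'h y : p' y -> exists l : seq (RA N d), y = \sum_(z <- l) z /\
    forall z, z \in l -> p' z /\ exists m, RA_homog m z.
  have [x <-] := pi_surj fpi y; rewrite /p' ka'f => /kaE px.
  have [_ _ _ ph _] := pQ; have [l [xE lP]] := ph x px.
  exists [seq f z | z <- l]; split; first by rewrite big_map xE; apply: rmorph_sum.
  move=> _ /mapP[z /lP[pz [dg zh]] ->]; split; first by rewrite ka'f; apply: (iffLR (kaE _)).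
  case: dg zh => [m zh|m ->]; first by exists m; apply: pi_homog fpi zh.
  by exists 0%N; rewrite rmorph0; apply: RAhomog0.
exists f; split=> //; exists p'; last by move=> x; rewrite kaE /p' ka'f.
exists (loc_extend p'); last by move=> x; apply: iff_sym; apply: qE.
split=> // [y|]; last first.
  exists 1, (RSA_of (RA_inv u1)); split=> //.
    exists 1%N, (RA_inv u1), [::]; split=> //; first exact: homog_inv.
    have [t tE] := @RSA_of_morph k F oo N d.
    by rewrite big_nil -!tE rmorph1 mulr1.
  by move/qE; apply: p'G; exists u1.
rewrite (loc_frac_repr y) => /qE /p'h[l [xE lP]]; rewrite xE.
have [w w0 wE] := submonoid_seq (denomP (loc_repr y).2).
exists [seq loc_frac z (loc_repr y).2 | z <- l]; split.
  rewrite big_map; have [t tE] := @RSA_of_morph k F oo N d.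
  elim: l {xE lP} => [|z l IH]; first by rewrite !big_nil; apply: loc_eq1; rewrite /= !mul0r.
  rewrite !big_cons -IH; apply: esym; apply: etrans (loc_addE _ _) _.
  by apply/loc_eq1; rewrite /= -mulrDl mulrA.
move=> _ /mapP[z /lP[pz [m zh]] ->]; split; first exact/qE.
exists (m%:Z - (size w)%:Z), m, z, w; split=> //.
by rewrite -wE; apply: loc_frac_den.
Qed.
End FreeStratum.

Lemma rmorph_mulD (R S : pzRingType) (f : {rmorphism R -> S}) (x y z : R) :
  x * y = z * (x + y) -> f x * f y = f z * (f x + f y).
Proof. by move=> e; rewrite -rmorphD -!rmorphM e. Qed.

Lemma rmorph_mul_sum (R S : pzRingType) (f : {rmorphism R -> S}) (I : finType) (P : pred I)
    (g : I -> R) (x y : R) :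
  x * y = \sum_(i | P i) g i -> f x * f y = \sum_(i | P i) f (g i).
Proof. by move=> e; rewrite -rmorphM e rmorph_sum. Qed.

(** * A basis of the support of a point *)

Section SupportBasis.
Variables (k : finFieldType) (F : fieldExtType {fraction {poly k}}) (oo : place F).
Local Notation A := (coefring oo).
Variables (N : set A) (n : A).
Hypothesis n0 : n != 0.
Hypothesis NE : forall x, N x <-> principal n x.
Hypothesis N1 : ~ N 1.
Variable D : set A.
Hypothesis D_div : forall d, D d -> Div N d.
Hypothesis D_approx : forall a, a != 0 ->
  exists b, [/\ b != 0, submonoid D b & degA_lt (a - b) a].
Hypothesis D_pair : forall a b, D a -> D b -> a <> b -> Div N (a * b).
Hypothesis D_gen : forall a, Div N a -> submonoid D a.
Local Notation gen := (VN_gen n0 NE).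
Variables (r : nat) (e : seq (VNr N r)) (eP : Finite.axiom e).
Hypothesis r_gt0 : (0 < r)%N.
Local Notation kV := (restr (constA oo) (VNr N r)).
Hypothesis VB : bijective (fcoord kV).
Variables (K : fieldType) (ka : {rmorphism RA N r -> K}).

(** VN is enumerated by the first coordinates of the vectors of [VNr N r], as r is positive. *)
Lemma VN_enum : exists eE : seq (VN N), Finite.axiom eE.
Proof.
exists (undup [seq (v : {ffun 'I_r -> VN N}) (Ordinal r_gt0) | v : {ffun 'I_r -> VN N} <- e]).
apply: Finite.uniq_enumP (undup_uniq _) _ => z; rewrite mem_undup.
apply/mapP; exists ([ffun=> z] : {ffun 'I_r -> VN N}); first exact: axiom_mem.
by rewrite ffunE.
Qed.

Lemma char_torsion : exists2 l, prime l & forall (V : lmodType A) (z : V), z *+ l = 0.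
Proof.
have [l lP lk] := finPcharP k; exists l => // V z.
have l0 : l%:R = 0 :> A.
  by rewrite -(rmorph_nat (constA oo)) (pcharf0 lk) rmorph0.
by rewrite -scaler_nat l0 scale0r.
Qed.

Lemma gen_neq0 : gen != 0.
Proof.
apply/eqP => g0; apply: N1; apply/(mem_level NE)/(VN_ann n0 NE).
by rewrite scale1r.
Qed.

Lemma support_basis : exists d (w : 'I_d -> VNr N r), [/\ (d <= r)%N,
  forall c : 'I_d -> A, \sum_j c j *: w j = 0 -> forall j, c j *: gen = 0 &
  forall v, (exists c : 'I_d -> A, v = \sum_j c j *: w j) <-> v = 0 \/ ka (RA_inv v) <> 0].
Proof.
have [ga gaE] := @RA_const_morph k F oo N r.
pose vl : {rmorphism A -> F} := \val.
pose iota : {rmorphism A -> K} := (ka \o ga) \o vl.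
have iotaI : injective iota by move=> a b /fmorph_inj; apply: coef_valI.
pose rho (v : fin_lmod eP) : K := ka (RA_inv v).
have rho0 : rho 0 = 0 by rewrite /rho RA_inv0 rmorph0.
have rhoN v : rho (- v) = - rho v by rewrite /rho RA_invN rmorphN.
have rhoM v w : v != 0 -> w != 0 -> v + w != 0 -> rho v * rho w = rho (v + w) * (rho v + rho w).
  move=> v0 w0 vw0; exact: rmorph_mulD (RA_inv_mul (bij_inj VB) v0 w0 vw0).
have n_nonunit y : 1 <> y * n by move=> y1; apply: N1; apply/NE; exists y.
have divE a : Div N a <-> exists b, n = a * b := DivE NE a.
have rho_div a b v : n = a * b -> a *: v != 0 ->
    iota a * rho (a *: v) = \sum_(u | a *: u == 0) rho (v - u).
  move=> nab av; have aN : Div N a by apply/divE; exists b.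
  rewrite [iota a](congr1 ka (gaE _)).
  exact: rmorph_mul_sum (RA_relation eP aN (elimN eqP av)).
have nV (v : fin_lmod eP) : n *: v = 0 := VNr_n n0 NE v.
have divV a b (v : fin_lmod eP) : n = a * b -> a *: v = 0 -> exists w : fin_lmod eP, v = b *: w.
  by move=> nab av; have [w] := VNr_div n0 NE nab (av : a *: (v : VNr N r) = 0); exists w.
have D_div' d : D d -> exists b, n = d * b by move/D_div/divE.
have D_gen' a b : n = a * b -> submonoid D a by move=> nab; apply/D_gen/divE; exists b.
have D_pair' a b : D a -> D b -> a <> b -> exists c, n = a * b * c.
  by move=> aD bD ab; apply/divE/D_pair.
have D_approx' a : a != 0 -> exists b, submonoid D b /\
    (a - b = 0 \/ (degA (a - b)%R < degA a)%N).
  move=> /D_approx[b [_ bD /andP[_ /orP[/eqP|] ab]]]; exists b; split=> //; by [left|right].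
have [eE eEP] := VN_enum; pose E := fin_lmod eEP; have [l lP ltors] := char_torsion.
have cardp (M : finLmodType A) (Z : {set M}) : 0 \in Z -> {in Z &, forall u v, u - v \in Z} ->
    exists f, #|Z| = (l ^ f)%N.
  by move=> Z0 ZB; apply: (card_subgroup_pexp Z0 ZB lP) => m; apply: ltors.
have [up cardW] := cardp (fin_lmod eP) (supp_rho rho) (supp_rho0 _) (supp_rhoB rhoN rhoM).
have [sg] : exists f, #|finset.setTfor E| = (l ^ f)%N by apply: cardp => [|u v _ _]; rewrite finset.in_setT.
rewrite cardsT => cardE.
pose g : E := gen.
have genP (z : E) : exists a, z = a *: g := VN_genP n0 NE z.
have annP a : a *: g = 0 <-> exists b, a = n * b := VN_ann n0 NE a.
have icP (c : A) : c *: g != 0 -> exists2 a, (c * a) *: g = 0 &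
    forall u, c * a = n * u -> (c * u) *: g != 0 := @VN_int_closed k F oo N n n0 NE eE (axiom_mem eEP) c.
have annV (J : A -> Prop) a : (forall z : E, (forall j, J j -> j *: z = 0) -> a *: z = 0) ->
    forall v : fin_lmod eP, (forall j, J j -> j *: v = 0) -> a *: v = 0 := @VNr_ann k F oo N r J a.
have [d [w [wI cW]]] := exists_basis (n := n) (E := E) (e := g) (@coef_mulI k F oo) n0 gen_neq0
  genP annP icP
  (supp_rho0 rho) (supp_rhoB rhoN rhoM) (supp_rhoZ rho0 rhoN rhoM rho_div D_div' D_approx')
  (lamB rho0 rhoN rhoM) (lamI rho0 rhoN rhoM)
  (PhiD iotaI rho0 rhoN rhoM n0 n_nonunit rho_div divV D_div' D_gen' D_pair' D_approx')
  (PhiM iotaI rho0 rhoN rhoM n0 n_nonunit rho_div divV D_div' D_gen' D_pair' D_approx')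
  (Phi_additive iota rho0 rhoN rhoM D_approx')
  (Phi_lam rho0 rhoN rhoM rho_div D_div' D_approx')
  (Phi_neq0 iotaI rho0 rhoN rhoM D_approx')
  (size_Phi_gt1 iotaI rho0 rhoN rhoM D_approx')
  (size_Phi_n iotaI rho0 rhoN rhoM n0 n_nonunit rho_div nV divV D_div' D_gen' D_pair' D_approx')
  nV annV lP (ltors E) cardE cardW.
have spanE := spanned_all genP (supp_rho0 rho) (supp_rhoB rhoN rhoM)
  (supp_rhoZ rho0 rhoN rhoM rho_div D_div' D_approx') wI cW.
exists d, (fun j => w j); split; last 1 first.
- move=> v; apply: iff_trans (iff_sym (spanE v)) _; rewrite finset.in_set.
  by split=> [/orP[/eqP|/eqP]|[->|/eqP kv]]; [left|right|rewrite eqxx|rewrite kv orbT].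
(* The bound d <= r comes from #|E| ^ d = #|W| <= #|E| ^ r. *)
- have E1 : (1 < #|E|)%N.
    rewrite ltnNge; apply/negP => /card_le1_eqP E1.
    by have := gen_neq0; rewrite (E1 g 0) ?eqxx.
  rewrite -(leq_exp2l _ _ E1) -cW; apply: leq_trans (max_card _) _.
  rewrite -[r in leqRHS]card_ord -card_ffun leq_eqVlt; apply/orP; left; apply/eqP.
  by apply: (bij_eq_card (f := fun v : fin_lmod eP => (v : {ffun 'I_r -> E}))); exists id.
exact: wI.2.
Qed.
End SupportBasis.

Lemma rmorph_prod_eq0 (R : pzRingType) (K : fieldType) (f : {rmorphism R -> K}) (T : Type)
    (g : T -> R) (c y : R) (v : T) (s : seq T) :
  f (g v) = 0 -> f y = 0 -> f (c * \prod_(u <- v :: s) g u + y) = 0.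
Proof. by move=> v0 y0; rewrite rmorphD !rmorphM big_cons !rmorphM v0 y0 mul0r mulr0 addr0. Qed.

Lemma rmorph_homog_eq0 (k : finFieldType) (F : fieldExtType {fraction {poly k}})
    (oo : place F) (N : set (coefring oo)) (r : nat) (K : fieldType)
    (ka : {rmorphism RA N r -> K}) m x :
  (forall v, ka (RA_inv v) = 0) -> RA_homog m.+1 x -> ka x = 0.
Proof.
move=> ka0; elim=> [|c [//|v s] y _ _ _ IH]; first exact: rmorph0.
exact: rmorph_prod_eq0 (ka0 v) IH.
Qed.

Theorem theorem2p7p5 (k : finFieldType) (F : fieldExtType {fraction {poly k}})
    (oo : place F) (N : set (coefring oo)) (r : nat) :
  (1 <= r)%N -> nonzero_proper_ideal N -> level_assumption N ->
  (forall W W' : set (VNr N r),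
     nonzero_free_submodule W -> nonzero_free_submodule W' -> W <> W' ->
     forall p, ~ (OmegaW W p /\ OmegaW W' p)) /\
  (forall p : set (RA N r),
     QA p <-> exists W : set (VNr N r), nonzero_free_submodule W /\ OmegaW W p).
Proof.
move=> r0 [_ _ [x0 Nx0 x00] N1] [D [D_div D_approx D_pair D_gen [n NE]]].
split=> [W W' _ _ WW' p [Wp W'p]|p]; first exact: WW' (OmegaW_disjoint Wp W'p).
split=> [pQ|[W [_ /OmegaW_QA]]//].
have n0 : n != 0.
  by apply: contra_neq x00 => n0; have /NE[y ->] := Nx0; rewrite n0 mulr0.
have [[p_0 pD] pM [p1 pP] _ [d [x [d0 xh xp]]]] := pQ.
have [K [ka kaE]] := residue_field p_0 pD pM p1 pP.
(* Otherwise every element of positive degree would lie in p. *)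
have [v kv] : exists v, ka (RA_inv v) <> 0.
  apply: contrapT => no; apply: xp; apply/kaE.
  case: d d0 xh => [[//|m]|//] _ xh; apply: rmorph_homog_eq0 xh => v.
  by apply: contrapT => kv; apply: no; exists v.
have v0 : v != 0 by apply/eqP => v0; apply: kv; rewrite v0 RA_inv0 rmorph0.
have VB := fcoord_of_RA_inv (v := v) (fun e => kv (etrans (congr1 ka e) (rmorph0 ka))).
have [e eP] := finite_enum VB.
have [s [w [sr wI wE]]] := support_basis n0 NE N1 D_div D_approx D_pair D_gen eP r0 VB ka.
have [i [iI iE]] := free_embedding wI.
have [u uv] : exists u, i u = v by apply/iE/wE; right.
have u0 : u != 0 by apply: contra_neq v0 => u0; rewrite -uv u0 raddf0.
exists (fun v => exists u, i u = v); split.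
  split; first by exists v => //; exists u.
  by exists s, w; split=> // c /wI c0 j; apply/(mem_level NE)/(VN_ann n0 NE).
exists s, i; split=> //.
  (* An empty family spans 0 only, but v is nonzero. *)
  rewrite sr andbT lt0n; apply/eqP => s0; case/eqP: v0.
  have /iE[c ->] : exists u, i u = v by exists u.
  by rewrite big1 => [|[j j_lt] _] //; exfalso; move: j_lt; rewrite s0.
apply: (stratum_QA n0 NE iI pQ kaE _ u0) => y; exact: iff_trans (iE y) (wE y).
Qed.
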